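(* Let $\tilde\mu_1$ and $\tilde\mu_2$ be two probability measures on $(\Omega,\mathcal F)$, each of which is a backward $\mathrm{SHL}(0)$ process. Then $\tilde\mu_1=\tilde\mu_2$.
   Context: $\mathbb H=\{z\in\mathbb C:\operatorname{Im}z>0\}$. The slit map $\tilde s:\mathbb H\to\mathbb H\setminus[0,i]$ is the conformal map $\tilde s(z)=\sqrt{z^2-1}$ (where $[0,i]$ is the straight segment from $0$ to $i$), and for $x\in\mathbb R$, $\tilde s_x(z)=x+\tilde s(z-x)$. $\mathcal P$ is the space of discrete measures on $[0,\infty)\times\mathbb R$ with the Borel $\sigma$-algebra of the weak$^*$ topology with respect to continuous compactly supported functions. $\mathcal Z$ is the space of conformal maps from $\mathbb H$ onto subsets of $\mathbb H$, with the topology of uniform convergence on compact subsets. $\mathcal X$ is the space of cadlag functions from $[0,\infty)$ to $\mathcal Z$ with the Borel $\sigma$-algebra of the Skorohod topology. $\Omega=\mathcal P\times\mathcal X$ with the product $\sigma$-algebra $\mathcal F$. For $F\in\mathcal X$, $F_t$ is the function at time $t$ and $F_t(z)$ its value at $z$. A probability measure $\tilde\mu$ on $(\Omega,\mathcal F)$, the law of a pair $(\tilde P,\tilde F)$, is called a backward $\mathrm{SHL}(0)$ process if: (1) the marginal distribution of $\tilde P$ is that of an intensity $1$ Poisson process on $[0,\infty)\times\mathbb R$; (2) $\tilde\mu$-a.s. $\tilde F_0$ is the identity; (3) for every $0\le s<t$, $\tilde F_t\circ\tilde F_s^{-1}$ is measurable with respect to $\sigma(\tilde P|_{(s,t]\times\mathbb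 R})$; (4) writing $\tilde A$ for the set of atoms of $\tilde P$ and $\tilde A_{t,n}=\tilde A\cap\{(s,x):|x|\le n,\ s\le t\}$, $\tilde\mu$-a.s., for every $t\in[0,\infty)$ and $z\in\mathbb H$, $$\tilde F_t(z)=z+\lim_{n\to\infty}\sum_{(s,x)\in\tilde A_{t,n}}\left[\tilde s_x(\tilde F_{s-}(z))-\tilde F_{s-}(z)\right].$$ *)

(* Defs.v *)
From HB Require Import structures.
From mathcomp Require Import all_boot all_order all_algebra.
From mathcomp Require Import complex.
From mathcomp Require Import all_classical all_reals all_analysis.
From mathcomp Require Import measurable_realfun.

Set Implicit Arguments.
Unset Strict Implicit.
Unset Printing Implicit Defensive.

Import Order.TTheory GRing.Theory Num.Theory.
Import numFieldNormedType.Exports.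

Local Open Scope classical_set_scope.
Local Open Scope complex_scope.
Local Open Scope ring_scope.

Definition borel (T : ptopologicalType) := g_sigma_algebraType (@open T).

(** * Time and space-time *)

Definition time (R : realType) : Type := set_type `[0 : R, +oo[.

Section time.
Context {R : realType}.

HB.instance Definition _ := Topological.on (time R).

Definition tval (t : time R) : R := set_val t.

Lemma tval0_proof : (0 : R) \in `[0 : R, +oo[%classic.
Proof. by rewrite inE /= in_itv /= lexx. Qed.

Definition time0 : time R := exist _ 0 tval0_proof.

HB.instance Definition _ := isPointed.Build (time R) time0.

Lemma continuous_tval : continuous tval.
Proof. exact: initial_continuous. Qed.

Definition time_left (t : time R) := within [set u | tval u < tval t] (nbhs t).
Definition time_right (t : time R) := within [set u | tval t < tval u] (nbhs t).

End time.

Definition spacetime (R : realType) : Type := (time R * R)%type.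
HB.instance Definition _ (R : realType) := Topological.on (spacetime R).
HB.instance Definition _ (R : realType) := Pointed.on (spacetime R).
HB.instance Definition _ (R : realType) :=
  Measurable.copy (spacetime R) (borel (spacetime R)).

Section spacetime.
Context {R : realType}.

(* Lebesgue measure on [0, +oo[ x R. *)
Definition area (B : set (spacetime R)) : \bar R :=
  (lebesgue_measure \x lebesgue_measure)%E [set (tval p.1, p.2) | p in B].

Definition strip (s t : time R) : set (spacetime R) :=
  [set p | tval s < tval p.1 <= tval t].

Let measurable_open (U : set (spacetime R)) : open U -> measurable U.
Proof. exact: sub_sigma_algebra. Qed.

Let measurable_closed (U : set (spacetime R)) : closed U -> measurable U.
Proof.
move=> cU; rewrite -[U]setCK; apply: measurableC; apply: measurable_open.
exact: closed_openC.
Qed.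

Let coord (p : spacetime R) : R * R := (tval p.1, p.2).

Let continuous_coord : continuous coord.
Proof.
move=> p.
have h1 : tval q.1 @[q --> p] --> tval p.1.
  apply: (@continuous_comp _ _ _ fst tval); first exact: cvg_fst.
  exact: continuous_tval.
have h2 : q.2 @[q --> p] --> p.2 by exact: cvg_snd.
exact: (cvg_pair h1 h2).
Qed.

Let hausdorff_spacetime : hausdorff_space (spacetime R).
Proof.
move=> p q pq; suff : coord p = coord q.
  case: p q {pq} => [p1 p2] [q1 q2] [] /= pq1 ->.
  by congr pair; exact: val_inj.
apply: (@norm_hausdorff _ (R * R)%type) => A B Ap Bq.
have [r [Ar Br]] := pq _ _ (continuous_coord Ap) (continuous_coord Bq).
by exists (coord r).
Qed.

Lemma measurable_compact (K : set (spacetime R)) : compact K -> measurable K.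
Proof.
move=> cK; apply: measurable_closed; apply: compact_closed cK.
exact: hausdorff_spacetime.
Qed.

Lemma measurable_countable (A : set (spacetime R)) :
  countable A -> measurable A.
Proof.
move=> /countable_injP[f injf].
have -> : A = \bigcup_n (A `&` f @^-1` [set n]).
  by apply/seteqP; split=> [p Ap|p [n _ []]//]; exists (f p).
apply: bigcup_measurable => n _.
have [->|/set0P[p [Ap fp]]] := eqVneq (A `&` f @^-1` [set n]) set0.
  exact: measurable0.
suff -> : A `&` f @^-1` [set n] = [set p].
  apply: measurable_closed; apply: compact_closed.
    exact: hausdorff_spacetime.
  exact: compact_set1.
apply/seteqP; split=> [q [Aq fq]|_ ->]; last by [].
by apply: injf; rewrite ?inE// fq fp.
Qed.

Lemma measurable_strip s t : measurable (strip s t).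
Proof.
have ct : continuous (fun p : spacetime R => tval p.1).
  move=> p; apply: (@continuous_comp _ _ _ fst tval); first exact: cvg_fst.
  exact: continuous_tval.
have mo a : measurable [set p : spacetime R | a < tval p.1].
  apply: measurable_open.
  by apply: (@open_comp _ _ _ [set x | a < x]) => // *; exact: ct.
have -> : strip s t =
    [set p | tval s < tval p.1] `\` [set p | tval t < tval p.1].
  apply/seteqP; split=> p /=; first case/andP=> sp tp.
    by split=> //; apply/negP; rewrite -leNgt.
  by case=> sp /negP tp; apply/andP; split=> //; rewrite leNgt.
exact: measurableD.
Qed.

End spacetime.

(** * Discrete measures *)

(* Discrete: carried by a countable set, with arbitrary weights. Local
   finiteness is what makes the weak* topology on test functions meaningful.
   The values of a library measure outside the Borel sets are arbitrary, but
   integrals, hence the topology below and its Borel sets, ignore them. *)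
Record pmeas (R : realType) := PMeas {
  pm :> {measure set (spacetime R) -> \bar R};
  pm_locally_finite : forall K, compact K -> (pm K < +oo)%E;
  pm_discrete : exists2 A, countable A & pm (~` A) = 0%E }.

Record test_fun (R : realType) := TestFun {
  tf :> spacetime R -> R;
  tf_continuous : continuous tf;
  tf_compact : compact (closure [set p | tf p != 0]) }.

Section pmeas.
Context {R : realType}.

HB.instance Definition _ := gen_eqMixin (pmeas R).
HB.instance Definition _ := gen_choiceMixin (pmeas R).
HB.instance Definition _ := gen_eqMixin (test_fun R).
HB.instance Definition _ := gen_choiceMixin (test_fun R).

Definition weak_ev (m : pmeas R) : {ptws test_fun R -> R} :=
  fun f => \int[m]_p f p.

HB.instance Definition _ :=
  Topological.copy (pmeas R) (initial_topology weak_ev).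

Lemma pmeas0_finite (K : set (spacetime R)) :
  compact K -> (mzero K < +oo :> \bar R)%E.
Proof. by move=> _; rewrite /mzero ltry. Qed.

Lemma pmeas0_discrete :
  exists2 A : set (spacetime R), countable A & mzero (~` A) = 0%E :> \bar R.
Proof. by exists set0. Qed.

HB.instance Definition _ :=
  isPointed.Build (pmeas R) (PMeas pmeas0_finite pmeas0_discrete).

Section restriction.
Variables (s t : time R) (m : pmeas R).

Let r : {measure set (spacetime R) -> \bar R} :=
  mrestr m (measurable_strip s t).

Let r_finite K : compact K -> (r K < +oo)%E.
Proof.
move=> cK; have mK := measurable_compact cK.
apply: le_lt_trans (pm_locally_finite m cK).
by apply: le_measure; rewrite ?inE //; apply: measurableI => //;
  exact: measurable_strip.
Qed.

Let r_discrete : exists2 A, countable A & r (~` A) = 0%E.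
Proof.
have [A cA mA0] := pm_discrete m; exists A => //.
have mA : measurable A by exact: measurable_countable.
apply/eqP; rewrite eq_le measure_ge0 andbT -mA0.
by apply: le_measure; rewrite ?inE //; [apply: measurableI => //;
  [exact: measurableC|exact: measurable_strip]|exact: measurableC].
Qed.

(* Restriction of [m] to (s, t] x R. *)
Definition prestr : pmeas R := PMeas r_finite r_discrete.

End restriction.

Definition atoms (m : pmeas R) : set (spacetime R) :=
  [set p | (0 < m [set p])%E].

Definition atoms_upto (m : pmeas R) (t : time R) (n : nat) :=
  atoms m `&` [set p | `|p.2| <= n%:R /\ tval p.1 <= tval t].

End pmeas.

(** * Conformal maps *)

Section conformal.
Variable (R : realType).
Local Notation C := (R[i]^o).

Definition upper_half_plane : set C := [set z | 0 < complex.Im z].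
Definition uhp : Type := set_type upper_half_plane.
HB.instance Definition _ := Uniform.on uhp.
Definition uval (z : uhp) : C := set_val z.

Lemma open_upper_half_plane : open upper_half_plane.
Proof.
rewrite openE => z /= z0; apply/nbhs_ballP; exists (complex.Im z)%:C => /=.
  by rewrite ltcR.
case: z z0 => [a b] /= b0 [c d]; rewrite -ball_normE /= normc_def ltcR /= => h.
have {}h : b - d < b.
  apply: le_lt_trans (ler_norm _) (le_lt_trans _ h).
  by rewrite -sqrtr_sqr ler_wsqrtr// lerDr sqr_ge0.
by rewrite ltrBlDr ltrDl in h.
Qed.

(* Complex differentiability is tested on the extension of [f] by 0 to C. *)
Definition conformal (f : uhp -> uhp) :=
  (forall z : uhp, derivable ('valL_ 0 (uval \o f) : C -> C) (uval z) 1) /\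
  injective f.

Lemma conformal_id : conformal id.
Proof.
split=> // z; apply: (@near_eq_derivable _ _ _ (id : C -> C)); last first.
  by apply: derivable_id.
have Hz : upper_half_plane (uval z) := set_mem (valP z).
apply: filterS (open_nbhs_nbhs (conj open_upper_half_plane Hz)) => w Hw.
exact: esym (congr1 (@^~ (exist _ w (mem_set Hw))) (valLK 0 (uval \o id))).
Qed.

Definition confmap : Type :=
  set_type [set f : {family compact, uhp -> uhp} | conformal f].
HB.instance Definition _ := Uniform.on confmap.
HB.instance Definition _ :=
  isPointed.Build confmap (exist _ id (mem_set conformal_id)).
Definition cfun (f : confmap) : uhp -> uhp := set_val f.

(* [sqrtC] is the branch of the square root with nonnegative imaginary part. *)
Definition slit_map (z : C) : C := sqrtC (z ^+ 2 - 1).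
Definition slit_map_at (x : R) (z : C) : C := x%:C + slit_map (z - x%:C).

End conformal.

(** * The Skorohod space *)

Section skorohod.
Variables (R : realType) (V : uniformType).

Record cadlag := Cadlag {
  traj :> time R -> V;
  traj_right : forall t, traj @ time_right t --> traj t;
  traj_left : forall t, exists l : V, traj @ time_left t --> l }.

HB.instance Definition _ := gen_eqMixin cadlag.
HB.instance Definition _ := gen_choiceMixin cadlag.

(* An increasing bijection of [0, +oo[. *)
Definition time_change (l : time R -> time R) :=
  {homo l : s t / tval s < tval t} /\ forall t, exists s, l s = t.

(* y_n --> x in the Skorohod topology on [0, +oo[ iff for every T there are
   time changes l_n such that, uniformly in t <= T, l_n t - t --> 0 and
   x (l_n t) is close to y_n t (Ethier and Kurtz, Markov Processes,
   Proposition 3.5.3). The topology is metrizable when V is, so its open sets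
   are the sequentially open ones for this convergence, which are the sets
   below. *)
Definition skorohod_nbhd (x : cadlag) (T d : R) (E : set (V * V)) :
  set cadlag :=
  [set y | exists2 l, time_change l &
    forall t, tval t <= T -> `|tval (l t) - tval t| < d /\ E (x (l t), y t)].

Definition skorohod_open : set_system cadlag := [set U | forall x, U x ->
  exists T d E, [/\ 0 < d, entourage E & skorohod_nbhd x T d E `<=` U]].

Lemma skorohod_openT : skorohod_open setT.
Proof.
move=> x _; exists 0, 1, setT; split=> //; exact: entourageT.
Qed.

Lemma skorohod_openI : setI_closed skorohod_open.
Proof.
move=> A B oA oB x [/oA[T [d [E [d0 eE sA]]]] /oB[T' [d' [E' [d'0 eE' sB]]]]].
exists (Num.max T T'), (Num.min d d'), (E `&` E'); split.
- by rewrite lt_min d0.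
- exact: filterI.
- move=> y [l lc ly]; split; [apply: sA|apply: sB]; exists l => // t tT.
  + have [|+ []] := ly t; first by rewrite le_max tT.
    by rewrite lt_min => /andP[].
  + have [|+ []] := ly t; first by rewrite le_max tT orbT.
    by rewrite lt_min => /andP[].
Qed.

Lemma skorohod_open_bigcup (I : Type) (f : I -> set cadlag) :
  (forall i, skorohod_open (f i)) -> skorohod_open (\bigcup_i f i).
Proof.
move=> of_ x [i _ /of_[T [d [E [d0 eE sf]]]]].
by exists T, d, E; split=> // y /sf fy; exists i.
Qed.

HB.instance Definition _ := isOpenTopological.Build cadlag
  skorohod_openT skorohod_openI skorohod_open_bigcup.

End skorohod.

Section paths.
Variable R : realType.

Lemma cst_right (t : time R) :
  (fun=> point) @ time_right t --> (point : confmap R).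
Proof. exact: cvg_cst. Qed.

Lemma cst_left (t : time R) :
  exists l : confmap R, (fun=> point) @ time_left t --> l.
Proof. by exists point; exact: cvg_cst. Qed.

HB.instance Definition _ :=
  isPointed.Build (cadlag R (confmap R)) (Cadlag cst_right cst_left).

End paths.

Definition Omega (R : realType) : Type :=
  (borel (pmeas R) * borel (cadlag R (confmap R)))%type.
HB.instance Definition _ (R : realType) := Measurable.on (Omega R).

Section SHL.
Variable R : realType.
Local Notation C := (R[i]^o).

Definition Pt (w : Omega R) : pmeas R := w.1.
Definition Ft (w : Omega R) : cadlag R (confmap R) := w.2.

Definition value (w : Omega R) (t : time R) (z : uhp R) : uhp R :=
  cfun (Ft w t) z.

(* At t = 0 the filter is trivial and this value is unspecified; almost surely
   no atom of the Poisson process lies on {0} x R. *)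
Definition left_value (w : Omega R) (t : time R) (z : uhp R) : uhp R :=
  cfun (lim (Ft w @ time_left t)) z.

(* Poisson process of intensity 1. The library's [poisson_pmf] is not used as
   it is constantly 1 at rate 0. *)
Definition poisson_law (nu : set (borel (pmeas R)) -> \bar R) :=
  (forall B k, measurable B -> (area B < +oo)%E ->
    nu [set m : pmeas R | m B = k%:R%:E] =
      (expR (- fine (area B)) * fine (area B) ^+ k / k`!%:R)%:E) /\
  (forall n (B : 'I_n -> set (spacetime R)) (S : 'I_n -> set (\bar R)),
    (forall i, measurable (B i)) -> trivIset setT B ->
    (forall i, measurable (S i)) ->
    nu [set m : pmeas R | forall i, S i (m (B i))] =
      (\prod_(i < n) nu [set m : pmeas R | S i (m (B i))])%E).

Definition sigma_P (s t : time R) : set_system (Omega R) :=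
  preimage_set_system setT (fun w => prestr s t (Pt w) : borel (pmeas R))
    measurable.

(* The map F_t \o F_s^-1 is defined on the random domain F_s(H); it is viewed
   as a random element G of the space of conformal maps of H, the one such that
   F_t = G \o F_s, unique because F_s(H) is open and nonempty. As F is not a
   function of P on Omega, the identity can only hold almost surely. *)
Definition increment_measurable (mu : probability (Omega R) R) :=
  forall s t : time R, tval s < tval t ->
  exists G : Omega R -> confmap R,
    (forall A : set (borel (confmap R)), measurable A ->
      sigma_P s t (G @^-1` A)) /\
    {ae mu, forall w, forall z, value w t z = cfun (G w) (value w s z)}.

(* Almost surely [atoms_upto] is finite; the sum over an infinite set of
   nonzero terms is 0 by convention. *)
Definition SHL_equation (w : Omega R) := forall (t : time R) (z : uhp R),
  (fun n => uval z + \sum_(p \in atoms_upto (Pt w) t n)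
     (slit_map_at p.2 (uval (left_value w p.1 z)) -
      uval (left_value w p.1 z)) : C) @ \oo
  --> uval (value w t z).

Record backward_SHL0 (mu : probability (Omega R) R) : Prop := BackwardSHL0 {
  SHL_poisson : poisson_law (pushforward mu fst);
  SHL_start : {ae mu, forall w, forall z, value w time0 z = z};
  SHL_increments : increment_measurable mu;
  SHL_driven : {ae mu, forall w, SHL_equation w} }.

End SHL.

(* Main.v *)
(* Call an event P-measurable if, up to null sets of both laws, it belongs to the
   sigma-algebra generated by the numbers of points of P in dyadic boxes. On this
   sigma-algebra the two laws agree, by the definition of a Poisson process, so it
   is enough to show that every event is P-measurable.

   By (3) with s = 0, at a fixed dyadic time F_t is under each law a measurable
   function of P, but a priori not the same function G1, G2 under the two laws.
   At dyadic times, equation (4) reads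
     f_t = z + lim_n lim_k (sum of the kicks of the boxes of level k charged by P,
       at spatial distance at most n, evaluated along f),
   a relation between P and countably many variables. It holds for G1 and G2
   almost surely, under either law because it is P-measurable, and it determines
   f: the kick s_x(w) - w at x is Lipschitz in w with constant O(1 / (1 + |x|)^2)
   away from the real line, the weighted measure rho = sum_m 4^-m P(. , |x| <= 2^m)
   is finite on bounded time intervals, and a Gronwall argument with respect to the
   clock rho applies. Hence G1 = G2 and every event {F_t(z) in U} is P-measurable.

   Finally, an open set of the Skorohod space is a countable union of sets
   described by countably many such events: up to a time T, the path stays in V_0,
   jumps into V_1 in the dyadic interval [a, b], stays in V_1, and so on, where
   the V_i are taken from a countable network of closed sets of conformal maps
   (each of finitely many open discs is mapped into a small closed disc). *)
Require Import Defs.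
From HB Require Import structures.
From mathcomp Require Import all_boot all_order all_algebra.
From mathcomp Require Import complex.
From mathcomp Require Import all_classical all_reals all_analysis.
From mathcomp Require Import measurable_realfun.
From mathcomp Require Import ring lra zify.
(* Once more, as [tval] must not denote the one of tuples. *)
Require Import Defs.

Set Implicit Arguments.
Unset Strict Implicit.
Unset Printing Implicit Defensive.

Import Order.TTheory GRing.Theory Num.Theory.
Import numFieldNormedType.Exports.

Local Open Scope classical_set_scope.
Local Open Scope complex_scope.
Local Open Scope ring_scope.

(** * The slit map *)

(** Pathwise uniqueness compares two flows driven by the same points, while the two laws offer two
    flows without a common probability space. Condition (3) replaces a coupling: it turns each flow
    into a function on [Omega] that makes sense under the other law too, so both can be compared at
    the same [w]. Since (3) has an exceptional null set for each time, only countably many times can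
    be used; dyadic ones are convenient because restricting to (0, t] keeps or discards whole boxes
    of a fine level. The kicks are not absolutely summable: a kick is of order 1 / |x| and the
    points have density 1. The difference of the kicks of two solutions is of order 1 / x^2, so the
    estimates concern differences only, and convergence itself is always taken from (4). The weight
    4^-m is this 1 / x^2 on the window |x| <= 2^m, whose expected number of points grows only like
    2^m. The left limits in (4) are taken at random times; sampling at the left end of each dyadic
    time cell replaces these by fixed times and still uses only values strictly before the jump, as
    the Gronwall argument requires. *)

Section complex_norm.
Variable R : realType.
Implicit Types z w : R[i].

(** The norm [|z|] of [R[i]] is itself an element of [R[i]]; a real-valued modulus keeps the
    estimates in the reals, where [lra] applies. *)
Definition cnorm z : R := Num.sqrt (complex.Re z ^+ 2 + complex.Im z ^+ 2).

Lemma cnormE z : `|z| = (cnorm z)%:C.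
Proof. exact: normc_def. Qed.

Lemma cnorm_ge0 z : 0 <= cnorm z.
Proof. exact: sqrtr_ge0. Qed.

Lemma cnormD z w : cnorm (z + w) <= cnorm z + cnorm w.
Proof. by rewrite -lecR rmorphD /= -!cnormE ler_normD. Qed.

Lemma cnormN z : cnorm (- z) = cnorm z.
Proof. by apply: complexI; rewrite -!cnormE normrN. Qed.

Lemma cnormB z w : cnorm (z - w) = cnorm (w - z).
Proof. by rewrite -cnormN opprB. Qed.

Lemma cnormM z w : cnorm (z * w) = cnorm z * cnorm w.
Proof. by apply: complexI; rewrite rmorphM /= -!cnormE normrM. Qed.

Lemma cnormV z : cnorm z^-1 = (cnorm z)^-1.
Proof. by apply: complexI; rewrite fmorphV /= -!cnormE normfV. Qed.

Lemma cnorm0 : cnorm 0 = 0.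
Proof. by apply: complexI; rewrite -cnormE normr0. Qed.

Lemma cnorm0_eq0 z : cnorm z = 0 -> z = 0.
Proof. by move=> z0; apply/normr0_eq0; rewrite cnormE z0. Qed.

Lemma cnorm_real (x : R) : cnorm x%:C = `|x|.
Proof. by rewrite /cnorm /= expr0n addr0 sqrtr_sqr. Qed.

Lemma ler_Re_cnorm z : `|complex.Re z| <= cnorm z.
Proof. by rewrite -sqrtr_sqr ler_wsqrtr// lerDl sqr_ge0. Qed.

Lemma ler_Im_cnorm z : `|complex.Im z| <= cnorm z.
Proof. by rewrite -sqrtr_sqr ler_wsqrtr// lerDr sqr_ge0. Qed.

Lemma ler_cnorm_ReIm z : cnorm z <= `|complex.Re z| + `|complex.Im z|.
Proof.
rewrite -ler_sqr ?nnegrE ?addr_ge0 ?cnorm_ge0//.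
rewrite sqr_sqrtr ?addr_ge0 ?sqr_ge0// sqrrD !real_normK ?num_real//.
by rewrite lerD2r lerDl mulrn_wge0// mulr_ge0.
Qed.

Lemma cnorm_sum (I : Type) (s : seq I) (P : pred I) (F : I -> R[i]) :
  cnorm (\sum_(i <- s | P i) F i) <= \sum_(i <- s | P i) cnorm (F i).
Proof.
elim/big_ind2 : _ => [|z x w y hz hw|//]; first by rewrite cnorm0.
by apply: le_trans (cnormD _ _) _; exact: lerD.
Qed.

End complex_norm.

Section slit.
Variable R : realType.
Implicit Types a b w : R[i].

Lemma slit_mapK a : slit_map a ^+ 2 = a ^+ 2 - 1.
Proof. exact: sqrtCK. Qed.

Lemma Im_slit_map_ge0 a : 0 <= complex.Im (slit_map a).
Proof. by rewrite -ler0c complexIm Im_rootC_ge0. Qed.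

Lemma slit_map_ReIm a :
  let r := slit_map a in
  complex.Re r ^+ 2 - complex.Im r ^+ 2 =
    complex.Re a ^+ 2 - complex.Im a ^+ 2 - 1 /\
  complex.Re r * complex.Im r = complex.Re a * complex.Im a.
Proof.
have := slit_mapK a; case: (slit_map a) => u v; case: a => p q.
rewrite !expr2 => -[/= h1 h2]; split; first by move: h1; lra.
by move: h2; lra.
Qed.

(** If the imaginary part decreased, then by the first identity of [slit_map_ReIm] the square of the
    real part would decrease too, and so would the modulus of the product of the two parts, which is
    preserved. *)
Lemma Im_slit_map_ge a : 0 < complex.Im a ->
  complex.Im a <= complex.Im (slit_map a).
Proof.
move=> q0; have [] := slit_map_ReIm a; have := Im_slit_map_ge0 a.
move: (complex.Re _) (complex.Im (slit_map _)) => u v v0.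
case: a q0 => p q /= q0 h1 h2; rewrite leNgt; apply/negP => vq.
have u2 : u ^+ 2 < p ^+ 2.
  have : v ^+ 2 < q ^+ 2 by rewrite ltr_pXn2r// nnegrE ltW.
  lra.
have : (u * v) ^+ 2 < (p * q) ^+ 2.
  rewrite !exprMn; apply: (@le_lt_trans _ _ (u ^+ 2 * q ^+ 2)).
    by apply: ler_wpM2l; rewrite ?sqr_ge0// ler_pXn2r// ?nnegrE ltW.
  by rewrite ltr_pM2r// exprn_gt0.
by rewrite h2 ltxx.
Qed.

Lemma Re_slit_map_sign a : 0 < complex.Im a ->
  0 <= complex.Re a * complex.Re (slit_map a).
Proof.
move=> q0; have := Im_slit_map_ge q0; have [_] := slit_map_ReIm a.
move: (complex.Re (slit_map a)) (complex.Im (slit_map _)) => u v.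
case: a q0 => p q /= q0 h vq; have v0 : 0 < v by exact: lt_le_trans vq.
have -> : u = p * q / v by rewrite -h mulfK// gt_eqF.
by rewrite !mulrA -expr2 -mulrA mulr_ge0 ?sqr_ge0// divr_ge0// ltW.
Qed.

(** As the imaginary part does not decrease, [slit_map_ReIm] lets the square of the real part drop
    by at most 1. *)
Lemma Re_slit_map_ge a : 0 < complex.Im a ->
  `|complex.Re a| - 1 <= `|complex.Re (slit_map a)|.
Proof.
move=> q0; have := Im_slit_map_ge q0; have [+ _] := slit_map_ReIm a.
move: (complex.Re (slit_map a)) (complex.Im (slit_map _)) => u v.
case: a q0 => p q /= q0 h vq.
have : q ^+ 2 <= v ^+ 2 by rewrite ler_pXn2r// ?nnegrE ?ltW// (lt_le_trans q0).
move=> qv; have {h qv} h : p ^+ 2 - 1 <= u ^+ 2 by lra.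
move: h; rewrite -(real_normK (num_real u)) -(real_normK (num_real p)).
have := normr_ge0 u; have := normr_ge0 p.
move: `|u| `|p| => {}u {}p p0 u0 h; rewrite leNgt; apply/negP => up.
suff : u ^+ 2 < p ^+ 2 - 1 by lra.
have : u ^+ 2 < (p - 1) ^+ 2 by rewrite ltr_pXn2r// nnegrE; lra.
by rewrite sqrrB1; lra.
Qed.

Definition slit_disp a := slit_map a - a.

(** The identity [a ^+ 2 - slit_map a ^+ 2 = 1] makes [a - slit_map a] the inverse of
    [a + slit_map a], and a difference of roots is the difference of their squares over their sum.
    Each term has two denominators, whence the quadratic decay of the Lipschitz constant. *)
Lemma slit_dispB a b : a + slit_map a != 0 -> b + slit_map b != 0 ->
  slit_map a + slit_map b != 0 ->
  slit_disp a - slit_disp b =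
    (a - b) * ((a + slit_map a)^-1 + (b + slit_map b)^-1) /
    (slit_map a + slit_map b).
Proof.
rewrite /slit_disp; have := slit_mapK a; have := slit_mapK b.
move: (slit_map a) (slit_map b) => r s hs hr ar bs rs.
have -> : (a + r)^-1 = a - r.
  by apply: (mulIf ar); rewrite mulVf// -subr_sqr hr; ring.
have -> : (b + s)^-1 = b - s.
  by apply: (mulIf bs); rewrite mulVf// -subr_sqr hs; ring.
apply: (mulIf rs); rewrite divfK//.
have e : r ^+ 2 - s ^+ 2 = a ^+ 2 - b ^+ 2 by rewrite hr hs; ring.
have -> : (r - a - (s - b)) * (r + s) =
  r ^+ 2 - s ^+ 2 - (a - b) * (r + s) by ring.
by rewrite e; ring.
Qed.

Lemma slit_disp_lip a b (d : R) : 0 < d ->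
  d <= cnorm (a + slit_map a) -> d <= cnorm (b + slit_map b) ->
  d <= cnorm (slit_map a + slit_map b) ->
  cnorm (slit_disp a - slit_disp b) <= 2 / d ^+ 2 * cnorm (a - b).
Proof.
move=> d0 ha hb hab.
have nz z : d <= cnorm z -> z != 0.
  by move=> dz; apply/eqP => z0; move: dz; rewrite z0 cnorm0 leNgt d0.
rewrite slit_dispB ?nz// !cnormM cnormV.
have iv z : d <= cnorm z -> (cnorm z)^-1 <= d^-1.
  by move=> dz; rewrite lef_pV2// posrE (lt_le_trans d0).
rewrite [leRHS]mulrC -mulrA ler_wpM2l ?cnorm_ge0//.
rewrite expr2 invfM mulrA; apply: ler_pM; rewrite ?invr_ge0 ?cnorm_ge0 ?iv//.
apply: le_trans (cnormD _ _) _; rewrite !cnormV mulrDl mul1r lerD ?iv//.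
Qed.

Definition kick (x : R) w := slit_map_at x w - w.

Lemma kickE x w : kick x w = slit_disp (w - x%:C).
Proof. by rewrite /kick /slit_map_at /slit_disp opprB addrCA addrA. Qed.

Lemma Im_Dslit_ge a (y : R) : 0 < y -> y <= complex.Im a ->
  y <= cnorm (a + slit_map a).
Proof.
move=> y0 ya; apply: le_trans (ler_Im_cnorm _); rewrite raddfD /=.
have a0 : 0 < complex.Im a by exact: lt_le_trans ya.
have := Im_slit_map_ge a0; have := ler_norm (complex.Im a + complex.Im (slit_map a)).
lra.
Qed.

Lemma Im_slitD_ge a b (y : R) : 0 < y -> y <= complex.Im a ->
  y <= complex.Im b -> y <= cnorm (slit_map a + slit_map b).
Proof.
move=> y0 ya yb; apply: le_trans (ler_Im_cnorm _); rewrite raddfD /=.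
have a0 : 0 < complex.Im a by exact: lt_le_trans ya.
have b0 : 0 < complex.Im b by exact: lt_le_trans yb.
have := Im_slit_map_ge a0; have := Im_slit_map_ge b0.
have := ler_norm (complex.Im (slit_map a) + complex.Im (slit_map b)).
lra.
Qed.

Lemma slit_disp_lip_Im a b (y : R) : 0 < y -> y <= complex.Im a ->
  y <= complex.Im b ->
  cnorm (slit_disp a - slit_disp b) <= 2 / y ^+ 2 * cnorm (a - b).
Proof.
by move=> y0 ya yb; apply: slit_disp_lip; rewrite ?Im_Dslit_ge ?Im_slitD_ge.
Qed.

(* Away from [x] the two slits look alike to both points: the real parts of
   [w - x], [w' - x] and of their images under the slit map have the same sign. *)
Lemma kick_lip (y M : R) : 0 < y -> 0 <= M -> exists2 K : R, 0 < K &
  forall (x : R) w w', y <= complex.Im w -> y <= complex.Im w' ->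
    `|complex.Re w| <= M -> `|complex.Re w'| <= M ->
    cnorm (kick x w - kick x w') <= K / (1 + `|x|) ^+ 2 * cnorm (w - w').
Proof.
(* The three denominators of [slit_disp_lip] are bounded below by [y] and by [|x| - M - 1]; with
   this [c], the larger of the two is at least [c * (1 + |x|)]. *)
move=> y0 M0; set c := y / (y + M + 2).
have c0 : 0 < c by rewrite divr_gt0//; lra.
exists (2 / c ^+ 2); first by rewrite divr_gt0// exprn_gt0.
move=> x w w' yw yw' Mw Mw'; rewrite !kickE.
have -> : w - w' = (w - x%:C) - (w' - x%:C) by ring.
have -> : 2 / c ^+ 2 / (1 + `|x|) ^+ 2 = 2 / (c * (1 + `|x|)) ^+ 2.
  by rewrite [(c * _) ^+ 2]exprMn [in RHS]invfM mulrA.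
have Imx v : complex.Im (v - x%:C) = complex.Im v.
  by case: v => ? ?; rewrite /= subr0.
have Rex v : complex.Re (v - x%:C) = complex.Re v - x by case: v.
have ywx : y <= complex.Im (w - x%:C) by rewrite Imx.
have ywx' : y <= complex.Im (w' - x%:C) by rewrite Imx.
have lb (D : R) : y <= D -> `|x| - M - 1 <= D -> c * (1 + `|x|) <= D.
  move=> yD xD; rewrite /c mulrAC ler_pdivrMr; last by lra.
  have [h|h] := leP (`|x| - M - 1) y.
    by rewrite ler_pM//; try lra; rewrite addr_ge0.
  apply: (@le_trans _ _ ((`|x| - M - 1) * (y + M + 2))); last first.
    by rewrite ler_wpM2r//; lra.
  have : 0 <= (M + 2) * (`|x| - M - 1 - y) by rewrite mulr_ge0//; lra.
  lra.
have Dlb v : y <= complex.Im (v - x%:C) -> `|complex.Re v| <= M ->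
  c * (1 + `|x|) <= cnorm (v - x%:C + slit_map (v - x%:C)).
  move=> yv Mv; apply: lb; first exact: Im_Dslit_ge.
  have v0 : 0 < complex.Im (v - x%:C) by exact: lt_le_trans yv.
  apply: le_trans (ler_Re_cnorm _); rewrite raddfD /=.
  have := Re_slit_map_sign v0; rewrite Rex.
  have h1 : `|x| - M <= `|complex.Re v - x|.
    by rewrite distrC; have := lerB_dist x (complex.Re v); lra.
  move: (complex.Re v - x) (complex.Re (slit_map _)) h1 => p u h1 pu.
  have h2 : `|p| <= `|p + u|.
    rewrite -ler_sqr ?nnegrE// !real_normK ?num_real// sqrrD.
    by have := sqr_ge0 u; lra.
  lra.
apply: slit_disp_lip; [| exact: Dlb | exact: Dlb |].
  by rewrite mulr_gt0//; have := normr_ge0 x; lra.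
apply: lb; first exact: Im_slitD_ge.
(* For [|x| <= M] the bound is negative; beyond, the real parts of the two images do not cancel, and
   the first alone suffices. *)
have [xM|xM] := leP `|x| M;
    first by have := cnorm_ge0 (slit_map (w - x%:C) + slit_map (w' - x%:C)); lra.
apply: le_trans (ler_Re_cnorm _); rewrite raddfD /=.
have w0 : 0 < complex.Im (w - x%:C) by exact: lt_le_trans ywx.
have w0' : 0 < complex.Im (w' - x%:C) by exact: lt_le_trans ywx'.
have := Re_slit_map_sign w0; have := Re_slit_map_sign w0'.
have := Re_slit_map_ge w0; rewrite !Rex.
move: (complex.Re (slit_map (w - _))) (complex.Re (slit_map (w' - _))) => u u' hu pu' pu.
move: (complex.Re w) (complex.Re w') Mw Mw' hu pu' pu => p p'.
rewrite !ler_norml => /andP[Mp pM] /andP[Mp' p'M] hu pu' pu.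
have [x0|x0] := leP 0 x.
  move: xM hu; rewrite (ger0_norm x0) => xM.
  rewrite (ler0_norm (_ : p - x <= 0)); last by lra.
  have u'0 : u' <= 0 by rewrite -(nmulr_rge0 _ (_ : p' - x < 0)) //; lra.
  have u0 : u <= 0 by rewrite -(nmulr_rge0 _ (_ : p - x < 0)) //; lra.
  rewrite (ler0_norm u0) ler0_norm; lra.
move: xM hu; rewrite (ltr0_norm x0) => xM.
rewrite (ger0_norm (_ : 0 <= p - x)); last by lra.
have u'0 : 0 <= u' by rewrite -(pmulr_rge0 _ (_ : 0 < p' - x)) //; lra.
have u0 : 0 <= u by rewrite -(pmulr_rge0 _ (_ : 0 < p - x)) //; lra.
rewrite (ger0_norm u0) ger0_norm; lra.
Qed.

End slit.

(** * Events modulo null sets *)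

Section countable_measurability.
Context d (T : measurableType d).

Lemma measurable_bigcup_count (I : countType) (P : set I) (F : I -> set T) :
  (forall i, P i -> measurable (F i)) -> measurable (\bigcup_(i in P) F i).
Proof.
move=> mF; have -> : \bigcup_(i in P) F i =
    \bigcup_n (if unpickle n is Some i then
      [set x | P i /\ F i x] else set0).
  apply/seteqP; split=> [x [i Pi Fix]|x [n _]].
    by exists (pickle i) => //; rewrite pickleK.
  by case: (unpickle n) => // i [Pi Fix]; exists i.
apply: bigcupT_measurable => n; case: (unpickle n) => // i.
have [Pi|nPi] := pselect (P i).
  have -> : [set x | P i /\ F i x] = F i; last exact: mF.
  by apply/seteqP; split=> x //= [].
have -> : [set x | P i /\ F i x] = set0; last exact: measurable0.
by apply/seteqP; split=> x //= [].
Qed.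

Lemma measurable_bigcap_count (I : countType) (P : set I) (F : I -> set T) :
  (forall i, P i -> measurable (F i)) -> measurable (\bigcap_(i in P) F i).
Proof.
move=> mF; rewrite -[X in measurable X]setCK setC_bigcap; apply: measurableC.
by apply: measurable_bigcup_count => i Pi; apply: measurableC; exact: mF.
Qed.

Lemma measurable_exists (I : countType) (F : I -> set T) :
  (forall i, measurable (F i)) -> measurable [set x | exists i, F i x].
Proof.
move=> mF; have -> : [set x | exists i, F i x] = \bigcup_i F i.
  by apply/seteqP; split=> [x [i Fx]|x [i _ Fx]]; exists i.
by apply: measurable_bigcup_count => i _; exact: mF.
Qed.

Lemma measurable_forall (I : countType) (F : I -> set T) :
  (forall i, measurable (F i)) -> measurable [set x | forall i, F i x].
Proof.
move=> mF; have -> : [set x | forall i, F i x] = \bigcap_i F i.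
  by apply/seteqP; split=> [x h i _|x h i]; exact: h.
by apply: measurable_bigcap_count => i _; exact: mF.
Qed.

Lemma measurable_imply (P : Prop) (F : set T) :
  (P -> measurable F) -> measurable [set x | P -> F x].
Proof.
move=> mF; have [p|np] := pselect P.
  have -> : [set x | P -> F x] = F; last exact: mF.
  by apply/seteqP; split=> x /= => [/(_ p)|].
have -> : [set x | P -> F x] = setT; last exact: measurableT.
by apply/seteqP; split=> x //= _ /np.
Qed.

Lemma measurable_const (P : Prop) : measurable [set x : T | P].
Proof.
have [p|np] := pselect P.
  have -> : [set x : T | P] = setT; last exact: measurableT.
  by apply/seteqP; split=> x //=.
have -> : [set x : T | P] = set0; last exact: measurable0.
by apply/seteqP; split=> x.
Qed.

(** [U] is the union of the countably many [N i] that it contains. The [N i] need not be open, which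
    is what allows sets of paths described by closed conditions. *)
Lemma measurable_network (I : countType) (N : I -> set T) (U : set T) :
  (forall i, measurable (N i)) ->
  (forall x, U x -> exists2 i, N i x & N i `<=` U) -> measurable U.
Proof.
move=> mN NU; have -> : U = \bigcup_(i in [set i | N i `<=` U]) N i.
  by apply/seteqP; split=> [x /NU[i Ni NiU]|x [i NiU]]; [by exists i|exact: NiU].
exact: measurable_bigcup_count.
Qed.

End countable_measurability.

Section modulo_null_sets.
Context d (T : measurableType d) (R : realType).
Variables (mu nu : {measure set T -> \bar R}) (G : set_system T).
Hypotheses (sG : sigma_algebra setT G) (mG : G `<=` measurable).
Hypothesis muG : forall A, G A -> mu A = nu A.

(** One and the same [B] serves both measures: this is what carries measures and almost sure
    statements from one to the other. *)
Definition ae_system : set_system T := [set A | exists2 B, G B &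
  (\forall x \ae mu, A x <-> B x) /\ (\forall x \ae nu, A x <-> B x)].

Lemma sub_ae_system : G `<=` ae_system.
Proof. by move=> A GA; exists A => //; split; exact: aeW. Qed.

Lemma ae_system_sigma_algebra : sigma_algebra setT ae_system.
Proof.
case: sG => G0 GD GU; split; first exact: sub_ae_system.
- move=> A [B GB [muAB nuAB]]; exists (setT `\` B); first exact: GD.
  by split; [move: muAB|move: nuAB]; apply: filterS => x AB;
    split=> -[_ h]; split=> // /AB.
- move=> A eA; have /choice[B hB] : forall n, exists B, [/\ G B,
      \forall x \ae mu, A n x <-> B x & \forall x \ae nu, A n x <-> B x].
    by move=> n; have [B GB [? ?]] := eA n; exists B.
  have {hB} [GB muAB nuAB] : [/\ forall n, G (B n),
      forall n, \forall x \ae mu, A n x <-> B n x &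
      forall n, \forall x \ae nu, A n x <-> B n x].
    by split=> n; have [] := hB n.
  exists (\bigcup_n B n); first exact: GU.
  by split; [have := ae_foralln muAB|have := ae_foralln nuAB];
    apply: filterS => x AB; split=> -[n _ /AB ?]; exists n.
Qed.

Lemma ae_eq_measure (m : {measure set T -> \bar R}) A B :
  measurable A -> measurable B -> (\forall x \ae m, A x <-> B x) -> m A = m B.
Proof.
suff le C D : measurable C -> measurable D ->
    (\forall x \ae m, C x <-> D x) -> (m C <= m D)%E.
  move=> mA mB AB; apply/eqP; rewrite eq_le !le//.
  by move: AB; apply: filterS => x [].
move=> mC mD [N [mN N0 CD]].
have <- : m (D `|` N) = m D.
  exact: ((null_setU _ mN).1 ((measure0_null_setP _ mN).2 N0)).
apply: le_measure; rewrite ?inE//; first exact: measurableU.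
move=> x Cx; have [Nx|nNx] := pselect (N x); [by right|left].
by apply: contrapT => nDx; apply/nNx/CD => /= -[/(_ Cx)].
Qed.

Lemma ae_system_eq A : measurable A -> ae_system A -> mu A = nu A.
Proof.
move=> mA [B GB [muAB nuAB]].
rewrite (ae_eq_measure mA (mG GB) muAB) (ae_eq_measure mA (mG GB) nuAB).
exact: muG.
Qed.

(** The complement of the representative [B] lies in [G], so it is null for [nu] as soon as it is
    null for [mu]. *)
Lemma ae_system_ae A : ae_system A ->
  (\forall x \ae mu, A x) -> (\forall x \ae nu, A x).
Proof.
move=> [B GB [muAB nuAB]] muA.
have [_ GD _] := sG.
have muB : mu (~` B) = 0%E.
  apply/(negligibleP mu); first by apply: measurableC; exact: mG.
  by move: muA muAB; apply: filterS2 => x Ax [h _]; exact: h.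
have nuB : \forall x \ae nu, B x.
  apply/(negligibleP nu); first by apply: measurableC; exact: mG.
  by have := muG (GD _ GB); rewrite setTD muB => /esym.
by move: nuB nuAB; apply: filterS2 => x Bx [_ h]; exact: h.
Qed.

Lemma ae_system_modulo A B : ae_system B ->
  (\forall x \ae mu, A x <-> B x) -> (\forall x \ae nu, A x <-> B x) ->
  ae_system A.
Proof.
move=> [C GC [muBC nuBC]] muAB nuAB; exists C => //; split.
  by move: muAB muBC; apply: filterS2 => x [? ?] [? ?]; split; auto.
by move: nuAB nuBC; apply: filterS2 => x [? ?] [? ?]; split; auto.
Qed.

End modulo_null_sets.

(** * Dyadic boxes and the weak* topology *)

Section time_points.
Variable R : realType.

Lemma tval_ge0 (t : time R) : 0 <= tval t.
Proof. by have := set_mem (valP t); rewrite /= in_itv /= andbT. Qed.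

Lemma tval_time_inj : injective (@tval R).
Proof. exact: val_inj. Qed.

Lemma time_of_proof (x : R) : (Num.max 0 x) \in `[0 : R, +oo[%classic.
Proof. by rewrite inE /= in_itv /= andbT le_max lexx. Qed.

(** A continuous retraction of the line onto [0, +oo[, so that real expressions denote times without
    a proof of their sign. *)
Definition time_of (x : R) : time R := exist _ (Num.max 0 x) (time_of_proof x).

Lemma time_ofE (x : R) : tval (time_of x) = Num.max 0 x.
Proof. by []. Qed.

Lemma time_ofK (x : R) : 0 <= x -> tval (time_of x) = x.
Proof. by move=> x0; rewrite time_ofE max_r. Qed.

Lemma time_of_tval (t : time R) : time_of (tval t) = t.
Proof. by apply: tval_time_inj; rewrite time_ofK// tval_ge0. Qed.

Lemma continuous_time_of : continuous time_of.
Proof.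
apply: continuous_comp_initial => x.
have -> : set_val \o time_of = (fun x : R => Num.max (cst 0 x) x) by [].
by apply: continuous_max; [exact: cvg_cst|exact: cvg_id].
Qed.

End time_points.

Section boxes.
Variable R : realType.
Implicit Types (s t c d : R) (B : set (spacetime R)).

(** The bounds are reals rather than times so that [s = -1] includes the initial line, which [s = 0]
    leaves out. *)
Definition box s t c d : set (spacetime R) :=
  [set p | s < tval p.1 <= t /\ c < p.2 <= d].

Definition rect t c d : set (spacetime R) :=
  [set p | tval p.1 <= t /\ c <= p.2 <= d].

Lemma compact_rect t c d : compact (rect t c d).
Proof.
have -> : rect t c d = (@time_of R @` `[0, t]) `*` `[c, d].
  apply/seteqP; split=> [[u x] /= [ut xcd]|[u x] /= [[v + <-] xcd]].
    split; last by rewrite in_itv.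
    by exists (tval u); rewrite ?time_of_tval// in_itv/= tval_ge0.
  rewrite in_itv/= => /andP[v0 vt]; split; first by rewrite /= time_ofK.
  by move: xcd; rewrite in_itv.
apply: compact_setX; last exact: segment_compact.
apply: continuous_compact; last exact: segment_compact.
by apply: continuous_subspaceT; exact: continuous_time_of.
Qed.

Lemma continuous_coord1 : continuous (fun p : spacetime R => tval p.1).
Proof.
move=> p; apply: (@continuous_comp _ _ _ fst (@tval R)); first exact: cvg_fst.
exact: continuous_tval.
Qed.

Lemma continuous_coord2 : continuous (fun p : spacetime R => p.2).
Proof. by move=> p; exact: cvg_snd. Qed.

Lemma measurable_continuous (f : spacetime R -> R) :
  continuous f -> measurable_fun setT f.
Proof.
move=> cf; apply: (measurability _ (RGenOInfty.measurableE R)).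
move=> _ [_ [a ->] <-]; rewrite setTI; apply: sub_sigma_algebra.
by apply: open_comp => [x _|]; [exact: cf|exact: interval_open].
Qed.

Lemma measurable_box s t c d : measurable (box s t c d).
Proof.
have -> : box s t c d = ((fun p : spacetime R => tval p.1) @^-1` `]s, t]) `&`
    (snd @^-1` `]c, d]).
  by apply/seteqP; split=> p /=; rewrite !in_itv.
apply: measurableI; rewrite -[X in measurable X]setTI.
  by apply: (measurable_continuous continuous_coord1).
by apply: (measurable_continuous continuous_coord2).
Qed.

Lemma measurable_rect t c d : measurable (rect t c d).
Proof. by apply: measurable_compact; exact: compact_rect. Qed.

Lemma box_rect s t c d : box s t c d `<=` rect t c d.
Proof. by move=> p [/andP[_ ?] /andP[/ltW ? ?]]; split=> //; apply/andP. Qed.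

Lemma rect_fin (m : pmeas R) t c d : (m (rect t c d) < +oo)%E.
Proof. by apply: pm_locally_finite; exact: compact_rect. Qed.

Lemma box_fin (m : pmeas R) s t c d : (m (box s t c d) < +oo)%E.
Proof.
apply: le_lt_trans (rect_fin m t c d).
by apply: le_measure; rewrite ?inE//; [exact: measurable_box|
  exact: measurable_rect|exact: box_rect].
Qed.

Definition clip01 (x : R) : R := Num.min 1 (Num.max 0 x).

Lemma clip01_ge0 x : 0 <= clip01 x.
Proof. by rewrite le_min ler01 le_max lexx. Qed.

Lemma clip01_le1 x : clip01 x <= 1.
Proof. by rewrite ge_min lexx. Qed.

Lemma clip01_le0 x : x <= 0 -> clip01 x = 0.
Proof. by move=> x0; rewrite /clip01 max_l// min_r. Qed.

Lemma clip01_ge1 x : 1 <= x -> clip01 x = 1.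
Proof.
by move=> x1; rewrite /clip01 max_r ?min_l// (le_trans _ x1).
Qed.

Lemma continuous_clip01 (T : topologicalType) (f : T -> R) :
  continuous f -> continuous (fun x => clip01 (f x)).
Proof.
move=> cf x.
have -> : (fun x => clip01 (f x)) = cst 1 \min (cst 0 \max f) by [].
apply: continuous_min; first exact: cvg_cst.
by apply: continuous_max; [exact: cvg_cst|exact: cf].
Qed.

(* Continuous functions on the line converging pointwise to the indicator of
   the half-open interval ]s, t]. *)
Definition bump s t (n : nat) (x : R) : R :=
  clip01 (n.+1%:R * (x - s)) * clip01 (1 - n.+1%:R * (x - t)).

Lemma bump_ge0 s t n x : 0 <= bump s t n x.
Proof. by rewrite mulr_ge0// clip01_ge0. Qed.

Lemma bump_le1 s t n x : bump s t n x <= 1.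
Proof. by rewrite mulr_ile1 ?clip01_ge0 ?clip01_le1. Qed.

Lemma bump_supp s t n x : bump s t n x != 0 -> s <= x <= t + 1.
Proof.
apply: contraR; rewrite negb_and -!ltNge => /orP[xs|tx].
  by rewrite /bump clip01_le0 ?mul0r// mulr_ge0_le0// subr_le0 ltW.
rewrite /bump [X in _ * X]clip01_le0 ?mulr0// subr_le0.
have : 1 * 1 <= n.+1%:R * (x - t).
  by apply: ler_pM => //; [rewrite ler1n|lra].
by rewrite mul1r.
Qed.

Lemma cvg_bump s t x : bump s t n x @[n --> \oo] --> (\1_(`]s, t]) x : R).
Proof.
rewrite indicE; have [|xst] := boolP (x \in _).
  rewrite inE/= in_itv/= => /andP[sx xt].
  apply: cvg_near_cst; near=> n; rewrite /bump clip01_ge1; last first.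
    rewrite -ler_pdivrMr ?subr_gt0// mul1r.
    by apply: (@le_trans _ _ n%:R); [near: n; exact: nbhs_infty_ger|
      rewrite ler_nat].
  rewrite mul1r clip01_ge1//; rewrite lerBrDr gerDl.
  by rewrite mulr_ge0_le0// subr_le0.
have [xs|sx] := leP x s.
  apply: cvg_near_cst; near=> n.
  by rewrite /bump clip01_le0 ?mul0r// mulr_ge0_le0// subr_le0.
have tx : t < x.
  by rewrite ltNge; apply: contra xst => xt; rewrite inE/= in_itv/= sx.
apply: cvg_near_cst; near=> n; rewrite /bump [X in _ * X]clip01_le0 ?mulr0//.
rewrite subr_le0 -ler_pdivrMr ?subr_gt0// mul1r.
by apply: (@le_trans _ _ n%:R); [near: n; exact: nbhs_infty_ger|rewrite ler_nat].
Unshelve. all: by end_near. Qed.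

Lemma continuous_bump (T : topologicalType) (f : T -> R) s t n :
  continuous f -> continuous (fun x => bump s t n (f x)).
Proof.
move=> cf.
have cB (a : R) : continuous (fun x => n.+1%:R * (f x - a)).
  by move=> x; apply: cvgMl_tmp; apply: cvgB; [exact: cf|exact: cvg_cst].
have cBB : continuous (fun x => 1 - n.+1%:R * (f x - t)).
  by move=> x; apply: cvgB; [exact: cvg_cst|exact: cB].
by move=> x; apply: cvgM; [exact: (continuous_clip01 (cB s))|
  exact: (continuous_clip01 cBB)].
Qed.

Definition box_bump s t c d n (p : spacetime R) : R :=
  bump s t n (tval p.1) * bump c d n p.2.

Lemma continuous_box_bump s t c d n : continuous (box_bump s t c d n).
Proof.
move=> p; apply: cvgM; [apply: (continuous_bump continuous_coord1)|
  apply: (continuous_bump continuous_coord2)].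
Qed.

Lemma box_bump_supp s t c d n p :
  box_bump s t c d n p != 0 -> rect (t + 1) c (d + 1) p.
Proof.
rewrite mulf_eq0 negb_or => /andP[/bump_supp /andP[_ ?] /bump_supp].
by split.
Qed.

Lemma hausdorff_spacetime : hausdorff_space (spacetime R).
Proof.
move=> p q pq; suff : (tval p.1, p.2) = (tval q.1, q.2).
  case: p q {pq} => [p1 p2] [q1 q2] [] /= pq1 ->.
  by congr pair; exact: val_inj.
apply: (@norm_hausdorff _ (R * R)%type) => A B Ap Bq.
pose coord (p : spacetime R) : R * R := (tval p.1, p.2).
have cc : continuous coord.
  by move=> z; exact: (cvg_pair (@continuous_coord1 z) (@continuous_coord2 z)).
have [r [Ar Br]] := pq _ _ (cc _ _ Ap) (cc _ _ Bq).
by exists (coord r).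
Qed.

Lemma compact_box_bump s t c d n :
  compact (closure [set p | box_bump s t c d n p != 0]).
Proof.
apply: (@subclosed_compact _ _ (rect (t + 1) c (d + 1))).
- exact: closed_closure.
- exact: compact_rect.
- rewrite closureE => p /(_ (rect (t + 1) c (d + 1))); apply; split.
    by apply: compact_closed; [exact: hausdorff_spacetime|exact: compact_rect].
  by move=> q; exact: box_bump_supp.
Qed.

Definition box_test s t c d n : test_fun R :=
  TestFun (@continuous_box_bump s t c d n) (@compact_box_bump s t c d n).

Lemma cvg_box_bump s t c d p :
  box_bump s t c d n p @[n --> \oo] --> (\1_(box s t c d) p : R).
Proof.
have -> : \1_(box s t c d) p =
    (\1_(`]s, t]) (tval p.1) : R) * \1_(`]c, d]) p.2.
  rewrite !indicE -natrM mulnb; congr (_%:R); congr nat_of_bool.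
  rewrite !mem_setE !in_itv/=.
  by apply/idP/andP => [/set_mem[]//|pst]; apply/mem_set.
by apply: cvgM; exact: cvg_bump.
Qed.

Lemma measurable_weak_ev (f : test_fun R) :
  measurable_fun setT (fun m : borel (pmeas R) => weak_ev m f).
Proof.
apply: (measurability _ (RGenOInfty.measurableE R)).
move=> _ [_ [a ->] <-]; rewrite setTI; apply: sub_sigma_algebra.
have cf : continuous (fun m : pmeas R => weak_ev m f).
  move=> m; apply: (@continuous_comp _ _ _ (@weak_ev R) (fun g => g f)).
    exact: initial_continuous.
  exact: proj_continuous.
by apply: open_comp => [x _|]; [exact: cf|exact: interval_open].
Qed.

(** Dominated convergence: all bumps are at most the indicator of one rectangle, of finite mass.
    This exhibits the mass of a box as a limit of weak* continuous functions, hence as a Borel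
    function. *)
Lemma cvg_weak_ev_box (m : pmeas R) s t c d :
  (weak_ev m (box_test s t c d n))%:E @[n --> \oo] --> m (box s t c d).
Proof.
pose K := rect (t + 1) c (d + 1).
have mK : measurable K by exact: measurable_rect.
have mf n : measurable_fun setT (EFin \o box_bump s t c d n).
  apply/measurable_EFinP; apply: measurable_continuous.
  exact: continuous_box_bump.
have mi : measurable_fun setT (EFin \o (\1_(box s t c d) : _ -> R)).
  by apply/measurable_EFinP; apply: measurable_indic; exact: measurable_box.
have iK : m.-integrable setT (EFin \o (\1_K : _ -> R)).
  apply/integrableP; split.
    by apply/measurable_EFinP; exact: measurable_indic.
  under eq_integral do rewrite gee0_abs ?lee_fin//.
  by rewrite integral_indic// setIT; exact: rect_fin.
have le n p : (`|(EFin \o box_bump s t c d n) p| <= (EFin \o \1_K) p)%E.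
  rewrite /= lee_fin indicE; have [pK|pK] := boolP (p \in K).
    have b0 : 0 <= box_bump s t c d n p by rewrite mulr_ge0 ?bump_ge0.
    by rewrite ger0_norm// mulr_ile1 ?bump_ge0 ?bump_le1.
  rewrite normr_le0; apply: contraNT pK => /box_bump_supp.
  by rewrite inE.
have cv p : (EFin \o box_bump s t c d n) p @[n --> \oo] -->
    (EFin \o \1_(box s t c d)) p.
  by apply: cvg_EFin; [exact: nearW|exact: cvg_box_bump].
have [_ _] := @dominated_convergence _ _ R m setT measurableT
  (fun n => EFin \o box_bump s t c d n) (EFin \o \1_(box s t c d))
  (EFin \o \1_K) mf mi
  (aeW _ (fun p _ => cv p)) iK
  (aeW _ (fun p n _ => le n p)).
rewrite [X in _ --> X -> _]integral_indic ?setIT//; last exact: measurable_box.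
set u := (X in X @ _ --> _ -> _); set v := (X in _ -> X @ _ --> _).
suff -> : v = u by [].
apply/funext => n; rewrite /u /v.
rewrite /weak_ev /Rintegral fineK//; apply: integrable_fin_num => //.
apply: (le_integrable measurableT (mf n) _ iK) => p _.
by rewrite (le_trans (le n p))// lee_abs.
Qed.

Lemma measurable_count s t c d :
  measurable_fun setT (fun m : borel (pmeas R) => pm m (box s t c d)).
Proof.
apply: (@emeasurable_fun_cvg _ _ _ _
  (fun n (m : borel (pmeas R)) => (weak_ev m (box_test s t c d n))%:E)).
  by move=> n; apply/measurable_EFinP; exact: measurable_weak_ev.
by move=> m _; exact: cvg_weak_ev_box.
Qed.

End boxes.

(** The strict bound at [- N - 1] is the form that [cell_gt] turns into a bound between reals. *)
Lemma absz_leP (z : int) (N : nat) :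
  reflect (- N%:Z - 1 < z /\ z <= N%:Z) (`|z| <= N)%N.
Proof. by apply: (iffP idP); lia. Qed.

Section dyadic.
Variable R : realType.
Implicit Types (k n : nat) (a b z : int) (x y : R).

Definition dy k z : R := z%:~R / 2 ^+ k.

(** The ceiling, so that cells are open on the left and closed on the right, like the intervals (s,
    t] of the restrictions of P, and carry the index of their right end. *)
Definition cell k x : int := Num.ceil (x * 2 ^+ k).

Let e2_gt0 k : 0 < 2 ^+ k :> R.
Proof. by rewrite exprn_gt0. Qed.

Lemma dyS k z : dy k z = dy k.+1 (2 * z).
Proof.
rewrite /dy exprS intrM; field.
by rewrite lt0r_neq0.
Qed.

Lemma dy_ceil k x : dy k (cell k x - 1) < x <= dy k (cell k x).
Proof. by rewrite /dy ltr_pdivrMr// ler_pdivlMr// ceil_itv. Qed.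

Lemma cellE k x z : (cell k x == z) = (dy k (z - 1) < x <= dy k z).
Proof. by rewrite /dy ltr_pdivrMr// ler_pdivlMr// /cell ceil_eq. Qed.

Lemma cell_le k x z : (cell k x <= z) = (x <= dy k z).
Proof. by rewrite /dy ler_pdivlMr// /cell ceil_le_int. Qed.

Lemma cell_gt k x z : (z < cell k x) = (dy k z < x).
Proof. by rewrite /dy ltr_pdivrMr// /cell ceil_gt_int. Qed.

Lemma dy1 k z : dy k z - dy k (z - 1) = 2^-1 ^+ k.
Proof. by rewrite /dy -mulrBl intrD opprD addrA subrr add0r opprK mul1r exprVn. Qed.

Lemma cell_dist k x : `|x - dy k (cell k x)| <= 2^-1 ^+ k.
Proof.
have /andP[lo hi] := dy_ceil k x; have := dy1 k (cell k x).
by rewrite ler0_norm; lra.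
Qed.

Lemma ler_dy k a b : (dy k a <= dy k b) = (a <= b).
Proof. by rewrite /dy ler_pM2r ?invr_gt0// ler_int. Qed.

Lemma ltr_dy k a b : (dy k a < dy k b) = (a < b).
Proof. by rewrite /dy ltr_pM2r ?invr_gt0// ltr_int. Qed.

Lemma dy_nat k (L : nat) : dy k (L * 2 ^ k)%N = L%:R.
Proof. by rewrite /dy -pmulrn natrM natrX mulfK// lt0r_neq0. Qed.

Lemma dyN k z : dy k (- z) = - dy k z.
Proof. by rewrite /dy intrN mulNr. Qed.

Lemma dy_shift k n z : (k <= n)%N -> dy k z = dy n (z * 2 ^+ (n - k)).
Proof.
move=> kn; rewrite /dy intrM rmorphXn/=.
have -> : 2 ^+ n = 2 ^+ (n - k) * 2 ^+ k :> R by rewrite -exprD subnK.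
by rewrite invfM mulrA mulfK// expf_neq0.
Qed.

End dyadic.

Section dyadic_boxes.
Variable R : realType.
Implicit Types (m : pmeas R) (k n : nat) (a b : int).

Definition dbox k a b : set (spacetime R) :=
  box (dy R k (a - 1)) (dy R k a) (dy R k (b - 1)) (dy R k b).

Lemma dboxP k a b p :
  dbox k a b p <-> cell k (tval p.1) = a /\ cell k p.2 = b.
Proof.
rewrite /dbox /box /= -!cellE.
by split=> [[/eqP ? /eqP]|[-> ->]].
Qed.

Lemma measurable_dbox k a b : measurable (dbox k a b).
Proof. exact: measurable_box. Qed.

Lemma dbox_fin m k a b : (m (dbox k a b) < +oo)%E.
Proof. exact: box_fin. Qed.

Lemma dbox_fin_num m k a b : m (dbox k a b) \is a fin_num.
Proof. by rewrite ge0_fin_numE ?dbox_fin. Qed.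

Lemma box_split1 m (s u t c d : R) : s <= u <= t ->
  (m (box s t c d) = m (box s u c d) + m (box u t c d))%E.
Proof.
move=> /andP[su ut]; rewrite -measureU; try exact: measurable_box.
  congr (m _); apply/seteqP; split=> [p [/andP[sp pt] pcd]|p].
    have [pu|up] := leP (tval p.1) u; [left|right]; split=> //.
      by rewrite sp.
    by rewrite up.
  move=> [[/andP[sp pu] pcd]|[/andP[up pt] pcd]]; split=> //.
    by rewrite sp (le_trans pu).
  by rewrite (le_lt_trans su).
by apply/seteqP; split=> // p [[/andP[_ pu] _] [/andP[+ _] _]]; rewrite ltNge pu.
Qed.

Lemma box_split2 m (s t c e d : R) : c <= e <= d ->
  (m (box s t c d) = m (box s t c e) + m (box s t e d))%E.
Proof.
move=> /andP[ce ed]; rewrite -measureU; try exact: measurable_box.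
  congr (m _); apply/seteqP; split=> [p [pst /andP[cp pd]]|p].
    have [pu|up] := leP p.2 e; [left|right]; split=> //.
      by rewrite cp.
    by rewrite up.
  move=> [[pst /andP[cp pe]]|[pst /andP[ep pd]]]; split=> //.
    by rewrite cp (le_trans pe).
  by rewrite pd (le_lt_trans ce).
by apply/seteqP; split=> // p [[_ /andP[_ pe]] [_ /andP[+ _]]]; rewrite ltNge pe.
Qed.

Lemma dboxS m k a b : (m (dbox k a b) =
  (m (dbox k.+1 (2 * a - 1) (2 * b - 1)) + m (dbox k.+1 (2 * a - 1) (2 * b))) +
  (m (dbox k.+1 (2 * a) (2 * b - 1)) + m (dbox k.+1 (2 * a) (2 * b))))%E.
Proof.
rewrite /dbox (dyS _ k (a - 1)) (dyS _ k a) (dyS _ k (b - 1)) (dyS _ k b).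
have e z : 2 * (z - 1) = 2 * z - 1 - 1 :> int by lia.
rewrite !e (@box_split1 _ _ (dy R k.+1 (2 * a - 1))) ?ler_dy; last by lia.
by congr (_ + _)%E; apply: box_split2; rewrite !ler_dy; lia.
Qed.

(** Level and window grow with the same parameter, so that increasing [n] refines the boxes and
    enlarges the region at once. *)
Definition same_counts n m m' := forall a b : int,
  (`|a| <= n * 2 ^ n)%N -> (`|b| <= n * 2 ^ n)%N ->
  m (dbox n a b) = m' (dbox n a b).

Lemma same_countsW n n' m m' : (n <= n')%N ->
  same_counts n' m m' -> same_counts n m m'.
Proof.
elim: n' => [|n' IH]; first by rewrite leqn0 => /eqP ->.
rewrite leq_eqVlt => /predU1P[-> //|]; rewrite ltnS => nn' mm'.
apply: IH => // a b ha hb; rewrite (dboxS m n' a b) (dboxS m' n' a b).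
have bound (z : int) : (`|z| <= n' * 2 ^ n')%N ->
    (`|(2 * z)%R| <= n'.+1 * 2 ^ n'.+1)%N /\
    (`|(2 * z - 1)%R| <= n'.+1 * 2 ^ n'.+1)%N.
  have : (0 < 2 ^ n')%N by rewrite expn_gt0.
  by rewrite expnS; move: (2 ^ n')%N => e e0 hz; split; nia.
have [a1 a2] := bound a ha; have [b1 b2] := bound b hb.
by rewrite !mm'.
Qed.

(* The cells of level [k] meeting the window of size [L]. *)
Definition gcell L k := ('I_(L * 2 ^ k).*2.+1 * 'I_(L * 2 ^ k).*2.+1)%type.

Definition gindex L k (i : 'I_(L * 2 ^ k).*2.+1) : int := i%:Z - (L * 2 ^ k)%N%:Z.

Definition gbox L k (c : gcell L k) := dbox k (gindex c.1) (gindex c.2).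

Lemma gindex_bound L k (i : 'I_(L * 2 ^ k).*2.+1) :
  (`|gindex i| <= L * 2 ^ k)%N.
Proof. by rewrite /gindex; have := ltn_ord i; lia. Qed.

Lemma gindex_inj L k : injective (@gindex L k).
Proof. by move=> i j ij; apply: val_inj; move: ij; rewrite /gindex /=; lia. Qed.

Lemma gindex_ex L k (z : int) : (`|z| <= L * 2 ^ k)%N ->
  exists i : 'I_(L * 2 ^ k).*2.+1, gindex i = z.
Proof.
move=> hz; have h : (`|(z + (L * 2 ^ k)%N%:Z)%R| < (L * 2 ^ k).*2.+1)%N by lia.
by exists (Ordinal h); rewrite /gindex /=; lia.
Qed.

Lemma gbox_inj L k (c c' : gcell L k) p : gbox c p -> gbox c' p -> c = c'.
Proof.
move=> /dboxP[h1 h2] /dboxP[h1' h2']; case: c c' h1 h2 h1' h2' => i j [i' j'] /=.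
by move=> -> -> /gindex_inj -> /gindex_inj ->.
Qed.

(** The cell ending at [- L] is needed to cover the closed window; it protrudes to the left by
    [2^-k], hence the bound [- L.+1]. *)
Lemma gbox_rect L k (c : gcell L k) : gbox c `<=` rect L%:R (- L.+1%:R) L%:R.
Proof.
move=> p /dboxP[h1 h2].
have := gindex_bound c.1; have := gindex_bound c.2.
rewrite -h1 -h2 => /absz_leP[l2 u2] /absz_leP[l1 u1]; split.
  by rewrite -(dy_nat R k) -cell_le.
rewrite -[X in _ && (_ <= X)](dy_nat R k) -cell_le.
apply/andP; split=> //.
have : dy R k (- (L * 2 ^ k)%N%:Z - 1) < p.2 by rewrite -cell_gt.
have := dy1 R k (- (L * 2 ^ k)%N%:Z); rewrite dyN dy_nat.
have : 2^-1 ^+ k <= 1 :> R by rewrite exprn_ile1 ?invr_le1 ?invr_ge0 ?ler1n ?unitfE.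
by rewrite -natr1; lra.
Qed.

Lemma gbox_ex L k p : rect L%:R (- L%:R) L%:R p -> exists c : gcell L k, gbox c p.
Proof.
move=> [pt /andP[lp pL]].
have c1 : (`|cell k (tval p.1)| <= L * 2 ^ k)%N.
  apply/absz_leP; split; last by rewrite cell_le dy_nat.
  rewrite cell_gt; apply: lt_le_trans (tval_ge0 _).
  have : dy R k (- (L * 2 ^ k)%N%:Z - 1) < dy R k (- (L * 2 ^ k)%N%:Z).
    by rewrite ltr_dy; lia.
  by move=> /lt_le_trans; apply; rewrite dyN dy_nat oppr_le0.
have c2 : (`|cell k p.2| <= L * 2 ^ k)%N.
  apply/absz_leP; split; last by rewrite cell_le dy_nat.
  rewrite cell_gt; apply: lt_le_trans lp.
  by rewrite -(dy_nat R k) -dyN ltr_dy; lia.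
have [i hi] := gindex_ex c1; have [j hj] := gindex_ex c2.
by exists (i, j); apply/dboxP; rewrite hi hj.
Qed.

End dyadic_boxes.
Arguments dbox R k a b : clear implicits.
Arguments gbox R {L k} c.

(** * Weak* open sets and counts in dyadic boxes *)

Section weak_topology.
Variable R : realType.
Implicit Types (m : pmeas R) (f : test_fun R).

Lemma pmeas_cvg (F : set_system (pmeas R)) m : Filter F ->
  (forall f, weak_ev m' f @[m' --> F] --> weak_ev m f) -> F --> m.
Proof.
move=> FF Fm; have Fwm : weak_ev @ F --> weak_ev m.
  apply/cvg_sup => f; apply/cvg_image.
    by apply/seteqP; split=> // y _; exists (fun=> y).
  move=> W /Fm /= FW; exists [set g : test_fun R -> R | W (g f)].
    exact: FW.
  by apply/seteqP; split=> [_ [g Wg <-]//|y Wy]; exists (fun=> y).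
move=> U; rewrite nbhsE => -[V [[A oA <-] Am] VU].
apply: filterS VU _; apply: (Fwm A); exact: open_nbhs_nbhs.
Qed.

Lemma test_fun_supp f : exists L : nat, forall p,
  f p != 0 -> rect L%:R (- L%:R) L%:R p.
Proof.
have cK := @tf_compact _ f; set K := closure _ in cK.
have bnd (g : spacetime R -> R) : continuous g ->
    exists L : nat, forall p, K p -> `|g p| <= L%:R.
  move=> cg; have /compact_bounded[M [Mr MK]] : compact (g @` K).
    apply: continuous_compact cK; exact: continuous_subspaceT.
  exists (Num.bound `|M|) => p Kp; apply: MK; last by exists p.
  exact: le_lt_trans (ler_norm _) (archi_boundP _).
have [L1 b1] := bnd _ (@continuous_coord1 R).
have [L2 b2] := bnd _ (@continuous_coord2 R).
exists (maxn L1 L2) => p fp0.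
have Kp : K p by apply: subset_closure.
have := b1 p Kp; have := b2 p Kp; rewrite natr_max => h2 h1; split.
  by rewrite le_max (le_trans (ler_norm _) h1).
by rewrite -ler_norml le_max h2 orbT.
Qed.

Lemma near_exp_half (e : R) : 0 < e -> \forall k \near \oo, 2^-1 ^+ k < e.
Proof.
move=> e0; have : 2^-1 ^+ k @[k --> \oo] --> (0 : R).
  by apply: cvg_expr; rewrite ger0_norm ?invr_ge0// invf_lt1// ltr1n.
move=> /cvgrPdist_lt /(_ e e0); apply: filterS => k.
by rewrite sub0r normrN ger0_norm ?exprn_ge0 ?invr_ge0.
Qed.

(** Compactness is used in its near-covering form; distances are those of the coordinates, through
    the extension [F] of [f] to the plane. *)
Lemma test_fun_unif f (t c d e : R) : 0 < e ->
  \forall k \near \oo, forall p, rect t c d p -> forall p',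
    `|tval p.1 - tval p'.1| <= 2^-1 ^+ k -> `|p.2 - p'.2| <= 2^-1 ^+ k ->
    `|f p - f p'| <= e.
Proof.
move=> e0; have := (compact_near_coveringP _).1 (@compact_rect R t c d).
apply => x Kx.
pose F (q : R * R) := f (time_of q.1, q.2).
have cF : {for (tval x.1, x.2), continuous F}.
  pose x0 : R * R := (tval x.1, x.2).
  have c1 : time_of q.1 @[q --> x0] --> time_of x0.1.
    apply: (@continuous_comp _ _ _ fst (@time_of R)); first exact: cvg_fst.
    exact: continuous_time_of.
  have c2 : q.2 @[q --> x0] --> x0.2 by exact: cvg_snd.
  apply: (@continuous_comp _ _ _ (fun q : R * R => (time_of q.1, q.2) : spacetime R)).
    exact: (cvg_pair c1 c2).
  exact: tf_continuous.
have FE p : F (tval p.1, p.2) = f p by rewrite /F /= time_of_tval; case: p.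
have e20 : 0 < e / 2 by rewrite divr_gt0.
move: cF => /cvgrPdist_lt/(_ _ e20)/nbhs_ballP[r /= r0 rF].
have r20 : 0 < r / 2 by rewrite divr_gt0.
near=> x' k => p' h1 h2.
have k2 : 2^-1 ^+ k < r / 2 by near: k; exact: near_exp_half.
have {}h1 := le_lt_trans h1 k2; have {k2}h2 := le_lt_trans h2 k2.
have x1 : `|tval x.1 - tval x'.1| < r / 2.
  near: x'; have /cvgrPdist_lt := @continuous_coord1 R x.
  by move=> /(_ _ r20).
have x2 : `|x.2 - x'.2| < r / 2.
  near: x'; have /cvgrPdist_lt := @continuous_coord2 R x.
  by move=> /(_ _ r20).
have close p : `|tval x.1 - tval p.1| < r -> `|x.2 - p.2| < r -> `|f x - f p| < e / 2.
  by move=> p1 p2; have := rF (tval p.1, p.2); rewrite !FE; apply; split.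
have fx' : `|f x - f x'| < e / 2 by apply: close; lra.
have fp' : `|f x - f p'| < e / 2.
  apply: close.
    have := ler_distD (tval x'.1) (tval x.1) (tval p'.1); lra.
  have := ler_distD (x'.2) x.2 p'.2; lra.
by have := ler_distD (f x) (f x') (f p'); rewrite (distrC (f x') (f x)); lra.
Unshelve. all: by end_near. Qed.

Section grid_step_function.
Variables (L n : nat) (m : pmeas R).
Implicit Types (a : gcell L n -> R).

Definition grid_step a (p : spacetime R) : R :=
  \sum_(c : gcell L n) a c * \1_(gbox R c) p.

Lemma grid_stepE a c p : gbox R c p -> grid_step a p = a c.
Proof.
move=> cp; rewrite /grid_step (bigD1 c)//= indicE mem_set// mulr1.
rewrite big1 ?addr0// => c' cc'; rewrite indicE memNset ?mulr0// => c'p.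
by move/eqP: cc'; apply; exact: gbox_inj c'p cp.
Qed.

Lemma grid_step0 a p : (forall c : gcell L n, ~ gbox R c p) -> grid_step a p = 0.
Proof.
by move=> cp; rewrite /grid_step big1// => c _; rewrite indicE memNset ?mulr0.
Qed.

Let integrable_term a c :
  m.-integrable setT (fun p => (a c * \1_(gbox R c) p)%:E).
Proof.
under eq_fun do rewrite EFinM.
apply: integrableZl => //; apply/integrableP; split.
  by apply/measurable_EFinP; apply: measurable_indic; exact: measurable_dbox.
under eq_integral do rewrite gee0_abs ?lee_fin//.
rewrite integral_indic ?setIT; [exact: dbox_fin|exact: measurableT|].
exact: measurable_dbox.
Qed.

Lemma integrable_grid_step a : m.-integrable setT (EFin \o grid_step a).
Proof.
have -> : EFin \o grid_step a =
    (fun p => \sum_(c : gcell L n) (a c * \1_(gbox R c) p)%:E)%E.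
  by apply/funext => p; rewrite /= sumEFin.
by apply: integrable_sum => // c _; exact: integrable_term.
Qed.

Lemma Rintegral_grid_step a : \int[m]_p grid_step a p =
  \sum_(c : gcell L n) a c * fine (m (gbox R c)).
Proof.
rewrite /Rintegral; under eq_integral do rewrite -sumEFin.
rewrite (integral_sum measurableT (integrable_term a)).
rewrite (eq_bigr (fun c => (a c * fine (m (gbox R c)))%:E)) ?sumEFin// => c _.
under eq_integral do rewrite EFinM.
rewrite integralZl//; last first.
  apply/integrableP; split.
    by apply/measurable_EFinP; apply: measurable_indic; exact: measurable_dbox.
  under eq_integral do rewrite gee0_abs ?lee_fin//.
  rewrite integral_indic ?setIT; [exact: dbox_fin|exact: measurableT|].
  exact: measurable_dbox.
rewrite integral_indic ?setIT; [|exact: measurableT|exact: measurable_dbox].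
by rewrite EFinM fineK ?dbox_fin_num.
Qed.

Lemma sum_gbox_le : \sum_(c : gcell L n) fine (m (gbox R c)) <=
  fine (m (rect L%:R (- L.+1%:R) L%:R)).
Proof.
have := Rintegral_grid_step (fun=> 1).
under eq_bigr do rewrite mul1r.
move=> <-; set K := rect _ _ _; have mK : measurable K by exact: measurable_rect.
have iK : m.-integrable setT (EFin \o (\1_K : _ -> R)).
  apply/integrableP; split.
    by apply/measurable_EFinP; exact: measurable_indic.
  under eq_integral do rewrite gee0_abs ?lee_fin//.
  by rewrite integral_indic// setIT; exact: rect_fin.
have -> : fine (m K) = \int[m]_p (\1_K : _ -> R) p.
  by rewrite /Rintegral integral_indic// setIT.
apply: le_Rintegral => //; first exact: integrable_grid_step.
move=> p _; have [[c cp]|/forallNP cp] := pselect (exists c : gcell L n, gbox R c p).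
  by rewrite (grid_stepE _ cp) indicE mem_set//; exact: gbox_rect cp.
by rewrite grid_step0.
Qed.

(** The step functions with values [a c - e] and [a c + e] enclose [f], also off the grid, where all
    three vanish. *)
Lemma weak_ev_grid f a (e : R) :
  (forall p, f p != 0 -> rect L%:R (- L%:R) L%:R p) ->
  (forall c p, gbox R c p -> `|f p - a c| <= e) ->
  `|weak_ev m f - \sum_(c : gcell L n) a c * fine (m (gbox R c))| <=
    e * \sum_(c : gcell L n) fine (m (gbox R c)).
Proof.
move=> supp fa; set S := \sum_c a c * _.
have bd p : grid_step (fun c => a c - e) p <= f p <= grid_step (fun c => a c + e) p.
  have [[c cp]|/forallNP cp] := pselect (exists c : gcell L n, gbox R c p).
    by rewrite !(grid_stepE _ cp); have := fa c p cp; rewrite ler_norml; lra.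
  rewrite !grid_step0//; suff -> : f p = 0 by rewrite lexx.
  apply/eqP; apply: contrapT => /negP/supp /(@gbox_ex _ L n)[c].
  exact: cp.
have intf : m.-integrable setT (EFin \o f).
  apply: (le_integrable measurableT _ _
    (integrable_grid_step (fun c => `|a c| + `|e|))).
    by apply/measurable_EFinP; apply: measurable_continuous; exact: tf_continuous.
  move=> p _; rewrite /= !lee_fin; have := bd p.
  have [[c cp]|/forallNP cp] := pselect (exists c : gcell L n, gbox R c p).
    rewrite !(grid_stepE _ cp) => /andP[lo hi].
    rewrite (ger0_norm (_ : 0 <= `|a c| + `|e|)) ?addr_ge0// ler_norml.
    have := ler_norm (a c); have := ler_norm (- a c).
    have := ler_norm e; rewrite normrN; lra.
  by rewrite !grid_step0// => ?; rewrite normr0 normr_le0; apply/eqP; lra.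
have up : weak_ev m f <= S + e * \sum_(c : gcell L n) fine (m (gbox R c)).
  rewrite mulr_sumr -big_split/=; under eq_bigr do rewrite -mulrDl.
  rewrite -Rintegral_grid_step; apply: le_Rintegral => //.
    exact: integrable_grid_step.
  by move=> p _; have /andP[] := bd p.
have lo : S - e * \sum_(c : gcell L n) fine (m (gbox R c)) <= weak_ev m f.
  rewrite mulr_sumr -sumrB; under eq_bigr do rewrite -mulrBl.
  rewrite -Rintegral_grid_step; apply: le_Rintegral => //.
    exact: integrable_grid_step.
  by move=> p _; have /andP[] := bd p.
by rewrite ler_norml; lra.
Qed.

End grid_step_function.

Lemma gbox_same_counts (L n : nat) m m' (c : gcell L n) : (L <= n)%N ->
  same_counts n m m' -> m (gbox R c) = m' (gbox R c).
Proof.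
move=> Ln mm'; apply: mm'; apply: leq_trans (gindex_bound _) _;
  by rewrite leq_mul2r Ln orbT.
Qed.

(** Counts at a fine level give the integral of a test function up to its oscillation on a box times
    the mass of the grid, and this mass is the same for [m'] as for [m]. Hence the sets [E n]
    generate a filter converging weak* to [m]. The bound [n0] serves to reach a level at which a
    given dyadic time is a grid time. *)
Lemma open_same_counts (U : set (pmeas R)) m (n0 : nat) : open U -> U m ->
  exists2 n, (n0 <= n)%N & forall m', same_counts n m m' -> U m'.
Proof.
move=> oU Um; pose E n := [set m' | same_counts n m m'].
pose F : set_system (pmeas R) := filter_from [set n | (n0 <= n)%N] E.
have FF : Filter F.
  apply: filter_from_filter; first by exists n0 => /=.
  move=> i j /= ni nj; exists (maxn i j); first by rewrite /= leq_max ni.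
  by move=> m' h; split; apply: same_countsW h; rewrite leq_max leqnn ?orbT.
suff Fm : F --> m.
  have [n nn0 nU] := Fm U (open_nbhs_nbhs (conj oU Um)).
  by exists n => // m' /nU.
apply: pmeas_cvg => f; apply/cvgrPdist_lt => e e0.
have [L supp] := test_fun_supp f.
pose M := fine (m (rect L%:R (- L.+1%:R) L%:R)).
have M0 : 0 <= M by apply: fine_ge0.
(* The error [e' * M] occurs twice, for [m] and for [m']; [M + 1] keeps the denominator positive. *)
pose e' := e / (2 * (M + 1)).
have e'0 : 0 < e' by rewrite divr_gt0// mulr_gt0//; lra.
have [k _ kP] := test_fun_unif f L%:R (- L.+1%:R) L%:R e'0.
pose n := maxn (maxn k L) n0.
have kn : (k <= n)%N by rewrite !leq_max leqnn.
have Ln : (L <= n)%N by rewrite !leq_max leqnn orbT.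
exists n; first by rewrite /= leq_max leqnn orbT.
move=> m' mm'.
pose a (c : gcell L n) : R := f (time_of (dy R n (gindex c.1)), dy R n (gindex c.2)).
have fa (c : gcell L n) p : gbox R c p -> `|f p - a c| <= e'.
  move=> cp; have Kp := gbox_rect cp; apply: (kP n kn p Kp).
    have /dboxP[+ _] := cp => <-; rewrite time_ofK ?cell_dist//.
    by apply: le_trans (tval_ge0 p.1) _; have /andP[] := dy_ceil n (tval p.1).
  by have /dboxP[_ +] := cp => <-; exact: cell_dist.
have h := weak_ev_grid m supp fa; have h' := weak_ev_grid m' supp fa.
have es (b : gcell L n -> R) : \sum_c b c * fine (m' (gbox R c)) =
    \sum_c b c * fine (m (gbox R c)).
  by apply: eq_bigr => c _; rewrite (gbox_same_counts c Ln mm').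
have es1 : \sum_(c : gcell L n) fine (m' (gbox R c)) =
    \sum_(c : gcell L n) fine (m (gbox R c)).
  by apply: eq_bigr => c _; rewrite (gbox_same_counts c Ln mm').
move: h h'; rewrite es es1.
have := sum_gbox_le L n m; rewrite -/M.
move: (\sum_c a c * _) (\sum_c _) => S N NM h h'.
have e'N : e' * N <= e' * M by rewrite ler_wpM2l// ltW.
have e'e : e' * M * 2 < e.
  have : e' * (2 * (M + 1)) = e by rewrite /e' divfK// gt_eqF//; lra.
  by rewrite mulrDr mulrDr mulrA -mulrA (mulrC 2 M) mulrA mulr1; lra.
have := ler_distD S (weak_ev m f) (weak_ev m' f).
by rewrite (distrC S (weak_ev m' f)); lra.
Qed.

End weak_topology.

(** * Poisson processes *)

Section poisson_mass.
Variable R : realType.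
Local Open Scope ereal_scope.

Definition pois (l : R) (k : nat) : R := (expR (- l) * l ^+ k / k`!%:R)%R.

Lemma pois_ge0 l k : (0 <= l)%R -> (0 <= pois l k)%R.
Proof. by move=> l0; rewrite divr_ge0// mulr_ge0 ?expR_ge0 ?exprn_ge0. Qed.

Lemma pois_sum l : (0 <= l)%R -> \sum_(k <oo) (pois l k)%:E = 1.
Proof.
move=> l0; have -> : 1 = (expR (- l) * expR l)%:E :> \bar R.
  by rewrite expRN mulVf ?gt_eqF ?expR_gt0.
apply/cvg_lim => //.
have h : (expR (- l) * series (exp_coeff l) n)%R @[n --> \oo] --> (expR (- l) * expR l)%R.
  by apply: cvgMl_tmp; exact: is_cvg_series_exp_coeff.
apply: (@cvg_trans _ ((expR (- l) * series (exp_coeff l) n)%:E @[n --> \oo])).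
  suff -> : (fun n => \sum_(0 <= k < n) (pois l k)%:E) =
    (fun n => (expR (- l) * series (exp_coeff l) n)%:E) by [].
  apply/funext => n; rewrite sumEFin; congr EFin.
  by rewrite /series mulr_sumr; apply: eq_bigr => k _; rewrite /pois mulrA.
by apply: cvg_EFin; [exact: nearW|exact: h].
Qed.

(** Shift of the index: [k * pois l k] is [l * pois l (k - 1)]. *)
Lemma pois_mean l : (0 <= l)%R ->
  \sum_(k <oo) ((k%:R * pois l k)%R)%:E <= l%:E.
Proof.
move=> l0; have p0 k : 0 <= (k%:R * pois l k)%:E.
  by rewrite lee_fin mulr_ge0// pois_ge0.
apply: lime_le; first exact: is_cvg_nneseries.
apply: nearW => n; have -> : l%:E = l%:E * \sum_(k <oo) (pois l k)%:E.
  by rewrite pois_sum// mule1.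
case: n => [|n]; first by rewrite big_nil pois_sum// mule1 lee_fin.
rewrite big_nat_recl// mul0r add0e.
have -> : \sum_(0 <= i < n) (i.+1%:R * pois l i.+1)%:E =
    l%:E * \sum_(0 <= i < n) (pois l i)%:E.
  rewrite ge0_sume_distrr => [|k _]; last by rewrite lee_fin pois_ge0.
  apply: eq_bigr => k _; rewrite -EFinM; congr EFin.
  rewrite /pois exprS factS natrM invfM; field.
  by rewrite pnatr_eq0 -lt0n fact_gt0 addrC natr1 pnatr_eq0.
rewrite lee_wpmul2l ?lee_fin//.
by apply: nneseries_lim_ge => k _; rewrite lee_fin pois_ge0.
Qed.

End poisson_mass.

Section box_area.
Variable R : realType.
Implicit Types s t c d : R.
Local Open Scope ereal_scope.

Lemma area_box s t c d : area (box s t c d) =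
  lebesgue_measure (`]s, t]%classic `&` `[0%R, +oo[%classic : set R) *
  lebesgue_measure (`]c, d]%classic : set R).
Proof.
rewrite /area.
have -> : [set (tval p.1, p.2) | p in box s t c d] =
    (`]s, t]%classic `&` `[0%R, +oo[%classic) `*` `]c, d]%classic.
  apply/seteqP; split=> [_ [p [pst pcd] <-]|[u x] [[ust u0] xcd]] /=.
    by rewrite !in_itv/= pst pcd tval_ge0.
  move: ust u0 xcd; rewrite /= !in_itv/= andbT => ust u0 xcd.
  by exists (time_of u, x); [split; rewrite /= ?time_ofK|rewrite /= time_ofK].
rewrite product_measure1E//; exact: measurableI.
Qed.

Lemma area_box_le s t c d : (s <= t)%R -> (c <= d)%R ->
  area (box s t c d) <= ((t - s) * (d - c))%:E.
Proof.
move=> st cd; rewrite area_box EFinM.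
have itv (a b : R) : (a <= b)%R -> lebesgue_measure (`]a, b]%classic : set R) = (b - a)%:E.
  rewrite lebesgue_measure_itv/= lte_fin le_eqVlt => /predU1P[->|->].
    by rewrite ltxx subrr.
  by rewrite EFinB.
rewrite (itv c d)//; apply: lee_wpmul2r; first by rewrite lee_fin subr_ge0.
rewrite -(itv s t)//; apply: le_measure; rewrite ?inE//; exact: measurableI.
Qed.

Lemma area_box_lty s t c d : area (box s t c d) < +oo.
Proof.
have [st|ts] := leP s t; last first.
  rewrite (_ : box s t c d = set0) ?/area ?image_set0 ?measure0//.
  by apply/seteqP; split=> // p [/andP[sp pt] _]; move: (lt_le_trans sp pt); rewrite ltNge ltW.
have [cd|dc] := leP c d; last first.
  rewrite (_ : box s t c d = set0) ?/area ?image_set0 ?measure0//.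
  by apply/seteqP; split=> // p [_ /andP[sp pt]]; move: (lt_le_trans sp pt); rewrite ltNge ltW.
by apply: le_lt_trans (area_box_le st cd) _; rewrite ltry.
Qed.

Lemma area_ge0 (B : set (spacetime R)) : 0 <= area B.
Proof. exact: measure_ge0. Qed.

Lemma area_box0 s t c d : (t <= 0)%R -> area (box s t c d) = 0.
Proof.
move=> t0; rewrite area_box; apply/eqP; rewrite mule_eq0; apply/orP; left.
rewrite -measure_le0 -(@lebesgue_measure_set1 R 0%R).
apply: le_measure; rewrite ?inE//; first exact: measurableI.
move=> u [] /=; rewrite !in_itv/= andbT => /andP[_ ut] u0.
by apply/eqP; rewrite eq_le u0 (le_trans ut).
Qed.

End box_area.

Section poisson_process.
Variables (R : realType) (mu : probability (Omega R) R).
Hypothesis mu_poisson : poisson_law (pushforward mu fst).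
Local Open Scope ereal_scope.
Implicit Types (s t c d : R) (w : Omega R).

Definition mean s t c d : R := fine (area (box s t c d)).

Lemma mean_ge0 s t c d : (0 <= mean s t c d)%R.
Proof. by rewrite fine_ge0// area_ge0. Qed.

Lemma measurable_Pt_count s t c d :
  measurable_fun setT (fun w => Pt w (box s t c d)).
Proof.
apply: (@measurableT_comp _ _ _ _ _ _ (fun m : borel (pmeas R) => pm m (box s t c d))).
  exact: measurable_count.
exact: measurable_fst.
Qed.

Lemma measurable_Pt_count_eq s t c d (x : \bar R) :
  measurable [set w | Pt w (box s t c d) = x].
Proof.
rewrite -[X in measurable X]setTI.
exact: (measurable_Pt_count s t c d) measurableT _ (emeasurable_set1 x).
Qed.

Lemma poisson_count s t c d k :
  mu [set w | Pt w (box s t c d) = k%:R%:E] = (pois (mean s t c d) k)%:E.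
Proof.
have [h _] := mu_poisson.
exact: (h (box s t c d) k (measurable_box s t c d) (area_box_lty s t c d)).
Qed.

(** A [pmeas] may have arbitrary weights; integrality follows from the Poisson probabilities of the
    disjoint events [E k] adding up to 1. *)
Lemma ae_nat_count s t c d :
  \forall w \ae mu, exists k : nat, Pt w (box s t c d) = k%:R%:E.
Proof.
pose E k := [set w | Pt w (box s t c d) = k%:R%:E].
have mE k : measurable (E k) by exact: measurable_Pt_count_eq.
have tE : trivIset setT E.
  apply/trivIsetP => i j _ _ ij; apply/seteqP; split=> // w [Ei Ej].
  by have := etrans (esym Ei) Ej => -[] /eqP; rewrite eqr_nat (negbTE ij).
have mU : measurable (\bigcup_k E k) by exact: bigcupT_measurable.
have muE : mu (\bigcup_k E k) = 1.
  rewrite measure_semi_bigcup// -(pois_sum (mean_ge0 s t c d)).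
  by apply: eq_eseriesr => k _; exact: poisson_count.
exists (~` \bigcup_k E k); split.
- exact: measurableC.
- by rewrite probability_setC// muE subee.
- by move=> w h [k _ Ek]; apply: h; exists k.
Qed.

(** Almost surely the count is the sum over [k] of [k] times the indicator of [E k], which is
    integrated term by term. *)
Lemma expected_count s t c d :
  \int[mu]_w Pt w (box s t c d) <= (mean s t c d)%:E.
Proof.
pose E k := [set w | Pt w (box s t c d) = k%:R%:E].
have mE k : measurable (E k) by exact: measurable_Pt_count_eq.
pose f k w : \bar R := (k%:R * \1_(E k) w)%:E.
have mf k : measurable_fun setT (f k).
  apply/measurable_EFinP; apply: measurable_funM => //.
have f0 k w : 0 <= f k w by rewrite lee_fin mulr_ge0.
have -> : \int[mu]_w Pt w (box s t c d) = \int[mu]_w \sum_(k <oo) f k w.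
  apply: ge0_ae_eq_integral => //.
  - exact: measurable_Pt_count.
  - exact: ge0_emeasurable_sum.
  - by move=> w _; exact: nneseries_ge0.
  move: (ae_nat_count s t c d); apply: filterS => w [k wk] _.
  rewrite (@nneseriesD1 _ _ k)// eseries0 ?adde0.
    by rewrite /f indicE mem_set// mulr1.
  move=> i _ /andP[_ ik]; rewrite /f indicE memNset ?mulr0// => Ei.
  by have := etrans (esym Ei) wk => -[] /eqP; rewrite eqr_nat (negbTE ik).
rewrite integral_nneseries//.
apply: le_trans (pois_mean (mean_ge0 s t c d)).
apply: lee_nneseries => [k _ _|k _]; first exact: integral_ge0.
rewrite /f; under eq_integral do rewrite EFinM.
rewrite ge0_integralZl//; last by apply/measurable_EFinP.
rewrite integral_indic// setIT EFinM le_eqVlt; apply/orP; left; apply/eqP.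
congr (_ * _); exact: poisson_count.
Qed.

Lemma ae_forall_count (I : countType) (P : I -> Omega R -> Prop) :
  (forall i, \forall w \ae mu, P i w) -> \forall w \ae mu, forall i, P i w.
Proof.
move=> aP; have : \forall w \ae mu, forall n : nat,
    if unpickle n is Some i then P i w else True.
  apply: ae_foralln => n; case: (unpickle n) => [i|]; first exact: aP.
  exact: aeW.
by apply: filterS => w h i; have := h (pickle i); rewrite pickleK.
Qed.

Lemma ae_nat_dbox : \forall w \ae mu, forall k (a b : int),
  exists j : nat, Pt w (dbox R k a b) = j%:R%:E.
Proof.
have h : \forall w \ae mu, forall x : nat * int * int,
    exists j : nat, Pt w (dbox R x.1.1 x.1.2 x.2) = j%:R%:E.
  by apply: ae_forall_count => x; exact: ae_nat_count.
by move: h; apply: filterS => w h k a b; exact: (h (k, a, b)).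
Qed.

(** The left limit at time 0 is unspecified, so atoms on the initial line have to be excluded; that
    line has area 0. *)
Lemma ae_no_atom0 : \forall w \ae mu, forall n : nat,
  Pt w (box (-1) 0 (- n%:R) n%:R) = 0.
Proof.
apply: ae_foralln => n.
have := poisson_count (-1) 0 (- n%:R) n%:R 0%N.
rewrite /mean area_box0// /pois oppr0 expR0 expr0 mul1r fact0 divr1.
set E := [set w | _] => muE.
have mE : measurable E by exact: measurable_Pt_count_eq.
exists (~` E); split; first exact: measurableC.
  by have := probability_setC mu mE; rewrite muE subee.
by [].
Qed.

Definition tail_weight (T : nat) w : \bar R :=
  \sum_(n <oo) (4^-1 ^+ n)%:E * Pt w (box (-1) T%:R (- 2 ^+ n) (2 ^+ n)).

(** The [n]-th box has area at most [2 (T + 1) 2^n], so the [n]-th term has expectation at most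
    [2 (T + 1) 2^-n]; the sum has finite expectation and is finite almost surely. *)
Lemma ae_tail_weight : \forall w \ae mu, forall T : nat, tail_weight T w < +oo.
Proof.
apply: ae_foralln => T.
pose f n w := (4^-1 ^+ n)%:E * Pt w (box (-1) T%:R (- 2 ^+ n) (2 ^+ n)) : \bar R.
have mf n : measurable_fun setT (f n).
  by apply: measurable_funeM; exact: measurable_Pt_count.
have e0 n : (0 <= 4^-1 ^+ n :> R)%R by rewrite exprn_ge0// invr_ge0.
have f0 n w : 0 <= f n w by apply: mule_ge0; rewrite ?lee_fin.
have g0 w : 0 <= tail_weight T w by apply: nneseries_ge0 => n _ _; exact: f0.
have itw : mu.-integrable setT (tail_weight T).
  apply/integrableP; split.
    have : measurable_fun setT (fun w => \sum_(n <oo) f n w).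
      exact: ge0_emeasurable_sum.
    by [].
  under eq_integral do rewrite gee0_abs//.
  rewrite integral_nneseries//.
  apply: (@le_lt_trans _ _ (\sum_(n <oo) ((2 * (T%:R + 1)) * 2^-1 ^+ n)%:E)).
    apply: lee_nneseries => [n _ _|n _]; first exact: integral_ge0.
    rewrite ge0_integralZl//; last exact: measurable_Pt_count.
    apply: (@le_trans _ _ ((4^-1 ^+ n)%:E * ((T%:R - -1) * (2 ^+ n - - 2 ^+ n))%:E)).
      rewrite lee_wpmul2l ?lee_fin//; apply: le_trans (expected_count _ _ _ _) _.
      rewrite /mean fineK ?ge0_fin_numE ?area_ge0 ?area_box_lty//.
      apply: area_box_le; first by apply: le_trans (ler0n _ _); rewrite oppr_le0.
      by apply: (@le_trans _ _ 0%R); rewrite ?oppr_le0 exprn_ge0.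
    rewrite -EFinM lee_fin opprK opprK -mulr2n mulrA.
    have -> : (4^-1 ^+ n = 2^-1 ^+ n * 2^-1 ^+ n :> R)%R.
      by rewrite -exprMn -invfM -natrM.
    have e2 : (2^-1 ^+ n * 2 ^+ n = 1 :> R)%R by rewrite -exprMn mulVf// expr1n.
    move: e2; move: (2^-1 ^+ n)%R (2 ^+ n)%R => x y xy.
    have -> : (x * x * (T%:R + 1) * (y *+ 2) = 2 * (T%:R + 1) * x * (x * y))%R.
      by rewrite -(mulr_natr y 2); ring.
    by rewrite xy mulr1.
  (* The geometric series used here has terms [r / 2 ^ k.+1], hence one more factor 2. *)
  pose r : R := (4 * (T%:R + 1))%R.
  have := @cvg_geometric_eseries_half R r 0; rewrite expr0 divr1.
  move=> /cvg_lim => cv; rewrite (_ : \sum_(n <oo) _ = r%:E) ?ltry//.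
  rewrite -cv//; congr (limn _); apply/funext => n; apply: eq_bigr => k _.
  congr EFin; rewrite /r addn1 natrX exprS invfM exprVn; field.
  by rewrite lt0r_neq0// exprn_gt0.
move: (integrable_ae measurableT itw); apply: filterS => w /(_ I).
by rewrite ge0_fin_numE.
Qed.

End poisson_process.

Section restriction_counts.
Variable R : realType.

(** At a level where [t] is a grid time, a box lies inside the strip or is disjoint from it, so the
    counts of the restriction are read off those of [m]. *)
Lemma prestr_dbox (t : time R) (m : pmeas R) k (a b z : int) :
  tval t = dy R k z ->
  prestr time0 t m (dbox R k a b) =
    if 0 < a <= z then m (dbox R k a b) else 0%E.
Proof.
move=> tz; have t0 : tval (time0 : time R) = dy R k 0 by rewrite /dy mul0r.
rewrite -[LHS]/(m (dbox R k a b `&` strip time0 t)).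
have st p : dbox R k a b p -> strip time0 t p = (0 < a <= z) :> Prop.
  move=> /dboxP[<- _]; rewrite /strip /= tz t0.
  by rewrite -cell_gt -cell_le.
case: ifPn => az; last first.
  rewrite (_ : _ `&` _ = set0) ?measure0//; apply/seteqP; split=> // p [pd].
  by rewrite (st _ pd); apply/negP.
congr (m _); apply/seteqP; split=> [p []//|p pd]; split=> //.
by rewrite (st _ pd).
Qed.

Lemma same_counts_prestr (t : time R) (m m' : pmeas R) k n (z : int) :
  (k <= n)%N -> tval t = dy R k z -> same_counts n m m' ->
  same_counts n (prestr time0 t m) (prestr time0 t m').
Proof.
move=> kn; rewrite (dy_shift R _ kn) => tz mm' a b ha hb.
by rewrite !(prestr_dbox _ _ _ tz) mm'.
Qed.

End restriction_counts.

(** * Events determined by the counts, under two Poisson laws *)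

Section two_poisson_laws.
Variables (R : realType) (mu1 mu2 : probability (Omega R) R).
Hypothesis mu1_poisson : poisson_law (pushforward mu1 fst).
Hypothesis mu2_poisson : poisson_law (pushforward mu2 fst).
Implicit Types (w : Omega R) (n : nat).

Definition count_event n (q : {ffun gcell n n -> nat}) : set (Omega R) :=
  [set w | forall c, Pt w (gbox R c) = (q c)%:R%:E].

(** [set0] makes the family stable under intersection, and [setT] provides the exhausting sequence
    for the uniqueness of measures. *)
Definition count_events : set_system (Omega R) := [set A |
  [\/ A = set0, A = setT | exists n (q : {ffun gcell n n -> nat}), A = count_event q]].

Lemma measurable_count_event n (q : {ffun gcell n n -> nat}) :
  measurable (count_event q).
Proof.
apply: measurable_forall => c; exact: measurable_Pt_count_eq.
Qed.

Lemma count_event_law (mu : probability (Omega R) R) n (q : {ffun gcell n n -> nat}) :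
  poisson_law (pushforward mu fst) ->
  mu (count_event q) = (\prod_(i < #|{: gcell n n}|)
    (expR (- fine (area (gbox R (enum_val i)))) *
     fine (area (gbox R (enum_val i))) ^+ q (enum_val i) /
     (q (enum_val i))`!%:R)%:E)%E.
Proof.
move=> [h1 h2].
pose B (i : 'I_#|{: gcell n n}|) := gbox R (enum_val i).
pose S (i : 'I_#|{: gcell n n}|) : set (\bar R) := [set (q (enum_val i))%:R%:E].
have mB i : measurable (B i) by exact: measurable_dbox.
have tB : trivIset setT B.
  move=> i j _ _ [p [pi pj]].
  by have := gbox_inj pi pj => /enum_val_inj.
have := h2 _ B S mB tB (fun i => emeasurable_set1 _).
have -> : pushforward mu fst [set m : pmeas R | forall i, S i (m (B i))] =
    mu (count_event q).
  congr (mu _); apply/seteqP; split=> w h; last by move=> i; exact: h.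
  by move=> c; have := h (enum_rank c); rewrite /S /B /= enum_rankK.
move=> ->; apply: eq_bigr => i _.
exact: (h1 (B i) (q (enum_val i)) (mB i) (area_box_lty _ _ _ _)).
Qed.

(** The counts at level [n'] determine those at level [n], so the finer event is contained in the
    coarser one or disjoint from it. *)
Lemma count_event_meet n n' (q : {ffun gcell n n -> nat})
    (q' : {ffun gcell n' n' -> nat}) : (n <= n')%N ->
  count_event q `&` count_event q' = set0 \/
  count_event q `&` count_event q' = count_event q'.
Proof.
move=> nn'; have [[w [qw qw']]|/forallNP no] := pselect
  (exists w, (count_event q `&` count_event q') w); [right|left]; last first.
  by apply/seteqP; split=> // w /no.
apply/seteqP; split=> [v []//|v qv']; split=> // c; rewrite -(qw c).
apply: (gbox_same_counts c (leqnn n)); apply: same_countsW nn' _ => a b ha hb.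
have [i hi] := gindex_ex ha; have [j hj] := gindex_ex hb.
by have := qv' (i, j); have := qw' (i, j); rewrite /gbox /= hi hj => -> ->.
Qed.

Lemma count_events_setI : setI_closed count_events.
Proof.
move=> A B [->|->|[n [q ->]]] [->|->|[n' [q' ->]]];
  rewrite ?set0I ?setI0 ?setTI ?setIT; try by constructor.
- by constructor 3; exists n', q'.
- by constructor 3; exists n, q.
have [nn'|/ltnW n'n] := leqP n n'.
  by have [->|->] := count_event_meet q q' nn'; [constructor|constructor 3; exists n', q'].
rewrite setIC; have [->|->] := count_event_meet q' q n'n;
  by [constructor|constructor 3; exists n, q].
Qed.

Definition poisson_events : set_system (Omega R) := <<s count_events >>.

Lemma measurable_poisson_events : poisson_events `<=` measurable.
Proof.
apply: smallest_sub; first exact: sigma_algebra_measurable.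
by move=> A [->|->|[n [q ->]]]; [exact: measurable0|exact: measurableT|
  exact: measurable_count_event].
Qed.

Lemma poisson_events_eq A : poisson_events A -> mu1 A = mu2 A.
Proof.
apply: (@g_sigma_algebra_measure_unique _ R _ count_events _ (fun=> setT)) => //.
- by move=> A' GA'; apply: measurable_poisson_events; exact: sub_sigma_algebra.
- by move=> _; constructor 2.
- by rewrite bigcup_const.
- exact: count_events_setI.
- move=> _ [->|->|[n [q ->]]]; first by rewrite !measure0.
    exact: etrans (probability_setT mu1) (esym (probability_setT mu2)).
  exact: etrans (count_event_law q mu1_poisson) (esym (count_event_law q mu2_poisson)).
- by move=> _; rewrite -ge0_fin_numE// fin_num_measure.
Qed.

(* Sets that coincide, up to a null set of each of the two laws, with an event
   of the Poisson process. *)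
Definition Pevents : set_system (Omega R) := ae_system mu1 mu2 poisson_events.

Lemma Pevents_sigma_algebra : sigma_algebra setT Pevents.
Proof. exact/ae_system_sigma_algebra/smallest_sigma_algebra. Qed.

(** The closure properties of measurable functions on this type become proofs of membership in
    [Pevents]. *)
Definition OmegaP := g_sigma_algebraType Pevents.

Lemma measurable_PeventsE (A : set (Omega R)) :
  measurable (A : set OmegaP) = Pevents A.
Proof.
rewrite -[LHS]/(<<s Pevents >> A) sigma_algebra_id//.
exact: Pevents_sigma_algebra.
Qed.

(** There are only countably many events [count_event q], because [q] takes natural values. Almost
    surely all counts are natural, and then [E] coincides with the union of the count events that it
    contains. *)
Lemma Pevents_local (E : set (Omega R)) :
  (forall w, E w -> exists n, forall w', same_counts n (Pt w) (Pt w') -> E w') ->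
  Pevents E.
Proof.
move=> loc.
pose N (x : {n : nat & {ffun gcell n n -> nat}}) := count_event (tagged x).
pose A := \bigcup_(x in [set x | N x `<=` E]) N x.
have mA : poisson_events A.
  rewrite -[poisson_events A]/(measurable (A : set (g_sigma_algebraType count_events))).
  apply: measurable_bigcup_count => x _; apply: sub_sigma_algebra.
  by constructor 3; exists (tag x), (tagged x).
have key (mu : probability (Omega R) R) : poisson_law (pushforward mu fst) ->
    \forall w \ae mu, E w <-> A w.
  move=> /ae_nat_dbox; apply: filterS => w nat_w; split=> [Ew|[x NE] /NE//].
  have [n nE] := loc w Ew.
  have /choice[q qP] : forall c : gcell n n, exists j : nat, Pt w (gbox R c) = j%:R%:E.
    by move=> c; exact: nat_w.
  have wq : N (existT _ n [ffun c => q c]) w by move=> c /=; rewrite ffunE.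
  exists (existT _ n [ffun c => q c]) => // w' qw'; apply: nE => a b ha hb.
  have [i hi] := gindex_ex ha; have [j hj] := gindex_ex hb.
  by have := qw' (i, j); have := wq (i, j); rewrite /gbox /= hi hj => -> ->.
by exists A => //; split; apply: key.
Qed.

Lemma measurable_Pt : measurable_fun setT (fun w : OmegaP => Pt w : borel (pmeas R)).
Proof.
apply: (@measurability _ _ OmegaP (borel (pmeas R)) setT _
  (@open (pmeas R))) => // _ [U oU <-].
rewrite setTI measurable_PeventsE; apply: Pevents_local => w Uw.
have [n _ nU] := open_same_counts 0 oU Uw.
by exists n => w' /nU.
Qed.

Lemma measurable_prestr (t : time R) k (z : int) : tval t = dy R k z ->
  measurable_fun setT (fun w : OmegaP => prestr time0 t (Pt w) : borel (pmeas R)).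
Proof.
move=> tz; apply: (@measurability _ _ OmegaP (borel (pmeas R)) setT _
  (@open (pmeas R))) => // _ [U oU <-].
rewrite setTI measurable_PeventsE; apply: Pevents_local => w Uw.
(* A level at least [k] makes [t] a grid time. *)
have [n kn nU] := open_same_counts k oU Uw.
by exists n => w' /(same_counts_prestr kn tz)/nU.
Qed.

Lemma Pevents_eq (A : set (Omega R)) : measurable A -> Pevents A -> mu1 A = mu2 A.
Proof.
apply: ae_system_eq; first exact: measurable_poisson_events.
exact: poisson_events_eq.
Qed.

Lemma Pevents_ae (A : set (Omega R)) : Pevents A ->
  (\forall w \ae mu1, A w) -> (\forall w \ae mu2, A w).
Proof.
apply: ae_system_ae; first exact: smallest_sigma_algebra.
  exact: measurable_poisson_events.
exact: poisson_events_eq.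
Qed.

Lemma Pevents_modulo (A B : set (Omega R)) : Pevents B ->
  (\forall w \ae mu1, A w <-> B w) -> (\forall w \ae mu2, A w <-> B w) ->
  Pevents A.
Proof. exact: ae_system_modulo. Qed.

End two_poisson_laws.

(** * Uniqueness of the solutions at dyadic times *)

Section discrete_gronwall.
Variable R : realType.

Lemma halving_eq0 (x B : R) : 0 <= x -> (forall i, x <= B * 2^-1 ^+ i) -> x = 0.
Proof.
move=> x0 xB; apply/eqP; rewrite eq_le x0 andbT.
have : B * 2^-1 ^+ i @[i --> \oo] --> B * 0.
  apply: cvgMl_tmp; apply: cvg_expr.
  by rewrite ger0_norm ?invr_ge0// invf_lt1// ltr1n.
rewrite mulr0 => h; rewrite leNgt; apply/negP => xpos.
move/cvgrPdist_lt : h => /(_ x xpos)[i _ /(_ i (leqnn i))].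
rewrite sub0r normrN; apply/negP; rewrite -leNgt.
exact: le_trans (xB i) (ler_norm _).
Qed.

(* A Gronwall lemma with respect to a purely atomic clock: [r t q] is the mass
   of ]t, q], and the value of [D] at [q] is controlled by its values strictly
   before [q]. *)
Lemma gronwall_clock (Q : set R) (D : R -> R) (r : R -> R -> R) (T B : R) :
  0 <= T ->
  (forall q, Q q -> q <= T -> 0 <= q /\ 0 <= D q <= B) ->
  (forall t q q', q <= q' -> 0 <= r t q <= r t q') ->
  (forall t, 0 <= t -> exists2 d, 0 < d & r t (t + d) <= 2^-1) ->
  (forall t phi q, 0 <= t -> 0 <= phi -> Q q -> q <= T ->
    (forall u, Q u -> u < t -> u < q -> D u = 0) ->
    (forall u, Q u -> u < q -> D u <= phi) -> D q <= phi * r t q) ->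
  forall q, Q q -> q <= T -> D q = 0.
Proof.
move=> T0 QD r_ge0 r_small step.
pose Z := [set t | 0 <= t <= T /\ forall u, Q u -> u < t -> D u = 0].
have Z0 : Z 0.
  split; first by rewrite lexx.
  by move=> u Qu u0; have [] := QD u Qu (le_trans (ltW u0) T0); rewrite leNgt u0.
have ubZ : ubound Z T by move=> t [/andP[]].
have supZ : has_sup Z by split; [exists 0|exists T].
pose tau := sup Z.
have tau0 : 0 <= tau by apply: sup_upper_bound.
have tauT : tau <= T by apply: ge_sup => //; exists 0.
have Dtau u : Q u -> u < tau -> D u = 0.
  move=> Qu /(sup_gt (ex_intro _ 0 Z0))[t [_ Zt] ut]; exact: Zt.
have [d d0 rd] := r_small tau tau0.
have D0 q : Q q -> q <= T -> q <= tau + d -> D q = 0.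
  (* Up to [tau + d] the clock started at [tau] gains at most 1/2, so one use of [step] halves any
     bound on [D]; iterating from [B] leaves only 0. *)
  suff h i : forall q, Q q -> q <= T -> q <= tau + d -> D q <= B * 2^-1 ^+ i.
    move=> Qq qT qd; have [_ /andP[Dq0 _]] := QD q Qq qT.
    by apply: (@halving_eq0 _ B) => // i; exact: h.
  elim: i => [|i IH] {}q Qq qT qd; have [q0 /andP[Dq0 DB]] := QD q Qq qT.
    by rewrite expr0 mulr1.
  have B0 : 0 <= B by exact: le_trans DB.
  have phi0 : 0 <= B * 2^-1 ^+ i by rewrite mulr_ge0// exprn_ge0// invr_ge0.
  have := step tau _ q tau0 phi0 Qq qT (fun u Qu ut _ => Dtau u Qu ut)
    (fun u Qu uq => IH u Qu (le_trans (ltW uq) qT) (le_trans (ltW uq) qd)).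
  move=> /le_trans; apply; rewrite exprSr mulrA ler_wpM2l//.
  by apply: le_trans rd; have /andP[] := r_ge0 tau _ _ qd.
(* The supremum could therefore be increased, unless it has reached [T]. *)
have : Z (Num.min (tau + d) T).
  split; first by rewrite ge_min lexx orbT andbT le_min T0 andbT addr_ge0// ltW.
  by move=> u Qu; rewrite lt_min => /andP[ud uT]; apply: D0 => //; exact: ltW.
move=> /(sup_upper_bound supZ); rewrite -/tau ge_min => /orP[|Ttau].
  by rewrite gerDl leNgt d0.
move=> q Qq qT; apply: D0 => //; apply: le_trans qT (le_trans Ttau _).
by rewrite lerDl ltW.
Qed.

End discrete_gronwall.

(** * The weighted measure serving as a clock *)

Section weighted_measure.
Variables (R : realType) (m : pmeas R).
Local Open Scope ereal_scope.

Definition slab (n : nat) : set (spacetime R) :=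
  [set p | (- 2 ^+ n < p.2 <= 2 ^+ n)%R].

Lemma measurable_slab n : measurable (slab n).
Proof.
have -> : slab n = setT `&` (snd @^-1` `](- 2 ^+ n)%R, (2 ^+ n)%R]).
  by rewrite setTI; apply/seteqP; split=> p /=; rewrite in_itv.
exact: (measurable_continuous (@continuous_coord2 R)).
Qed.

Lemma quarter_ge0 n : (0 <= 4^-1 ^+ n :> R)%R.
Proof. by rewrite exprn_ge0// invr_ge0. Qed.

Definition rho : {measure set (spacetime R) -> \bar R} :=
  mseries (fun n => mscale (NngNum (quarter_ge0 n)) (mrestr m (measurable_slab n))) 0.

Lemma rhoE A : rho A = \sum_(n <oo) (4^-1 ^+ n)%:E * m (A `&` slab n).
Proof. by []. Qed.

Definition between (s t : R) : set (spacetime R) := [set p | (s < tval p.1 <= t)%R].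

Lemma measurable_between s t : measurable (between s t).
Proof.
have -> : between s t = setT `&` ((fun p => tval p.1) @^-1` `]s, t]).
  by rewrite setTI; apply/seteqP; split=> p /=; rewrite in_itv.
exact: (measurable_continuous (@continuous_coord1 R)).
Qed.

(** Continuity from above: the strips over ]t, t + 1 / (i + 1)] decrease to the empty set. Atoms at
    time [t] itself are excluded, so the clock starts from 0 even at a jump. *)
Lemma rho_between0 (t : R) : (forall T : nat, rho (between (-1) T%:R) < +oo) ->
  forall e : R, (0 < e)%R -> exists2 d : R, (0 < d)%R & rho (between t (t + d)) <= e%:E.
Proof.
move=> rfin e e0; pose F (i : nat) := between t (t + i.+1%:R^-1).
have mF i : measurable (F i) by exact: measurable_between.
have F0 : \bigcap_i F i = set0.
  apply/seteqP; split=> // p Fp; have := Fp 0%N I => /andP[tp _].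
  have p0 : (0 < tval p.1 - t)%R by rewrite subr_gt0.
  have /= := Fp (Num.bound (tval p.1 - t)^-1) I => /andP[_].
  rewrite -lerBlDl leNgt => /negP; apply.
  rewrite invf_plt ?posrE//; apply: lt_trans (archi_boundP _) _.
    by rewrite invr_ge0 ltW.
  by rewrite ltr_nat.
have F0fin : rho (F 0%N) < +oo.
  apply: le_lt_trans (rfin (Num.bound (`|t + 1|)%R)).
  apply: le_measure; rewrite ?inE//; first exact: measurable_between.
  move=> p /andP[_ pt]; apply/andP; split.
    by apply: lt_le_trans (tval_ge0 _); rewrite ltrN10.
  apply: le_trans pt _; rewrite invr1.
  exact: le_trans (ler_norm _) (ltW (archi_boundP _)).
have niF : nonincreasing_seq F.
  move=> i j ij; apply/subsetPset => p /andP[tp pt]; apply/andP; split=> //.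
  by apply: le_trans pt _; rewrite lerD2l lef_pV2 ?posrE// ler_nat.
have mb : measurable (\bigcap_i F i) by rewrite F0; exact: measurable0.
have := nonincreasing_cvg_mu F0fin mF mb niF; rewrite F0 measure0.
move=> /fine_cvgP[_ /cvgrPdist_lt/(_ e e0)[i _ /(_ i (leqnn i))]].
rewrite sub0r normrN => /ltW h; exists (i.+1%:R^-1)%R; first by rewrite invr_gt0.
rewrite -/(F i) -[leLHS]fineK ?lee_fin; last first.
  rewrite ge0_fin_numE//; apply: le_lt_trans F0fin.
  by apply: le_measure; rewrite ?inE//; apply/subsetPset; exact: niF.
exact: le_trans (ler_norm _) h.
Qed.

End weighted_measure.
Arguments slab R n : clear implicits.

Section mesh_sums.
Variable R : realType.
Implicit Types (m : pmeas R) (f g : time R -> R[i]) (n k J : nat).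

Definition dtime k (j : nat) : time R := time_of (dy R k j).

Lemma dtimeE k j : tval (dtime k j) = dy R k j.
Proof. by rewrite time_ofK// /dy divr_ge0// exprn_ge0. Qed.

(* The boxes of level [k] covering the times of ]0, J 2^-k] and the points of
   [-n, n]. *)
Definition mesh n k J := ('I_J * 'I_(n * 2 ^ k).*2.+1)%type.

Definition mbox n k J (c : mesh n k J) : set (spacetime R) :=
  dbox R k (c.1.+1)%:Z (@gindex n k c.2).

(** The path is sampled at the left end of the time cell, which precedes every atom of the box and
    approximates the left limit. A charged box counts once whatever its mass, just as the driving
    equation counts each atom once. *)
Definition kick_sum n k J m f : R[i] := \sum_(c : mesh n k J)
  if m (mbox c) == 0%E then 0 else kick (dy R k (@gindex n k c.2)) (f (dtime k c.1)).

Record good m : Prop := Good {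
  good_nat : forall k (a b : int), exists j : nat, m (dbox R k a b) = j%:R%:E;
  good_start : forall n, m (box (-1) 0 (- n%:R) n%:R) = 0%E;
  good_tail : forall T : nat, (rho m (between (-1) T%:R) < +oo)%E }.

(* The driving equation restricted to dyadic times, with the two limits spelt
   out: it only involves the values of [f] at dyadic times. *)
Definition solves m (z : R[i]) f := forall kq jq i : nat, exists n0 : nat, forall n,
  (n0 <= n)%N -> exists k0 : nat, forall k, (k0 <= k)%N -> (kq <= k)%N ->
    cnorm (z + kick_sum n k (jq * 2 ^ (k - kq)) m f - f (dtime kq jq)) <= 2^-1 ^+ i.

(** The region in which [kick_lip] is uniform. A single integer controls both the modulus and the
    distance to the real line, so that the event needs countable quantifiers only. *)
Definition bounded_path f := forall T : nat, exists M : nat, forall k j : nat,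
  dy R k j <= T%:R ->
  cnorm (f (dtime k j)) <= M%:R /\ M.+1%:R^-1 <= complex.Im (f (dtime k j)).

Lemma pow2_between (x : R) : 1 <= x -> exists n, x <= 2 ^+ n <= 2 * x.
Proof.
move=> x1; have ex : exists n, x <= 2 ^+ n.
  exists (Num.bound x); apply: le_trans (ltW (archi_boundP _)) _.
    exact: le_trans x1.
  by rewrite -natrX ler_nat ltnW// ltn_expl.
case: (ex_minnP ex) => -[|n] xn minn.
  by exists 0%N; move: xn; rewrite expr0 => ->; lra.
exists n.+1; rewrite xn exprS ler_pM2l//= leNgt; apply/negP => /ltW /minn.
by rewrite ltnn.
Qed.

Lemma rho_ge m A n : measurable A -> A `<=` slab R n ->
  ((4^-1 ^+ n)%:E * m A <= rho m A)%E.
Proof.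
move=> mA An; rewrite rhoE (@nneseriesD1 _ _ n)//=.
rewrite (setIidl An) leeDl//; apply: nneseries_ge0 => k _ _.
by apply: mule_ge0; rewrite ?lee_fin ?quarter_ge0.
Qed.

(** A charged box has mass at least 1 by integrality. For [2 ^+ n] between [1 + |x|] and twice that
    number, the box lies in [slab n] and receives the weight [4^-n], at least a quarter of
    [(1 + |x|)^-2]. *)
Lemma dbox_weight m k (a b : int) : good m -> m (dbox R k a b) != 0%E ->
  (((1 + `|dy R k b|) ^+ 2)^-1%:E <= 4%:E * rho m (dbox R k a b))%E.
Proof.
move=> gm; have [j mj] := good_nat gm k a b; rewrite mj eqe pnatr_eq0 => j0.
set x := dy R k b.
have [n /andP[xn nx]] : exists n, 1 + `|x| <= 2 ^+ n <= 2 * (1 + `|x|).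
  by apply: pow2_between; rewrite lerDl.
have sub : dbox R k a b `<=` slab R n.
  move=> p [_ /andP[lo hi]]; rewrite /slab /=.
  have := dy1 R k b; rewrite -/x => d1.
  have : 2^-1 ^+ k <= 1 :> R by rewrite exprn_ile1 ?invr_le1 ?invr_ge0 ?ler1n ?unitfE.
  have := ler_norm x; have := ler_norm (- x); rewrite normrN.
  by move: lo hi; rewrite -/x; move: (2^-1 ^+ k) d1 => h d1 *; apply/andP; lra.
apply: (@le_trans _ _ (4%:E * ((4^-1 ^+ n)%:E * m (dbox R k a b)))%E); last first.
  by rewrite lee_pmul2l// rho_ge//; exact: measurable_dbox.
rewrite mj -!EFinM lee_fin.
apply: (@le_trans _ _ (4 * (4^-1 ^+ n * 1))); last first.
  by rewrite ler_pM2l// ler_wpM2l ?quarter_ge0// ler1n lt0n.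
have -> : 4^-1 ^+ n = ((2 ^+ n) ^+ 2)^-1 :> R.
  by rewrite exprAC exprVn; congr (_ ^-1); congr (_ ^+ n); rewrite expr2 -natrM.
have x0 := normr_ge0 x; have x1 : 0 < 1 + `|x| by rewrite ltr_pwDl.
rewrite mulr1 -[leLHS]mul1r ler_pdivrMr ?exprn_gt0// mulrAC.
rewrite ler_pdivlMr ?exprn_gt0// mul1r -(_ : 2 ^+ 2 = 4 :> R); last first.
  by rewrite -natrX.
by rewrite -exprMn ler_pXn2r// nnegrE ?exprn_ge0// mulr_ge0// ltW.
Qed.

Lemma mbox_inj n k J (c c' : mesh n k J) p : mbox c p -> mbox c' p -> c = c'.
Proof.
case: c c' => [a i] [a' i'] /dboxP[h1 h2] /dboxP[h1' h2'].
have aa' : a = a' by apply: val_inj; move: h1; rewrite h1' => -[].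
by move: h2; rewrite h2' aa' => /gindex_inj /= ->.
Qed.

Lemma mbox_between n k J (c : mesh n k J) (t : R) : t <= dy R k c.1 ->
  mbox c `<=` between t (dy R k J).
Proof.
move=> tc p [/andP[lo hi] _]; apply/andP; split.
  apply: le_lt_trans tc _; apply: le_lt_trans lo.
  by rewrite ler_dy; have := ltn_ord c.1; lia.
by apply: le_trans hi _; rewrite ler_dy; have := ltn_ord c.1; lia.
Qed.

Lemma sum_rho_mbox m n k J (t : R) :
  (\sum_(c : mesh n k J | (t <= dy R k c.1)%R) rho m (mbox c) <=
    rho m (between t (dy R k J)))%E.
Proof.
pose F (c : mesh n k J) := if t <= dy R k c.1 then mbox c else set0.
have mF c : measurable (F c).
  by rewrite /F; case: ifP => // _; exact: measurable_dbox.
have tF : trivIset setT F.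
  move=> c c' _ _ [p []]; rewrite /F; case: ifP => // _ pc; case: ifP => // _.
  exact: mbox_inj.
have -> : (\sum_(c : mesh n k J | (t <= dy R k c.1)%R) rho m (mbox c) =
    \sum_(c \in setT) rho m (F c))%E.
  have -> : setT = [set` index_enum (mesh n k J)].
    by apply/seteqP; split=> c // _; rewrite /= mem_index_enum.
  rewrite -fsbig_seq ?index_enum_uniq// big_mkcond; apply: eq_bigr => c _.
  by rewrite /F; case: ifP => //; rewrite measure0.
have fT : finite_set [set: mesh n k J] by exact: finite_finset.
rewrite -(measure_fin_bigcup (rho m) fT tF (fun c _ => mF c)).
apply: le_measure; rewrite ?inE.
- by apply: fin_bigcup_measurable.
- exact: measurable_between.
- move=> p [c _]; rewrite /F; case: ifP => // tc; exact: mbox_between.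
Qed.

Lemma rho_between_fin m (s t : R) : good m ->
  rho m (between s t) \is a fin_num.
Proof.
move=> gm; rewrite ge0_fin_numE//.
apply: le_lt_trans (good_tail gm (Num.bound `|t|)).
apply: le_measure; rewrite ?inE; [exact: measurable_between..|].
move=> p /andP[_ pt]; apply/andP; split.
  by apply: lt_le_trans (tval_ge0 _); rewrite ltrN10.
apply: le_trans pt _; exact: le_trans (ler_norm _) (ltW (archi_boundP _)).
Qed.

(** Boxes sampled before [t] cancel. Each other charged box contributes at most
    [K * phi / (1 + |x|) ^+ 2], which [dbox_weight] bounds by [4 * K * phi] times its [rho]-mass,
    and these boxes are disjoint parts of the strip over ]t, J 2^-k]. *)
Lemma kick_sum_diff m n k J f g (y M K t phi : R) : good m ->
  0 < K -> 0 <= phi ->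
  (forall (x : R) w w', y <= complex.Im w -> y <= complex.Im w' ->
    `|complex.Re w| <= M -> `|complex.Re w'| <= M ->
    cnorm (kick x w - kick x w') <= K / (1 + `|x|) ^+ 2 * cnorm (w - w')) ->
  (forall a : 'I_J, [/\ y <= complex.Im (f (dtime k a)),
    y <= complex.Im (g (dtime k a)), `|complex.Re (f (dtime k a))| <= M &
    `|complex.Re (g (dtime k a))| <= M]) ->
  (forall a : 'I_J, dy R k a < t -> f (dtime k a) = g (dtime k a)) ->
  (forall a : 'I_J, cnorm (f (dtime k a) - g (dtime k a)) <= phi) ->
  cnorm (kick_sum n k J m f - kick_sum n k J m g) <=
    phi * (4 * K * fine (rho m (between t (dy R k J)))).
Proof.
move=> gm K0 phi0 lip dom eqt dphi.
have frho (c : mesh n k J) : rho m (mbox c) \is a fin_num.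
  rewrite ge0_fin_numE//; apply: le_lt_trans (good_tail gm (Num.bound (dy R k J))).
  apply: le_measure; rewrite ?inE; [exact: measurable_dbox|exact: measurable_between|].
  have c0 : -1 <= dy R k c.1 by apply: (@le_trans _ _ 0); rewrite ?lerN10// /dy divr_ge0.
  move=> p /(mbox_between c0)/andP[p0 pJ]; apply/andP; split=> //.
  by apply: le_trans pJ (ltW (archi_boundP _)); rewrite /dy divr_ge0.
rewrite /kick_sum -sumrB; apply: le_trans (cnorm_sum _ _ _) _.
have term (c : mesh n k J) :
    cnorm ((if m (mbox c) == 0%E then 0 else kick (dy R k (@gindex n k c.2))
        (f (dtime k c.1))) -
     (if m (mbox c) == 0%E then 0 else kick (dy R k (@gindex n k c.2)) (g (dtime k c.1)))) <=
    if t <= dy R k c.1 then phi * (4 * K * fine (rho m (mbox c))) else 0.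
  case: ifPn => [_|mc].
    by rewrite subrr cnorm0; case: ifP => // _; rewrite !mulr_ge0// ?ltW// fine_ge0.
  case: ifPn => [tc|]; last first.
    by rewrite -ltNge => /eqt ->; rewrite subrr cnorm0.
  have [f1 f2 f3 f4] := dom c.1.
  apply: le_trans (lip _ _ _ f1 f2 f3 f4) _; rewrite mulrC.
  apply: ler_pM => //; first exact: cnorm_ge0.
    by rewrite divr_ge0 ?exprn_ge0 ?addr_ge0// ltW.
  rewrite [4 * K]mulrC -mulrA ler_pM2l// -lee_fin EFinM fineK//.
  exact: dbox_weight.
apply: le_trans (ler_sum _ (fun c _ => term c)) _.
rewrite -big_mkcond/= -!mulr_sumr ler_wpM2l// ler_wpM2l//.
  by rewrite mulr_ge0// ltW.
rewrite -lee_fin fineK ?rho_between_fin// -sumEFin.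
apply: le_trans (sum_rho_mbox m n k J t).
rewrite (eq_bigr (fun c => rho m (mbox c))) // => c _.
by rewrite fineK ?frho.
Qed.

Lemma solves_unique m z f g : good m -> solves m z f -> solves m z g ->
  bounded_path f -> bounded_path g ->
  forall k j, f (dtime k j) = g (dtime k j).
Proof.
move=> gm sf sg bf bg k0 j0.
pose T := Num.bound (dy R k0 j0).
have k0T : dy R k0 j0 <= T%:R.
  by apply/ltW/archi_boundP; rewrite /dy divr_ge0.
have [Mf bfT] := bf T; have [Mg bgT] := bg T.
pose M := maxn Mf Mg; pose y : R := M.+1%:R^-1.
have y0 : 0 < y by rewrite invr_gt0.
have dom (h : time R -> R[i]) Mh : (Mh <= M)%N ->
    (forall k j : nat, dy R k j <= T%:R ->
      cnorm (h (dtime k j)) <= Mh%:R /\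
      Mh.+1%:R^-1 <= complex.Im (h (dtime k j))) ->
    forall k j : nat, dy R k j <= T%:R ->
      cnorm (h (dtime k j)) <= M%:R /\ y <= complex.Im (h (dtime k j)).
  move=> MM hh k j kj; have [h1 h2] := hh k j kj; split.
    by apply: le_trans h1 _; rewrite ler_nat.
  by apply: le_trans h2; rewrite lef_pV2 ?posrE// ler_nat.
have {bfT} df := dom f Mf (leq_maxl _ _) bfT.
have {bgT} dg := dom g Mg (leq_maxr _ _) bgT.
have [K K0 lip] := kick_lip y0 (ler0n R M).
pose Q : set R := [set q | exists k j : nat, q = dy R k j].
pose D q := cnorm (f (time_of q) - g (time_of q)).
pose r t q := 4 * K * fine (rho m (between t q)).
suff /(_ (dy R k0 j0)) : forall q, Q q -> q <= T%:R -> D q = 0.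
  move=> /(_ (ex_intro _ k0 (ex_intro _ j0 erefl)) k0T) /cnorm0_eq0 /eqP.
  by rewrite subr_eq0 => /eqP.
pose B : R := M%:R + M%:R.
have DB q : Q q -> q <= T%:R -> D q <= B.
  move=> [k [j ->]] kjT; apply: le_trans (cnormD _ _) _; rewrite cnormN.
  by rewrite lerD//; [have [] := df k j kjT|have [] := dg k j kjT].
apply: (@gronwall_clock _ Q D r T%:R B) => //.
- move=> q Qq qT; split; last by rewrite cnorm_ge0 DB.
  by have [k [j ->]] := Qq; rewrite /dy divr_ge0.
- move=> t q q' qq'; apply/andP; split.
    by rewrite mulr_ge0 ?fine_ge0// mulr_ge0// ltW.
  rewrite /r ler_pM2l ?mulr_gt0// fine_le ?rho_between_fin//.
  apply: le_measure; rewrite ?inE; [exact: measurable_between..|].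
  by move=> p /andP[tp pq]; apply/andP; split=> //; exact: le_trans qq'.
- move=> t t0; have e0 : 0 < 2^-1 / (4 * K) by rewrite divr_gt0 ?mulr_gt0// invr_gt0.
  have [d d0 hd] := rho_between0 t (good_tail gm) e0; exists d => //.
  rewrite /r mulrC -ler_pdivlMr ?mulr_gt0// -lee_fin fineK ?rho_between_fin//.
(* For suitable [n] and [k] both equations hold up to [e / 2]. The kick sums sample only times
   before [q], and the bound of [kick_sum_diff] depends on neither [n] nor [k]. *)
move=> t phi _ t0 phi0 [kq [jq ->]] qT eqt Dphi; apply/ler_addgt0Pr => e e0.
have [i _ /(_ i (leqnn i)) ie] : \forall i \near \oo, 2^-1 ^+ i < e / 2 :> R.
  by apply: near_exp_half; rewrite divr_gt0.
have [nf hf] := sf kq jq i; have [ng hg] := sg kq jq i.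
have [kf {}hf] := hf (maxn nf ng) (leq_maxl _ _).
have [kg {}hg] := hg (maxn nf ng) (leq_maxr _ _).
pose k := maxn (maxn kf kg) kq.
have kkq : (kq <= k)%N by rewrite leq_maxr.
have {}hf := hf k (leq_trans (leq_maxl _ _) (leq_maxl _ _)) kkq.
have {}hg := hg k (leq_trans (leq_maxr _ _) (leq_maxl _ _)) kkq.
have qE : dy R kq jq = dy R k (jq * 2 ^ (k - kq))%N.
  rewrite (dy_shift R _ kkq); congr (dy R k _).
  by rewrite -[RHS]natz natrM natrX; congr (_ * _); rewrite natz.
have aq (a : 'I_(jq * 2 ^ (k - kq))) : dy R k a < dy R kq jq.
  by rewrite qE ltr_dy ltz_nat.
have aT (a : 'I_(jq * 2 ^ (k - kq))) : dy R k a <= T%:R.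
  exact: le_trans (ltW (aq a)) qT.
have Qa (a : 'I_(jq * 2 ^ (k - kq))) : Q (dy R k a) by exists k, a.
have := @kick_sum_diff m (maxn nf ng) k (jq * 2 ^ (k - kq)) f g y M%:R K t phi gm K0 phi0 lip.
have h1 (a : 'I_(jq * 2 ^ (k - kq))) : [/\ y <= complex.Im (f (dtime k a)),
    y <= complex.Im (g (dtime k a)), `|complex.Re (f (dtime k a))| <= M%:R &
    `|complex.Re (g (dtime k a))| <= M%:R].
  have [f1 f2] := df k a (aT a); have [g1 g2] := dg k a (aT a).
  by split=> //; exact: le_trans (ler_Re_cnorm _) _.
have h2 (a : 'I_(jq * 2 ^ (k - kq))) : dy R k a < t -> f (dtime k a) = g (dtime k a).
  move=> at_; apply/eqP; rewrite -subr_eq0; apply/eqP/cnorm0_eq0.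
  exact: (eqt _ (Qa a) at_ (aq a)).
have h3 (a : 'I_(jq * 2 ^ (k - kq))) : cnorm (f (dtime k a) - g (dtime k a)) <= phi.
  exact: (Dphi _ (Qa a) (aq a)).
move=> /(_ h1 h2 h3); rewrite -qE -/(r t _) => hS.
move: hf hg hS; rewrite /D -/(dtime kq jq).
move: (kick_sum _ _ _ _ f) (kick_sum _ _ _ _ g) (f _) (g _) => Sf Sg F G hf hg hS.
have -> : F - G = (z + Sg - G) - (z + Sf - F) + (Sf - Sg) by ring.
apply: le_trans (cnormD _ _) _.
have := cnormD (z + Sg - G) (- (z + Sf - F)); rewrite cnormN.
by move: (2^-1 ^+ i) ie hf hg => x; lra.
Qed.

End mesh_sums.
Arguments mbox R {n k J} c.

(** * The driving equation at dyadic times *)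

Section evaluation.
Variable R : realType.
Local Notation C := (R[i]^o).

Lemma cvg_cnorm (T : Type) (F : set_system T) (g : T -> C) (l : C) : Filter F ->
  g @ F --> l <-> forall e : R, 0 < e -> \forall x \near F, cnorm (l - g x) < e.
Proof.
move=> FF; split=> [/cvgrPdist_lt h e e0|h].
  have := h e%:C; rewrite ltcR => /(_ e0); apply: filterS => x.
  by rewrite cnormE ltcR.
apply/cvgrPdist_lt => -[e e'] /=; rewrite ltcE/= => /andP[/eqP -> e0].
by have := h e e0; apply: filterS => x; rewrite cnormE ltcR.
Qed.

Lemma continuous_uval : continuous (@uval R).
Proof. exact: initial_continuous. Qed.

Lemma continuous_set_val_confmap : continuous
  (fun g : confmap R => set_val g : {family compact, uhp R -> uhp R}).
Proof. exact: initial_continuous. Qed.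

Lemma continuous_ev (z : uhp R) : continuous (fun g : confmap R => uval (cfun g z)).
Proof.
move=> g; apply: (@continuous_comp _ _ _ (fun g : confmap R => cfun g z) (@uval R)); last first.
  exact: continuous_uval.
have h := @continuous_set_val_confmap g.
have hp := ((pointwise_cvgP _ _).1 (pointwise_cvg_compact_family _ h) z).
apply: hp; rewrite nbhs_filterE; apply: fmap_filter; exact: nbhs_filter.
Qed.

Lemma Im_uval_gt0 (z : uhp R) : 0 < complex.Im (uval z).
Proof. exact: set_mem (valP z). Qed.

End evaluation.

Section solution_paths.
Variables (R : realType) (w : Omega R) (z : uhp R).
Local Notation C := (R[i]^o).

Definition path_at (t : time R) : C := uval (value w t z).
Definition path_left (t : time R) : C := uval (left_value w t z).

Lemma path_right_cvg (t : time R) : path_at @ time_right t --> path_at t.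
Proof.
exact: (cvg_comp _ _ (@traj_right _ _ (Ft w) t) (@continuous_ev R z _)).
Qed.

Lemma path_left_cvg (t : time R) : path_at @ time_left t --> path_left t.
Proof.
have h : Ft w @ time_left t --> lim (Ft w @ time_left t).
  by have [l hl] := traj_left (Ft w) t; apply/cvg_ex; exists l.
exact: (cvg_comp _ _ h (@continuous_ev R z _)).
Qed.

Lemma near_time (t : time R) (P : time R -> Prop) :
  (\forall u \near time_left t, P u) -> (\forall u \near time_right t, P u) ->
  P t -> \forall u \near t, P u.
Proof.
move=> hl hr Pt_; have : \forall u \near t, (tval u < tval t -> P u) /\
    (tval t < tval u -> P u).
  by apply: filterI; [exact: hl|exact: hr].
apply: filterS => u [ul ur].
by case: (ltgtP (tval u) (tval t)) => [/ul|/ur|/tval_time_inj ->].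
Qed.

Lemma compact_times (T : R) : compact [set t : time R | tval t <= T].
Proof.
have -> : [set t : time R | tval t <= T] = @time_of R @` `[0, T].
  apply/seteqP; split=> [t /= tT|_ /= [v + <-]].
    by exists (tval t); rewrite ?time_of_tval// in_itv/= tval_ge0.
  by rewrite in_itv/= => /andP[v0 vT]; rewrite time_ofK.
apply: continuous_compact; last exact: segment_compact.
by apply: continuous_subspaceT; exact: continuous_time_of.
Qed.

Let ok (M : nat) (x : C) := cnorm x <= M%:R /\ M.+1%:R^-1 <= complex.Im x.

Let okS (M M' : nat) x : (M <= M')%N -> ok M x -> ok M' x.
Proof.
move=> MM [h1 h2]; split; first by rewrite (le_trans h1)// ler_nat.
by rewrite (le_trans _ h2)// lef_pV2 ?posrE// ler_nat.
Qed.

Let near_ok (F : set_system (time R)) (l : C) : Filter F -> 0 < complex.Im l ->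
  path_at @ F --> l -> exists M, \forall u \near F, ok M (path_at u).
Proof.
move=> FF l0 /cvg_cnorm hl; have y0 : 0 < complex.Im l / 2 by rewrite divr_gt0.
have [M _ hM] : \forall M \near \oo, cnorm l + complex.Im l / 2 <= M%:R /\
    (complex.Im l / 2)^-1 <= M%:R.
  by apply: filterI; exact: nbhs_infty_ger.
exists M; have [M1 M2] := hM M (leqnn M); apply: filterS (hl _ y0) => u lu; split.
  apply: le_trans M1; have -> : path_at u = l - (l - path_at u) by ring.
  by apply: le_trans (cnormD _ _) _; rewrite cnormN lerD2l ltW.
apply: (@le_trans _ _ (complex.Im l / 2)).
  rewrite -[leRHS]invrK lef_pV2 ?posrE ?invr_gt0//.
  by apply: le_trans M2 _; rewrite ler_nat.
have := le_lt_trans (ler_Im_cnorm _) lu; rewrite raddfB /= ltr_norml.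
by move=> /andP[_]; lra.
Qed.

(** Left limits exist in the space of conformal maps, so they too send [z] into the open half-plane:
    near each time the path is bounded and stays off the real line. Compactness of [0, T] makes this
    uniform. *)
Lemma path_bounded : bounded_path path_at.
Proof.
move=> T.
have loc (t : time R) : exists M, \forall u \near t, ok M (path_at u).
  have [M1 h1] := near_ok _ (Im_uval_gt0 _) (@path_right_cvg t).
  have [M2 h2] := near_ok _ (Im_uval_gt0 _) (@path_left_cvg t).
  have [M3 h3] : exists M, \forall u \near globally [set t], ok M (path_at u).
    apply: near_ok (Im_uval_gt0 (value w t z)) _.
    by move=> U /nbhs_singleton Ut _ /= ->.
  exists (maxn (maxn M1 M2) M3); apply: near_time.
  - by apply: filterS h2 => u; apply: okS; rewrite !leq_max leqnn orbT.
  - by apply: filterS h1 => u; apply: okS; rewrite !leq_max leqnn.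
  - by apply: okS (h3 t erefl); rewrite leq_max leqnn orbT.
have [M _ hM] : \forall M \near \oo,
    [set t : time R | tval t <= T%:R] `<=` (fun u => ok M (path_at u)).
  apply: (compact_near_coveringP _).1; first exact: compact_times.
  move=> t _; have [M hM] := loc t.
  exists ([set u | ok M (path_at u)], [set M' | (M <= M')%N]).
    by split=> //=; exists M.
  by move=> [u M'] /= [hu MM']; exact: okS hu.
by exists M => k j kj; apply: (hM M (leqnn M)); rewrite /= dtimeE.
Qed.

End solution_paths.

(** * Atoms and the boxes that contain them *)

Section atoms_and_boxes.
Variable R : realType.
Implicit Types (m : pmeas R) (p : spacetime R).

Lemma measurable_point p : measurable [set p].
Proof. by apply: measurable_countable; exact: countable1. Qed.

(** By discreteness [B] consists of countably many points up to a null set, and these have no mass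
    unless one of them is an atom. *)
Lemma atom_in m (B : set (spacetime R)) : measurable B -> m B != 0%E ->
  exists2 p, B p & atoms m p.
Proof.
move=> mB; apply: contra_neqP => /forall2NP noatom.
have [A /countable_injP[f injf] mA0] := pm_discrete m.
apply: measure_negligible => //.
have : m.-negligible (\bigcup_n (A `&` B `&` f @^-1` [set n]) `|` ~` A).
  apply: negligibleU; last first.
    by exists (~` A); split => //; apply: measurableC; apply: measurable_countable;
      apply/countable_injP; exists f.
  apply: negligible_bigcup => n.
  have [->|/set0P[p [[Ap Bp] fp]]] := eqVneq (A `&` B `&` f @^-1` [set n]) set0.
    exact: negligible_set0.
  exists [set p]; split; first exact: measurable_point.
    apply/eqP; rewrite eq_le measure_ge0 andbT leNgt; apply/negP => p0.
    by have [] := noatom p.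
  by move=> q [[Aq Bq] fq]; apply: injf; rewrite ?inE// fq fp.
apply: negligibleS => p Bp; have [Ap|] := pselect (A p); last by right.
by left; exists (f p).
Qed.

Lemma near_all_seq (T : eqType) (s : seq T) (P : T -> nat -> Prop) :
  (forall x, x \in s -> \forall k \near \oo, P x k) ->
  \forall k \near \oo, forall x, x \in s -> P x k.
Proof.
elim: s => [|x s IH] h; first exact: nearW.
have hx : \forall k \near \oo, P x k by apply: h; rewrite mem_head.
have hs : \forall k \near \oo, forall y, y \in s -> P y k.
  by apply: IH => y ys; apply: h; rewrite inE ys orbT.
apply: filterS2 hx hs => k {}hx hs y; rewrite inE => /predU1P[->//|].
exact: hs.
Qed.

Definition same_cell (k : nat) (p q : spacetime R) :=
  cell k (tval p.1) = cell k (tval q.1) /\ cell k p.2 = cell k q.2.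

Lemma cell_eq_dist k (x y : R) : cell k x = cell k y -> `|x - y| < 2^-1 ^+ k.
Proof.
move=> xy; have /andP[x1 x2] := dy_ceil k x; have /andP[y1 y2] := dy_ceil k y.
have := dy1 R k (cell k x); rewrite -xy in y1 y2 => d.
by rewrite ltr_norml; move: (2^-1 ^+ k) d => h d; lra.
Qed.

Lemma near_separated (s : seq (spacetime R)) :
  \forall k \near \oo, forall p, p \in s -> forall q, q \in s -> same_cell k p q -> p = q.
Proof.
apply: near_all_seq => p _; apply: near_all_seq => q _.
have [->|pq] := pselect (p = q); first exact: nearW.
have [d d0 hd] : exists2 d : R, 0 < d &
    (`|tval p.1 - tval q.1| < d -> `|p.2 - q.2| < d -> p = q).
  have [p1q1|p1q1] := eqVneq (tval p.1) (tval q.1).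
    have [p2q2|p2q2] := eqVneq p.2 q.2.
      case: pq; case: p q p1q1 p2q2 => [p1 p2] [q1 q2] /= h ->.
      by rewrite (tval_time_inj h).
    by exists `|p.2 - q.2|; rewrite ?normr_gt0 ?subr_eq0// ltxx.
  by exists `|tval p.1 - tval q.1|; rewrite ?normr_gt0 ?subr_eq0// ltxx.
apply: filterS (near_exp_half d0) => k kd [h1 h2]; apply: hd.
  exact: lt_trans (cell_eq_dist h1) kd.
exact: lt_trans (cell_eq_dist h2) kd.
Qed.

(** At a fine level finitely many chosen atoms lie in distinct boxes, each of mass at least 1 by
    integrality; so there cannot be more of them than the mass of a slightly larger rectangle. *)
Lemma atoms_finite m (n : nat) : good m ->
  finite_set (atoms m `&` rect n%:R (- n%:R) n%:R).
Proof.
move=> gm; apply: contrapT => /infinite_set_fset inf.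
have [N hN] : exists N : nat, (m (rect n%:R (- n.+1%:R) n%:R) < N%:R%:E)%E.
  have fin := rect_fin m n%:R (- n.+1%:R) n%:R.
  exists (Num.bound (fine (m (rect n%:R (- n.+1%:R) n%:R)))).
  by rewrite -[ltLHS]fineK ?ge0_fin_numE// lte_fin archi_boundP// fine_ge0.
have [X XA NX] := inf N.
pose s := finmap.enum_fset X.
have [k _ /(_ k (leqnn k)) sep] := near_separated s.
have cX p : p \in s -> exists c : gcell n k, gbox R c p.
  by move=> pX; apply: gbox_ex; have [] := XA p pX.
have /choice[c hc] : forall p, exists c : gcell n k, p \in s -> gbox R c p.
  move=> p; have [/cX[c ?]|ps] := boolP (p \in s); first by exists c.
  by exists (ord0, ord0).
have cinj p q : p \in s -> q \in s -> c p = c q -> p = q.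
  move=> ps qs cpq; apply: sep => //.
  have /dboxP[h1 h2] := hc p ps; have /dboxP[h3 h4] := hc q qs.
  by rewrite /same_cell h1 h2 h3 h4 cpq.
have uc : uniq [seq c p | p <- s].
  by rewrite map_inj_in_uniq ?finmap.fset_uniq// => p q; exact: cinj.
have : (N%:R%:E <= \sum_(d <- [seq c p | p <- s]) m (gbox R d))%E.
  apply: (@le_trans _ _ (\sum_(d <- [seq c p | p <- s]) 1%:E)%E).
    rewrite sumEFin lee_fin big_const_seq count_predT size_map iter_addr_0.
    by rewrite ler_nat.
  rewrite big_seq [leRHS]big_seq; apply: lee_sum => d /mapP[p ps ->].
  have [j mj] := good_nat gm k (gindex (c p).1) (gindex (c p).2).
  rewrite /gbox mj lee_fin ler1n lt0n; apply/eqP => j0.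
  have [+ _] := XA p ps; rewrite /atoms/= -/(is_true _) ltNge => /negP; apply.
  rewrite -[leRHS](_ : m (gbox R (c p)) = 0%E); last by rewrite /gbox mj j0.
  apply: le_measure; rewrite ?inE; [exact: measurable_point|exact: measurable_dbox|].
  by move=> _ ->; exact: hc.
apply/negP; rewrite -ltNge; apply: le_lt_trans hN.
rewrite big_uniq//=; apply: (@le_trans _ _ (\sum_(d : gcell n k) m (gbox R d))%E).
  rewrite big_mkcond/=; apply: lee_sum => d _; by case: ifP.
rewrite (eq_bigr (fun d => (fine (m (gbox R d)))%:E)) => [|d _]; last first.
  by rewrite fineK// /gbox dbox_fin_num.
rewrite sumEFin -[leRHS]fineK ?ge0_fin_numE ?rect_fin// lee_fin.
exact: sum_gbox_le.
Qed.

End atoms_and_boxes.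

Section mesh_sums_converge.
Variables (R : realType) (m : pmeas R).
Hypothesis gm : good m.
Implicit Types (p : spacetime R) (n k : nat).

Lemma atom_gt0 p : atoms m p -> 0 < tval p.1.
Proof.
move=> ap; rewrite lt_neqAle tval_ge0 andbT eq_sym; apply/eqP => p0.
pose n := (Num.bound `|p.2|).+1.
have := good_start gm n => m0; move: ap; rewrite /atoms/= ltNge => /negP; apply.
rewrite -m0; apply: le_measure; rewrite ?inE; [exact: measurable_point|exact: measurable_box|].
move=> _ ->; rewrite /box /= p0 lexx andbT ltrN10; split=> //.
have : `|p.2| < n%:R by apply: lt_le_trans (archi_boundP _) _; rewrite ?ler_nat.
by rewrite ltr_norml => /andP[-> /ltW].
Qed.

Lemma atoms_upto_finite t n : finite_set (atoms_upto m t n).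
Proof.
pose N := maxn n (Num.bound (tval t)).
apply: sub_finite_set (atoms_finite N gm) => p [ap [pn pt]]; split=> //.
have nN : n%:R <= N%:R :> R by rewrite ler_nat leq_maxl.
split; last by rewrite -ler_norml (le_trans pn).
apply: le_trans pt _; apply: le_trans (ltW (archi_boundP (tval_ge0 t))) _.
by rewrite ler_nat leq_maxr.
Qed.

(** The index of the left end of the time cell of [p]; for an atom at a positive time the absolute
    value only converts it to [nat]. *)
Definition left_index k p : nat := `|cell k (tval p.1) - 1|%N.

Lemma left_indexE k p : 0 < tval p.1 ->
  (left_index k p)%:Z = cell k (tval p.1) - 1.
Proof.
move=> p0; rewrite /left_index gez0_abs// subr_ge0 -gtz0_ge1.
by rewrite cell_gt /dy mul0r.
Qed.

Lemma kick_sum_atoms n kq jq (s : seq (spacetime R)) : uniq s ->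
  atoms_upto m (dtime R kq jq) n = [set` s] ->
  \forall k \near \oo, (kq <= k)%N -> forall f,
    kick_sum n k (jq * 2 ^ (k - kq)) m f =
    \sum_(p <- s) kick (dy R k (cell k p.2)) (f (dtime R k (left_index k p))).
Proof.
move=> us sE.
(* The cell ending at [-n] protrudes from the window, and an atom beyond [-n] in it would be counted
   by mistake. The wider window has finitely many atoms, so a fine level excludes this. *)
have /finite_seqP[s' s'E] := atoms_upto_finite (dtime R kq jq) n.+1.
have near_far : \forall k \near \oo, forall p, p \in s' -> p.2 < - n%:R ->
    p.2 <= - n%:R - 2^-1 ^+ k.
  apply: near_all_seq => p _; have [pn|pn] := ltP p.2 (- n%:R); last exact: nearW.
  have d0 : 0 < - n%:R - p.2 by rewrite subr_gt0.
  by apply: filterS (near_exp_half d0) => k kd _; move: (2^-1 ^+ k) kd => x; lra.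
apply: filterS2 near_far (near_separated s) => k far sep kkq f.
have qE : dy R kq jq = dy R k (jq * 2 ^ (k - kq))%N.
  rewrite (dy_shift R _ kkq); congr (dy R k _).
  by rewrite -[RHS]natz natrM natrX; congr (_ * _); rewrite natz.
set J := (jq * 2 ^ (k - kq))%N in qE *.
have sP p : p \in s -> [/\ atoms m p, `|p.2| <= n%:R, tval p.1 <= dy R k J & 0 < tval p.1].
  move=> ps; have : atoms_upto m (dtime R kq jq) n p by rewrite sE.
  by move=> [ap [pn +]]; rewrite dtimeE qE => pt; split=> //; exact: atom_gt0.
have inJ p : p \in s -> (left_index k p < J)%N.
  move=> /sP[_ _ pJ p0]; rewrite -ltz_nat left_indexE// ltrBlDr.
  by rewrite ltzD1 cell_le.
have cellx p : p \in s -> exists i : 'I_(n * 2 ^ k).*2.+1, gindex i = cell k p.2.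
  move=> /sP[_ pn _ _]; apply: gindex_ex; apply/absz_leP.
  move: pn; rewrite ler_norml => /andP[lo hi]; split; last by rewrite cell_le dy_nat.
  rewrite cell_gt; apply: lt_le_trans lo.
  by rewrite -(dy_nat R k) -dyN ltr_dy; lia.
have cell_of p : p \in s -> exists c : mesh n k J,
    [/\ mbox R c p, (c.1 : nat) = left_index k p & gindex c.2 = cell k p.2].
  move=> ps; have [i hi] := cellx p ps; exists (Ordinal (inJ p ps), i); split=> //.
  apply/dboxP; rewrite hi; split=> //=.
  have [_ _ _ p0] := sP p ps; have := left_indexE k p0.
  by move: (left_index k p) (cell k (tval p.1)) => a b; lia.
have occupied (c : mesh n k J) : m (mbox R c) != 0%E -> exists2 p, p \in s & mbox R c p.
  move=> /atom_in; case=> [|p pc ap]; first exact: measurable_dbox.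
  exists p => //; suff : atoms_upto m (dtime R kq jq) n p by rewrite sE.
  have /dboxP[h1 h2] := pc.
  have pt : tval p.1 <= tval (dtime R kq jq).
    by rewrite dtimeE qE -cell_le h1; have := ltn_ord c.1; lia.
  have /absz_leP[b1 b2] := gindex_bound c.2.
  have pn : p.2 <= n%:R by rewrite -(dy_nat R k) -cell_le h2.
  have pn' : - n%:R - 2^-1 ^+ k < p.2.
    have : dy R k (- (n * 2 ^ k)%N%:Z - 1) < p.2 by rewrite -cell_gt h2.
    have := dy1 R k (- (n * 2 ^ k)%N%:Z); rewrite dyN dy_nat.
    by move: (2^-1 ^+ k) => x; lra.
  split=> //; split=> //; rewrite ler_norml pn andbT leNgt; apply/negP => pn2.
  have : p \in s'.
    suff : atoms_upto m (dtime R kq jq) n.+1 p by rewrite s'E.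
    split=> //; split=> //; rewrite ler_norml -natr1.
    have : 2^-1 ^+ k <= 1 :> R by rewrite exprn_ile1 ?invr_le1 ?invr_ge0 ?ler1n ?unitfE.
    by move: (2^-1 ^+ k) pn' => x *; apply/andP; lra.
  by move=> /far /(_ pn2); rewrite leNgt pn'.
rewrite /kick_sum.
(* Each box is written as a sum over the atoms in it; exchanging the two sums then leaves one box
   per atom. *)
have term (c : mesh n k J) : (if m (mbox R c) == 0%E then 0
    else kick (dy R k (@gindex n k c.2)) (f (dtime R k c.1))) =
    \sum_(p <- s) if `[< mbox R c p >] then
      kick (dy R k (@gindex n k c.2)) (f (dtime R k c.1)) else 0.
  case: ifPn => [/eqP mc|/occupied[p ps pc]].
    rewrite big_seq big1// => p ps; case: ifPn => // /asboolP pc.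
    have [ap _ _ _] := sP p ps; move: ap; rewrite /atoms /= ltNge => /negP[].
    rewrite -mc; apply: le_measure; rewrite ?inE;
      [exact: measurable_point|exact: measurable_dbox|].
    by move=> _ ->.
  rewrite (bigD1_seq p)//= ifT; last exact/asboolP.
  rewrite big_seq_cond big1 ?addr0// => q /andP[qs qp]; case: ifPn => // /asboolP qc.
  move: qp; rewrite (sep q qs p ps) ?eqxx//.
  by have /dboxP[h1 h2] := pc; have /dboxP[h3 h4] := qc; split; congruence.
rewrite (eq_bigr _ (fun c _ => term c)) exchange_big/= big_seq [RHS]big_seq.
apply: eq_bigr => p ps; have [c [pc c1 c2]] := cell_of p ps.
rewrite (bigD1 c)//= ifT; last exact/asboolP.
rewrite c1 c2 big1 ?addr0// => c' c'c; case: ifPn => // /asboolP pc'.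
by move: c'c; rewrite (mbox_inj pc' pc) eqxx.
Qed.

End mesh_sums_converge.

Lemma cvg_sum_seq0 (R : realType) (T : eqType) (s : seq T) (F : T -> nat -> R) :
  (forall x, x \in s -> F x k @[k --> \oo] --> (0 : R)) ->
  \sum_(x <- s) F x k @[k --> \oo] --> (0 : R).
Proof.
elim: s => [|x s IH] h.
  have -> : (fun k => \sum_(y <- [::]) F y k) = (fun=> 0).
    by apply/funext => k; rewrite big_nil.
  exact: cvg_cst.
have -> : (fun k => \sum_(y <- x :: s) F y k) = F x \+ (fun k => \sum_(y <- s) F y k).
  by apply/funext => k; rewrite big_cons.
rewrite -[X in _ --> X]addr0; apply: cvgD; first by apply: h; rewrite mem_head.
by apply: IH => y ys; apply: h; rewrite inE ys orbT.
Qed.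

Section solution_solves.
Variables (R : realType) (w : Omega R) (z : uhp R).
Hypotheses (gw : good (Pt w)) (eqw : SHL_equation w).
Local Notation f := (path_at w z).

Lemma nbhs_time (t : time R) (A : set (time R)) : nbhs t A ->
  exists2 r : R, 0 < r & forall u, `|tval t - tval u| < r -> A u.
Proof.
move=> At; have At' : nbhs (time_of (tval t)) A by rewrite time_of_tval.
have /nbhs_ballP[r /= r0 rA] := continuous_time_of At'.
exists r => // u ur; have := rA (tval u) ur.
by rewrite /= time_of_tval.
Qed.

Lemma left_sample_cvg (p : spacetime R) : 0 < tval p.1 ->
  f (dtime R k (left_index k p)) @[k --> \oo] --> path_left w z p.1.
Proof.
move=> p0; apply/cvg_cnorm => e e0.
have /cvg_cnorm/(_ e e0)/nbhs_time[r r0 hr] := @path_left_cvg R w z p.1.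
apply: filterS (near_exp_half r0) => k kr.
have /andP[lo hi] := dy_ceil k (tval p.1).
have tE : tval (dtime R k (left_index k p)) = dy R k (cell k (tval p.1) - 1).
  by rewrite dtimeE left_indexE.
have u1 : `|tval p.1 - tval (dtime R k (left_index k p))| < r.
  rewrite tE ger0_norm ?subr_ge0 ?ltW//; apply: le_lt_trans kr.
  by have := dy1 R k (cell k (tval p.1)); move: (2^-1 ^+ k) => x; lra.
have u2 : tval (dtime R k (left_index k p)) < tval p.1 by rewrite tE.
exact: (hr _ u1 u2).
Qed.

(** [kick x w] depends only on [w - x], so moving the atom to a grid point costs no more than moving
    [w] by the same amount. *)
Lemma kick_sample_cvg (p : spacetime R) : 0 < tval p.1 ->
  cnorm (kick (dy R k (cell k p.2)) (f (dtime R k (left_index k p))) -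
    kick p.2 (path_left w z p.1)) @[k --> \oo] --> (0 : R).
Proof.
move=> p0; set l := path_left w z p.1.
have l0 : 0 < complex.Im l by exact: Im_uval_gt0.
pose y := complex.Im l / 2; have y0 : 0 < y by rewrite divr_gt0.
have /cvg_cnorm fl := left_sample_cvg p0.
apply/cvgrPdist_lt => e e0.
(* [2 / y ^+ 2] is the Lipschitz constant at height [y], and two errors add up, from the sampling of
   the path and from the position. *)
pose e' := e / (2 / y ^+ 2) / 2.
have e'0 : 0 < e' by rewrite !divr_gt0// exprn_gt0.
near=> k; rewrite sub0r normrN ger0_norm ?cnorm_ge0//.
have fk1 : cnorm (l - f (dtime R k (left_index k p))) < y by near: k; exact: fl.
have fk2 : cnorm (l - f (dtime R k (left_index k p))) < e' by near: k; exact: fl.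
have ke : 2^-1 ^+ k < e' by near: k; exact: near_exp_half.
have := le_lt_trans (cell_dist k p.2) ke.
move: (f _) fk1 fk2 (dy R k _) => fk fk1 fk2 xk xk1.
have Imx (x : R) v : complex.Im (v - x%:C) = complex.Im v.
  by case: v => ? ?; rewrite /= subr0.
have yfk : y <= complex.Im fk.
  have := le_lt_trans (ler_Im_cnorm _) fk1; rewrite raddfB /= ltr_norml.
  by move=> /andP[_]; rewrite /y; lra.
rewrite !kickE; apply: le_lt_trans (slit_disp_lip_Im y0 _ _) _; rewrite ?Imx//.
  by rewrite /y; lra.
have -> : fk - xk%:C - (l - p.2%:C) = - ((l - fk) - (p.2 - xk)%:C).
  by rewrite rmorphB /=; ring.
have := cnormD (l - fk) (- (p.2 - xk)%:C); rewrite cnormN cnormN cnorm_real => h.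
rewrite mulrC -ltr_pdivlMr ?divr_gt0 ?exprn_gt0//.
apply: le_lt_trans h _; have := ltrD fk2 xk1; rewrite -mulr2n /e'.
by rewrite -[X in _ < X -> _]mulr_natr divfK.
Unshelve. all: by end_near. Qed.

(** For fixed [n] finitely many atoms are involved, and each sampled kick tends to the kick at the
    left limit; the limit in [n] is the driving equation. *)
Lemma path_solves : solves (Pt w) (uval z) f.
Proof.
move=> kq jq i; set t := dtime R kq jq.
have e0 : 0 < 2^-1 ^+ i / 2 :> R by rewrite divr_gt0// exprn_gt0// invr_gt0.
have [n0 _ hn0] : \forall n \near \oo, _ := (cvg_cnorm _ _ _).1 (@eqw t z) _ e0.
exists n0 => n nn0; have {hn0} := hn0 n nn0.
have fin := atoms_upto_finite gw t n; rewrite fsbig_finite//=.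
set s := finmap.enum_fset (fset_set (atoms_upto (Pt w) t n)).
have us : uniq s by exact: finmap.fset_uniq.
have sE : atoms_upto (Pt w) t n = [set` s].
  by rewrite -[LHS](fset_setK fin).
set S := \sum_(p <- s) _ => hS.
have cv : cnorm (\sum_(p <- s) (kick (dy R k (cell k p.2)) (f (dtime R k (left_index k p))) -
    kick p.2 (path_left w z p.1))) @[k --> \oo] --> (0 : R).
  have cs : \sum_(p <- s) cnorm (kick (dy R k (cell k p.2)) (f (dtime R k (left_index k p))) -
      kick p.2 (path_left w z p.1)) @[k --> \oo] --> (0 : R).
    have : forall p, p \in s -> 0 < tval p.1.
      move=> p ps; apply: (atom_gt0 gw).
      have : atoms_upto (Pt w) t n p by rewrite sE.
      by case.
    by move=> pos; apply: cvg_sum_seq0 => p ps; apply: kick_sample_cvg; exact: pos.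
  apply: (squeeze_cvgr _ (cvg_cst 0) cs); apply: nearW => k.
  by rewrite cnorm_ge0 cnorm_sum.
have /cvgrPdist_lt/(_ _ e0) cvk := cv.
have [k0 _ hk0] := filterI (kick_sum_atoms gw us sE) cvk.
exists k0 => k kk0 kkq; have [h1 +] := hk0 k kk0.
rewrite sub0r normrN ger0_norm ?cnorm_ge0//.
rewrite (h1 kkq f) sumrB -/S.
move: hS; rewrite -/(f t); move: (\sum_(p <- s) _) (f t) => S' F hS hS'.
have -> : uval z + S' - F = (S' - S) - (F - (uval z + S)) by ring.
have := cnormD (S' - S) (- (F - (uval z + S))); rewrite cnormN.
by move: (2^-1 ^+ i) hS hS' => x; lra.
Qed.

End solution_solves.

(** * Measurability of the values of the flow *)

Section complex_measurability.
Context d (T : measurableType d) (R : realType).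
Implicit Types X Y : T -> R[i].

Definition cmeasurable X := measurable_fun setT (fun w => complex.Re (X w)) /\
  measurable_fun setT (fun w => complex.Im (X w)).

Lemma cmeasurable_cst (c : R[i]) : cmeasurable (fun=> c).
Proof. by split; exact: measurable_cst. Qed.

Lemma cmeasurableD X Y : cmeasurable X -> cmeasurable Y -> cmeasurable (X \+ Y).
Proof.
move=> [X1 X2] [Y1 Y2]; split.
  have -> : (fun w => complex.Re ((X \+ Y) w)) =
    (fun w => complex.Re (X w)) \+ (fun w => complex.Re (Y w)).
    by apply/funext => w /=; rewrite raddfD.
  exact: measurable_funD.
have -> : (fun w => complex.Im ((X \+ Y) w)) =
  (fun w => complex.Im (X w)) \+ (fun w => complex.Im (Y w)).
  by apply/funext => w /=; rewrite raddfD.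
exact: measurable_funD.
Qed.

Lemma cmeasurableN X : cmeasurable X -> cmeasurable (fun w => - X w).
Proof.
move=> [X1 X2]; split.
  have -> : (fun w => complex.Re (- X w)) = \- (fun w => complex.Re (X w)).
    by apply/funext => w /=; rewrite raddfN.
  exact: measurableT_comp.
have -> : (fun w => complex.Im (- X w)) = \- (fun w => complex.Im (X w)).
  by apply/funext => w /=; rewrite raddfN.
exact: measurableT_comp.
Qed.

Lemma cmeasurable_sum (I : Type) (s : seq I) (X : I -> T -> R[i]) :
  (forall i, cmeasurable (X i)) -> cmeasurable (fun w => \sum_(i <- s) X i w).
Proof.
move=> mX; elim: s => [|i s IH].
  have -> : (fun w => \sum_(i <- [::]) X i w) = (fun=> 0).
    by apply/funext => w; rewrite big_nil.
  exact: cmeasurable_cst.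
have -> : (fun w => \sum_(j <- i :: s) X j w) = X i \+ (fun w => \sum_(j <- s) X j w).
  by apply/funext => w; rewrite big_cons.
exact: cmeasurableD.
Qed.

Lemma cmeasurable_if (A : set T) X : measurable A -> cmeasurable X ->
  cmeasurable (fun w => if w \in A then X w else 0).
Proof.
move=> mA [X1 X2]; split.
  have -> : (fun w => complex.Re (if w \in A then X w else 0)) =
      (fun w => complex.Re (X w)) \* (\1_A : T -> R).
    by apply/funext => w /=; rewrite indicE; case: ifP; rewrite ?mulr1 ?mulr0.
  by apply: measurable_funM => //.
have -> : (fun w => complex.Im (if w \in A then X w else 0)) =
    (fun w => complex.Im (X w)) \* (\1_A : T -> R).
  by apply/funext => w /=; rewrite indicE; case: ifP; rewrite ?mulr1 ?mulr0.
by apply: measurable_funM => //.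
Qed.

Lemma cmeasurable_sq X : cmeasurable X ->
  measurable_fun setT (fun w => complex.Re (X w) ^+ 2 + complex.Im (X w) ^+ 2).
Proof.
by move=> [X1 X2]; apply: measurable_funD; exact: measurable_funX.
Qed.

Lemma measurable_cnorm_le X (e : R) : cmeasurable X -> 0 <= e ->
  measurable [set w | cnorm (X w) <= e].
Proof.
move=> mX e0.
have -> : [set w | cnorm (X w) <= e] = setT `&`
    (fun w => complex.Re (X w) ^+ 2 + complex.Im (X w) ^+ 2) @^-1` `]-oo, e ^+ 2].
  rewrite setTI; apply/seteqP; split=> w /=; rewrite in_itv/=.
    by rewrite -(ler_sqr (cnorm_ge0 _)) ?nnegrE// sqr_sqrtr ?addr_ge0 ?sqr_ge0.
  by rewrite -(ler_sqr (cnorm_ge0 _)) ?nnegrE// sqr_sqrtr ?addr_ge0 ?sqr_ge0.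
exact: (cmeasurable_sq mX).
Qed.

Lemma measurable_cnorm_lt X (e : R) : cmeasurable X ->
  measurable [set w | cnorm (X w) < e].
Proof.
move=> mX; have [e0|e0] := leP e 0.
  rewrite (_ : [set w | _] = set0)//; apply/seteqP; split=> // w /=.
  by rewrite ltNge (le_trans e0)// cnorm_ge0.
have -> : [set w | cnorm (X w) < e] = setT `&`
    (fun w => complex.Re (X w) ^+ 2 + complex.Im (X w) ^+ 2) @^-1` `]-oo, e ^+ 2[.
  rewrite setTI; apply/seteqP; split=> w /=; rewrite in_itv/=;
    by rewrite -(ltr_sqr (cnorm_ge0 _)) ?nnegrE ?ltW// sqr_sqrtr ?addr_ge0 ?sqr_ge0.
exact: (cmeasurable_sq mX).
Qed.

Definition copen (U : set R[i]) := forall x, U x ->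
  exists2 e : R, 0 < e & forall y, cnorm (y - x) < e -> U y.

Lemma rat_approx (x e : R) : 0 < e -> exists q : rat, `|x - ratr q| < e.
Proof.
move=> e0; have xe : x - e < x + e by lra.
have [q] := rat_in_itvoo xe; rewrite in_itv/= => /andP[lo hi]; exists q.
by rewrite ltr_norml; lra.
Qed.

Lemma crat_approx (x : R[i]) (e : R) : 0 < e ->
  exists a b : rat, cnorm (x - (ratr a +i* ratr b)) < e.
Proof.
move=> e0; have e20 : 0 < e / 2 by rewrite divr_gt0.
have [a ha] := rat_approx (complex.Re x) e20.
have [b hb] := rat_approx (complex.Im x) e20.
exists a, b; apply: le_lt_trans (ler_cnorm_ReIm _) _.
by rewrite !raddfB /=; lra.
Qed.

Lemma measurable_copen X (U : set R[i]) : cmeasurable X -> copen U ->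
  measurable [set w | U (X w)].
Proof.
move=> mX oU.
pose N (x : rat * rat * nat) :=
  [set w | cnorm (X w - (ratr x.1.1 +i* ratr x.1.2)) < 2^-1 ^+ x.2].
apply: (measurable_network (N := N)) => [[[a b] i]|w UXw].
  exact: (measurable_cnorm_lt _ (cmeasurableD mX (cmeasurable_cst (- (ratr a +i* ratr b))))).
have [e e0 eU] := oU _ UXw.
have e20 : 0 < e / 2 by rewrite divr_gt0.
have [i _ /(_ i (leqnn i)) ie] := near_exp_half e20.
have i0 : 0 < 2^-1 ^+ i :> R by rewrite exprn_gt0// invr_gt0.
have [a [b ab]] := crat_approx (X w) i0.
exists (a, b, i) => // v; rewrite /N /= => vab; apply: eU.
move: ab vab; set c := _ +i* _ => ab vab.
have -> : X v - X w = (X v - c) - (X w - c) by ring.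
apply: le_lt_trans (cnormD _ _) _; rewrite cnormN.
by move: (2^-1 ^+ i) ab vab ie => x; lra.
Qed.

(* [slit_disp] is continuous on the upper half-plane only. *)
Lemma cmeasurable_kick (x : R) X : cmeasurable X ->
  (forall w, 0 < complex.Im (X w)) -> cmeasurable (fun w => kick x (X w)).
Proof.
move=> mX X0.
have lip c : 0 < complex.Im c -> forall r : R, 0 < r -> exists2 e : R, 0 < e &
    forall y, cnorm (y - c) < e ->
      0 < complex.Im y /\ cnorm (kick x y - kick x c) < r.
  move=> c0 r r0; pose y0 := complex.Im c / 2.
  have y0_gt0 : 0 < y0 by rewrite divr_gt0.
  pose e := Num.min y0 (r / (2 / y0 ^+ 2)).
  have e0 : 0 < e by rewrite lt_min y0_gt0 divr_gt0// divr_gt0// exprn_gt0.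
  exists e => // y; rewrite lt_min => /andP[ye1 ye2].
  have := le_lt_trans (ler_Im_cnorm _) ye1; rewrite raddfB /= ltr_norml.
  rewrite /y0 => /andP[h _]; have Imy : y0 <= complex.Im y by rewrite /y0; lra.
  split; first exact: lt_le_trans Imy.
  have Imx v : complex.Im (v - x%:C) = complex.Im v.
    by case: v => ? ?; rewrite /= subr0.
  rewrite !kickE; apply: le_lt_trans (slit_disp_lip_Im y0_gt0 _ _) _; rewrite ?Imx//.
    by rewrite /y0; lra.
  have -> : y - x%:C - (c - x%:C) = y - c by ring.
  by rewrite mulrC -ltr_pdivlMr// divr_gt0// exprn_gt0.
have op (g : R[i] -> R) : (forall a b, `|g a - g b| <= cnorm (a - b)) ->
    measurable_fun setT (fun w => g (kick x (X w))).
  move=> gl; apply: (measurability _ (RGenOInfty.measurableE R)).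
  move=> _ [_ [a ->] <-]; rewrite setTI.
  have -> : (fun w => g (kick x (X w))) @^-1` `]a, +oo[ =
      [set w | [set c | 0 < complex.Im c /\ a < g (kick x c)] (X w)].
    by apply/seteqP; split=> w /=; rewrite in_itv/= andbT => // -[].
  apply: measurable_copen => // c [c0 ac].
  have r0 : 0 < g (kick x c) - a by rewrite subr_gt0.
  have [e e0 he] := lip c c0 _ r0; exists e => // y /he[y0 yk]; split=> //.
  by have := le_lt_trans (gl _ _) yk; rewrite ltr_norml => /andP[+ _]; lra.
by split; apply: op => a b; rewrite -raddfB; [exact: ler_Re_cnorm|exact: ler_Im_cnorm].
Qed.

End complex_measurability.

Lemma poisson_good (R : realType) (mu : probability (Omega R) R) :
  poisson_law (pushforward mu fst) -> \forall w \ae mu, good (Pt w).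
Proof.
move=> pmu; have := ae_tail_weight pmu.
apply: filterS3 (ae_nat_dbox pmu) (ae_no_atom0 pmu) => w natw w0 tailw.
by split.
Qed.

Section congruence.
Variables (R : realType) (m : pmeas R).
Implicit Types f g : time R -> R[i].

Lemma eq_solves f g (z : R[i]) : (forall k j, f (dtime R k j) = g (dtime R k j)) ->
  solves m z f -> solves m z g.
Proof.
move=> fg + kq jq i => /(_ kq jq i)[n0 hn]; exists n0 => n /hn[k0 hk].
exists k0 => k kk kkq; rewrite -fg; apply: le_trans (hk k kk kkq).
rewrite le_eqVlt; apply/orP; left; apply/eqP; congr (cnorm (_ + _ - _)).
by apply: eq_bigr => c _; rewrite fg.
Qed.

Lemma eq_bounded_path f g : (forall k j, f (dtime R k j) = g (dtime R k j)) ->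
  bounded_path f -> bounded_path g.
Proof.
by move=> fg + T => /(_ T)[M hM]; exists M => k j /hM; rewrite fg.
Qed.

End congruence.

Section path_events.
Variables (R : realType) (mu1 mu2 : probability (Omega R) R).
Hypothesis mu1_poisson : poisson_law (pushforward mu1 fst).
Hypothesis mu2_poisson : poisson_law (pushforward mu2 fst).
Local Notation OmegaP := (OmegaP mu1 mu2).
Variable G : time R -> Omega R -> confmap R.
Hypothesis mG : forall k j (A : set (borel (confmap R))), measurable A ->
  Pevents mu1 mu2 (G (dtime R k j) @^-1` A).
Variable z : uhp R.

Definition field_path (w : Omega R) (t : time R) : R[i] := uval (cfun (G t w) z).

Lemma cmeasurable_field_path k j :
  cmeasurable (fun w : OmegaP => field_path w (dtime R k j)).
Proof.
have ev (g : R[i]^o -> R) : continuous g ->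
    measurable_fun setT (fun w : OmegaP => g (field_path w (dtime R k j))).
  move=> cg; apply: (measurability _ (RGenOInfty.measurableE R)).
  move=> _ [_ [a ->] <-]; rewrite setTI measurable_PeventsE//.
  apply: (@mG k j [set h : borel (confmap R) | g (uval (cfun h z)) \in `]a, +oo[]).
  apply: sub_sigma_algebra.
  have := @open_comp _ _ (fun h : confmap R => g (uval (cfun h z))) `]a, +oo[%classic.
  apply; last exact: interval_open.
  by move=> h _; apply: continuous_comp; [exact: continuous_ev|exact: cg].
have cRe (g : R[i]^o -> R) : (forall a b, `|g a - g b| <= cnorm (a - b)) -> continuous g.
  move=> gl x; have FF := @nbhs_filter (R[i]^o) x.
  apply/(@cvgrPdist_lt _ _ _ _ FF) => e e0.
  have := (@cvg_cnorm R _ (nbhs (x : R[i]^o)) id x FF).1 (@cvg_id _ (nbhs (x : R[i]^o))) e e0.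
  by apply: filterS => y; apply: le_lt_trans (gl x y).
by split; apply: ev; apply: cRe => a b; rewrite -raddfB;
  [exact: ler_Re_cnorm|exact: ler_Im_cnorm].
Qed.

(** The quantifiers of [solves] range over natural numbers and the kick sums are finite, so
    countable operations on conditions about counts and dyadic values suffice. *)
Lemma Pevents_solves :
  Pevents mu1 mu2 [set w | solves (Pt w) (uval z) (field_path w)].
Proof.
rewrite -measurable_PeventsE//.
apply: measurable_forall => kq; apply: measurable_forall => jq.
apply: measurable_forall => i; apply: measurable_exists => n0.
apply: measurable_forall => n; apply: measurable_imply => _.
apply: measurable_exists => k0; apply: measurable_forall => k.
apply: measurable_imply => _; apply: measurable_imply => _.
apply: measurable_cnorm_le; last by rewrite exprn_ge0// invr_ge0.
apply: cmeasurableD; last by apply: cmeasurableN; exact: cmeasurable_field_path.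
apply: cmeasurableD; first exact: cmeasurable_cst.
apply: cmeasurable_sum => c.
pose A : set OmegaP := [set w | Pt w (mbox R c) <> 0%E].
have mA : measurable A.
  rewrite -[A]/(~` [set w | Pt w (mbox R c) = 0%E]); apply: measurableC.
  have mc : measurable_fun setT (fun w : OmegaP => Pt w (mbox R c)).
    apply: (@measurableT_comp _ _ _ _ _ _ (fun m : borel (pmeas R) => pm m (mbox R c))).
      exact: measurable_count.
    exact: (measurable_Pt mu1_poisson mu2_poisson).
  by have := mc measurableT _ (emeasurable_set1 0%E); rewrite setTI.
have -> : (fun w : OmegaP => if Pt w (mbox R c) == 0%E then 0 else
     kick (dy R k (gindex c.2)) (field_path w (dtime R k c.1))) =
   (fun w => if w \in A then kick (dy R k (gindex c.2)) (field_path w (dtime R k c.1)) else 0).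
  apply/funext => w; case: eqP => wc; first by rewrite memNset//; apply.
  by rewrite mem_set.
apply: cmeasurable_if => //; apply: cmeasurable_kick.
  exact: cmeasurable_field_path.
by move=> w; exact: Im_uval_gt0.
Qed.

Lemma Pevents_bounded : Pevents mu1 mu2 [set w | bounded_path (field_path w)].
Proof.
rewrite -measurable_PeventsE//.
apply: measurable_forall => T; apply: measurable_exists => M.
apply: measurable_forall => k; apply: measurable_forall => j.
apply: measurable_imply => _.
apply: (@measurableI _ OmegaP [set w | cnorm (field_path w (dtime R k j)) <= M%:R]
  [set w | M.+1%:R^-1 <= complex.Im (field_path w (dtime R k j))]).
  by apply: measurable_cnorm_le => //; exact: cmeasurable_field_path.
have [_ mI] := cmeasurable_field_path k j.
have := mI measurableT `[M.+1%:R^-1, +oo[%classic (measurable_itv _).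
rewrite setTI; congr (measurable _); apply/seteqP; split=> w /=;
  by rewrite in_itv/= andbT.
Qed.

End path_events.

(** * The flow at dyadic times as a function of the points *)

Section adapted_paths.
Variables (R : realType) (mu1 mu2 : probability (Omega R) R).
Hypothesis h1 : backward_SHL0 mu1.
Hypothesis h2 : backward_SHL0 mu2.
Let p1 := SHL_poisson h1.
Let p2 := SHL_poisson h2.
Local Notation OmegaP := (OmegaP mu1 mu2).
Local Notation Pevents := (Pevents mu1 mu2).

(* By (2) and (3) with s = 0, at a dyadic time the map F_t is almost surely a
   function of the restriction of P to ]0, t]. *)
Lemma adapted_field (mu : probability (Omega R) R) : backward_SHL0 mu ->
  exists G : time R -> Omega R -> confmap R,
    (forall k j (A : set (borel (confmap R))), measurable A ->
      Pevents (G (dtime R k j) @^-1` A)) /\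
    \forall w \ae mu, forall k j z,
      value w (dtime R k j) z = cfun (G (dtime R k j) w) z.
Proof.
move=> h.
have one (x : nat * nat) : exists G : Omega R -> confmap R,
    (forall A : set (borel (confmap R)), measurable A -> Pevents (G @^-1` A)) /\
    \forall w \ae mu, forall z, value w (dtime R x.1 x.2) z = cfun (G w) z.
  (* Condition (3) only reaches times after 0; at time 0 the map is [point], that is the identity,
     by (2). *)
  case: x => k [|j] /=.
    exists (fun=> point); split.
      move=> A _; rewrite -measurable_PeventsE//; exact: (@measurable_const _ OmegaP (A point)).
    have := SHL_start h; apply: filterS => w h0 z.
    have -> : dtime R k 0 = time0.
      by apply: tval_time_inj; rewrite dtimeE /dy mul0r.
    by rewrite h0.
  have t0 : tval (time0 : time R) < tval (dtime R k j.+1).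
    by rewrite dtimeE /dy divr_gt0.
  have [G [mG aeG]] := SHL_increments h t0; exists G; split.
    move=> A mA; have [B mB] := mG A mA; rewrite setTI => <-.
    rewrite -measurable_PeventsE//.
    have := measurable_prestr p1 p2 (dtimeE R k j.+1) measurableT mB.
    by rewrite setTI.
  by move: (SHL_start h) aeG; apply: filterS2 => w w0 wG z; rewrite wG w0.
have /choice[G HG] := one.
(* A dyadic time has many indices [(k, j)], each with its own choice of map; one of them is kept per
   time. *)
have tG (t : time R) : exists H : Omega R -> confmap R,
    forall k j, t = dtime R k j -> exists k' j', t = dtime R k' j' /\ H = G (k', j').
  have [[k [j tkj]]|no] := pselect (exists k j, t = dtime R k j).
    by exists (G (k, j)) => _ _ _; exists k, j.
  by exists (fun=> point) => k j tkj; case: no; exists k, j.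
have /choice[H HH] := tG; exists H; split.
  move=> k j A mA; have [k' [j' [_ ->]]] := HH _ k j erefl.
  by have [+ _] := HG (k', j'); exact.
have ae : \forall w \ae mu, forall x z,
    value w (dtime R x.1 x.2) z = cfun (G x w) z.
  by apply: ae_forall_count => x; have [] := HG x.
move: ae; apply: filterS => w hw k j z.
have [k' [j' [-> ->]]] := HH _ k j erefl.
by rewrite (hw (k', j')).
Qed.

Lemma paths_eq_field (mu : probability (Omega R) R) (G : time R -> Omega R -> confmap R) z :
  backward_SHL0 mu ->
  (\forall w \ae mu, forall k j z, value w (dtime R k j) z = cfun (G (dtime R k j) w) z) ->
  \forall w \ae mu, solves (Pt w) (uval z) (field_path G z w) /\
    bounded_path (field_path G z w).
Proof.
move=> h aeG; apply: filterS3 aeG (poisson_good (SHL_poisson h)) (SHL_driven h).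
move=> w wG gw eqw.
have E k j : path_at w z (dtime R k j) = field_path G z w (dtime R k j).
  by rewrite /path_at wG.
split; first exact: (@eq_solves R (Pt w) _ _ (uval z) E (@path_solves R w z gw eqw)).
exact: (@eq_bounded_path R _ _ E (@path_bounded R w z)).
Qed.

Lemma Pevents_ae_sym (A : set (Omega R)) : Pevents A ->
  (\forall w \ae mu2, A w) -> (\forall w \ae mu1, A w).
Proof.
move=> [B GB [aB bB]]; apply: (ae_system_ae (smallest_sigma_algebra _ _)
  (@measurable_poisson_events R)) => [C GC|]; last by exists B.
exact: esym (poisson_events_eq p1 p2 GC).
Qed.

Lemma value_event z k j (U : set R[i]) : copen U ->
  Pevents [set w | U (uval (value w (dtime R k j) z))].
Proof.
move=> oU; have [G1 [mG1 aeG1]] := adapted_field h1.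
have [G2 [mG2 aeG2]] := adapted_field h2.
have s1 := paths_eq_field z h1 aeG1; have s2 := paths_eq_field z h2 aeG2.
have mS (G : time R -> Omega R -> confmap R) :
    (forall k j (A : set (borel (confmap R))), measurable A ->
      Pevents (G (dtime R k j) @^-1` A)) ->
    Pevents [set w | solves (Pt w) (uval z) (field_path G z w) /\
      bounded_path (field_path G z w)].
  move=> mG; have mA := Pevents_solves p1 p2 mG z; have mB := Pevents_bounded mG z.
  rewrite -!measurable_PeventsE// in mA mB *.
  exact: (@measurableI _ OmegaP _ _ mA mB).
have s12 := Pevents_ae_sym (mS _ mG2) s2.
have s21 := Pevents_ae p1 p2 (mS _ mG1) s1.
have unique (mu : probability (Omega R) R) : backward_SHL0 mu ->
    (\forall w \ae mu, solves (Pt w) (uval z) (field_path G1 z w) /\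
      bounded_path (field_path G1 z w)) ->
    (\forall w \ae mu, solves (Pt w) (uval z) (field_path G2 z w) /\
      bounded_path (field_path G2 z w)) ->
    \forall w \ae mu, forall k j,
      field_path G1 z w (dtime R k j) = field_path G2 z w (dtime R k j).
  move=> h t1 t2; apply: filterS3 (poisson_good (SHL_poisson h)) t1 t2.
  by move=> w gw [f1 b1] [f2 b2]; exact: (@solves_unique R _ _ _ _ gw f1 f2 b1 b2).
have u2 := unique mu2 h2 s21 s2.
(* This event represents that of the flow under both laws: for [mu1] by the choice of [G1], for
   [mu2] through [G1 = G2]. *)
have mE : Pevents [set w | U (field_path G1 z w (dtime R k j))].
  rewrite -measurable_PeventsE//; apply: measurable_copen => //.
  exact: cmeasurable_field_path.
apply: (Pevents_modulo mE).
  by move: aeG1; apply: filterS => w wG; rewrite /field_path/= wG.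
move: aeG2 u2; apply: filterS2 => w wG uw.
by rewrite /= uw /field_path wG.
Qed.

End adapted_paths.

(** * Events of the Skorohod space *)

Section piecewise_linear_bump.
Variables (R : realType) (p c : R).

(** For [t] and [t'] between [p] and [c], the piecewise linear map with knots [p], [t], [c] sent to
    [p], [t'], [c], and the identity outside [p, c]. *)
Definition pl_bump (t t' x : R) : R :=
  if x <= p then x
  else if x <= t then p + (x - p) * ((t' - p) / (t - p))
  else if x <= c then c - (c - x) * ((c - t') / (c - t))
  else x.

Variables (t t' : R).
Hypotheses (pt : p < t) (tc : t < c) (pt' : p < t') (tc' : t' < c).

Let k1 : R := (t' - p) / (t - p).
Let k2 : R := (c - t') / (c - t).
Let k1_gt0 : 0 < k1. Proof. by rewrite divr_gt0 ?subr_gt0. Qed.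
Let k2_gt0 : 0 < k2. Proof. by rewrite divr_gt0 ?subr_gt0. Qed.
Let e1 : (t - p) * k1 = t' - p.
Proof. by rewrite /k1 mulrC divfK// subr_eq0 gt_eqF. Qed.
Let e2 : (c - t) * k2 = c - t'.
Proof. by rewrite /k2 mulrC divfK// subr_eq0 gt_eqF. Qed.

Lemma pl_bump_id x : x <= p \/ c <= x -> pl_bump t t' x = x.
Proof.
rewrite /pl_bump; case: leP => // px [//|cx].
rewrite leNgt (lt_le_trans tc cx) /=; case: leP => // xc.
have -> : x = c by apply/eqP; rewrite eq_le xc cx.
by rewrite subrr mul0r subr0.
Qed.

Lemma pl_bumpL x : p < x -> x <= t -> pl_bump t t' x = p + (x - p) * k1.
Proof. by move=> px xt; rewrite /pl_bump leNgt px xt. Qed.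

Lemma pl_bumpR x : t <= x -> x <= c -> pl_bump t t' x = c - (c - x) * k2.
Proof.
rewrite le_eqVlt => /predU1P[<- _|tx xc]; first by rewrite pl_bumpL// e1 e2; lra.
by rewrite /pl_bump [x <= p]leNgt (lt_trans pt tx) [x <= t]leNgt tx xc.
Qed.

Lemma pl_bump_left x : p <= x -> x < t -> p <= pl_bump t t' x < t'.
Proof.
rewrite le_eqVlt => /predU1P[<- _|px xt].
  by rewrite pl_bump_id ?lexx//; left.
rewrite (pl_bumpL px (ltW xt)).
have : 0 < (x - p) * k1 by rewrite mulr_gt0// subr_gt0.
have : (x - p) * k1 < (t - p) * k1 by rewrite ltr_pM2r// ltrD2r.
by rewrite e1; lra.
Qed.

Lemma pl_bump_right x : t <= x -> x <= c -> t' <= pl_bump t t' x <= c.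
Proof.
move=> tx xc; rewrite (pl_bumpR tx xc).
have : 0 <= (c - x) * k2 by rewrite mulr_ge0 ?subr_ge0// ltW.
have : (c - x) * k2 <= (c - t) * k2 by rewrite ler_pM2r// lerD2l lerN2.
by rewrite e2; lra.
Qed.

Lemma pl_bump_incr x y : x < y -> pl_bump t t' x < pl_bump t t' y.
Proof.
move=> xy; have [xp|px] := leP x p.
  rewrite (pl_bump_id (or_introl xp)).
  have [yp|py] := leP y p; first by rewrite pl_bump_id//; left.
  have [yt|ty] := ltP y t.
    rewrite (pl_bumpL py (ltW yt)).
    have : 0 < (y - p) * k1 by rewrite mulr_gt0// subr_gt0.
    lra.
  have [yc|cy] := leP y c; last by rewrite pl_bump_id//; right; exact: ltW.
  have /andP[h _] := pl_bump_right ty yc; exact: le_lt_trans xp (lt_le_trans pt' h).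
have [xt|tx] := ltP x t.
  have [yt|ty] := leP y t.
    rewrite (pl_bumpL px (ltW xt)) (pl_bumpL (lt_trans px xy) yt).
    by rewrite ltrD2l ltr_pM2r// ltrD2r.
  have /andP[_ xt'] := pl_bump_left (ltW px) xt.
  have [yc|cy] := leP y c; last first.
    rewrite [ltRHS]pl_bump_id; last by right; exact: ltW.
    exact: lt_trans xt' (lt_trans tc' cy).
  have /andP[h _] := pl_bump_right (ltW ty) yc; exact: lt_le_trans xt' h.
have [xc|cx] := leP x c; last first.
  have cy := lt_trans cx xy.
  by rewrite !pl_bump_id//; right; exact: ltW.
have [yc|cy] := leP y c; last first.
  rewrite [ltRHS]pl_bump_id; last by right; exact: ltW.
  by have /andP[_ h] := pl_bump_right tx xc; exact: le_lt_trans h cy.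
rewrite (pl_bumpR tx xc) (pl_bumpR (le_trans tx (ltW xy)) yc).
by rewrite ltrD2l ltrN2 ltr_pM2r// ltrD2l ltrN2.
Qed.

(** The displacement vanishes at [p] and [c] and is affine on either side of [t], so it is largest
    at [t]. *)
Lemma pl_bump_dist x : `|pl_bump t t' x - x| <= `|t' - t|.
Proof.
have [xp|px] := leP x p; first by rewrite pl_bump_id ?subrr ?normr0//; left.
have [xt|tx] := leP x t.
  rewrite (pl_bumpL px xt).
  have -> : p + (x - p) * k1 - x = (x - p) / (t - p) * (t' - t).
    by rewrite /k1; field; rewrite subr_eq0 gt_eqF.
  rewrite normrM ger0_norm; last by rewrite divr_ge0// subr_ge0 // ltW.
  by apply: ler_piMl => //; rewrite ler_pdivrMr ?subr_gt0// mul1r lerD2r.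
have [xc|cx] := leP x c; last by rewrite pl_bump_id ?subrr ?normr0//; right; exact: ltW.
rewrite (pl_bumpR (ltW tx) xc).
have -> : c - (c - x) * k2 - x = (c - x) / (c - t) * (t' - t).
  by rewrite /k2; field; rewrite subr_eq0 gt_eqF.
rewrite normrM ger0_norm; last by rewrite divr_ge0// subr_ge0 // ltW.
by apply: ler_piMl => //; rewrite ler_pdivrMr ?subr_gt0// mul1r lerD2l lerN2 ltW.
Qed.

End piecewise_linear_bump.

(** Exchanging [t] and [t'] inverts both slopes; this yields the surjectivity of the time change. *)
Lemma pl_bumpK (R : realType) (p c t t' : R) : p < t -> t < c -> p < t' -> t' < c ->
  cancel (pl_bump p c t t') (pl_bump p c t' t).
Proof.
move=> pt tc pt' tc' x; have [xp|px] := leP x p.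
  by rewrite !pl_bump_id //; left.
have [xc|cx] := ltP x c; last by rewrite !pl_bump_id //; right.
have [xt|tx] := ltP x t.
  have /andP[_ h2] := pl_bump_left pt tc pt' (ltW px) xt.
  have h3 : p < pl_bump p c t t' x.
    by rewrite -[ltLHS](@pl_bump_id _ p c t t')//; [exact: pl_bump_incr|left].
  rewrite (pl_bumpL _ _ h3 (ltW h2)) (pl_bumpL _ _ px (ltW xt)).
  by field; rewrite !subr_eq0 !gt_eqF.
have /andP[h1 h2] := pl_bump_right pt tc tc' tx (ltW xc).
rewrite (pl_bumpR _ pt' tc' h1 h2) (pl_bumpR _ pt tc tx (ltW xc)).
by field; rewrite !subr_eq0 !gt_eqF.
Qed.

Lemma time_change_bump (R : realType) (p c t t' : R) :
  0 <= p -> p < t -> t < c -> p < t' -> t' < c ->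
  exists2 b : time R -> time R, time_change b &
    forall u, tval (b u) = pl_bump p c t t' (tval u).
Proof.
move=> p0 pt tc pt' tc'.
have ge0 s s' x : p < s -> s < c -> p < s' -> s' < c -> 0 <= x -> 0 <= pl_bump p c s s' x.
  move=> ps sc ps' sc' x0; have [xp|px] := leP x p; first by rewrite pl_bump_id//; left.
  apply: le_trans p0 _; apply: ltW.
  by rewrite -[ltLHS](@pl_bump_id _ p c s s')//; [exact: pl_bump_incr|left].
exists (fun u => time_of (pl_bump p c t t' (tval u))) => [|u]; last first.
  by rewrite time_ofK// ge0// tval_ge0.
split=> [u v uv|v].
  by rewrite !time_ofK ?ge0 ?tval_ge0//; exact: pl_bump_incr.
exists (time_of (pl_bump p c t' t (tval v))).
by rewrite time_ofK ?ge0 ?tval_ge0// pl_bumpK// time_of_tval.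
Qed.

Section dyadic_times.
Variable R : realType.

Definition dt (q : nat * nat) : time R := dtime R q.1 q.2.

Lemma dyadic_between (x y : R) : 0 <= x -> x < y ->
  exists q, x < tval (dt q) < y.
Proof.
move=> x0 xy; have [k _ hk] : \forall k \near \oo, (2^-1 ^+ k < y - x)%R.
  by apply: near_exp_half; rewrite subr_gt0.
have {hk} := hk k (leqnn k) => kxy.
pose j := Num.floor (x * 2 ^+ k) + 1.
have e0 : 0 < 2 ^+ k :> R by rewrite exprn_gt0.
have /andP[lo hi] := floor_itv (x * 2 ^+ k).
have j0 : (0 <= j)%R by rewrite addr_ge0// floor_ge0 mulr_ge0// ltW.
exists (k, `|j|%N); rewrite dtimeE /= /dy gez0_abs// ltr_pdivlMr// hi /=.
rewrite ltr_pdivrMr// /j intrD; apply: le_lt_trans (_ : x * 2 ^+ k + 1 < _).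
  by rewrite lerD2r.
rewrite -ltrBrDl -mulrBl; apply: le_lt_trans (_ : 2^-1 ^+ k * 2 ^+ k < _).
  by rewrite -exprMn mulVf// expr1n.
by rewrite ltr_pM2r.
Qed.

End dyadic_times.

Section switching_paths.
Variables (R : realType) (V : uniformType) (I : countType) (N : I -> set V).
Hypothesis closedN : forall i, closed (N i).
Hypothesis networkN : forall (f : V) (E : set (V * V)), entourage E ->
  exists2 i, nbhs f (N i) & forall g h, N i g -> N i h -> E (g, h).
Implicit Types F G : cadlag R V.
Local Notation dyad := (nat * nat)%type.
Local Notation dt := (dt R).

Definition holds (F : time R -> V) (i : I) (A : set R) :=
  forall u, A (tval u) -> N i (F u).

(* The path stays in [N i] from [p] on; each item (a, b, c, i') makes it switch
   to [N i'] between [a] and [b] and stay there until [c]. *)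
Fixpoint switches (F : time R -> V) (p : dyad) (i : I)
    (l : seq (dyad * dyad * dyad * I)) (q : dyad) : Prop :=
  match l with
  | [::] => tval (dt p) < tval (dt q) /\ holds F i `[tval (dt p), tval (dt q)]
  | (a, b, c, i') :: l' =>
    [/\ tval (dt p) < tval (dt a) /\ tval (dt b) < tval (dt c),
        exists t : R, [/\ tval (dt a) <= t <= tval (dt b),
          holds F i `[tval (dt p), t[ & holds F i' `[t, tval (dt c)]]
      & switches F c i' l' q]
  end.

Definition small (E : set (V * V)) (i : I) :=
  forall g h, N i g -> N i h -> E (g, h).

(** Only the windows in which a switch may occur have to be short; on the plateaus, closeness comes
    from the smallness of the sets. *)
Definition fine (d : R) (E : set (V * V)) (l : seq (dyad * dyad * dyad * I)) :=
  forall x, x \in l ->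
    tval (dt x.1.1.2) - tval (dt x.1.1.1) < d /\ small E x.2.

(* Matching the two switching times in each cell by a piecewise linear change
   of time shows that two paths with the same switches are close. *)
Lemma switches_close F G (d : R) E p i l q : 0 < d -> fine d E l -> small E i ->
  switches F p i l q -> switches G p i l q ->
  exists2 c : time R -> time R, time_change c & forall u,
    [/\ tval u <= tval (dt p) -> c u = u,
        `|tval (c u) - tval u| < d
      & tval (dt p) <= tval u -> tval u <= tval (dt q) -> E (F (c u), G u)].
Proof.
move=> d0; elim: l p i => [|[[[a b] c] i'] l IH] p i fl si /=.
  move=> [pq hF] [_ hG]; exists id; first by split=> // t; exists t.
  move=> u; split=> //; first by rewrite subrr normr0.
  by move=> pu uq; apply: si; [apply: hF|apply: hG]; rewrite /= in_itv/= pu.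
move=> [[pa bc] [t [/andP[at_ tb] F1 F2]] Fl] [_ [s [/andP[as_ sb] G1 G2]] Gl].
have [bad si'] := fl (a, b, c, i') (mem_head _ _).
have {fl}fl : fine d E l by move=> x xl; apply: fl; rewrite inE xl orbT.
(* The change [k] for the rest of the chain fixes all times up to [c], while the new bump moves only
   times between [p] and [c], carrying the switch [s] of [G] to the switch [t] of [F]; so the two
   compose without interfering. *)
have [k [k_incr k_surj] hk] := IH _ _ fl si' Fl Gl.
have ps : tval (dt p) < s := lt_le_trans pa as_.
have pt : tval (dt p) < t := lt_le_trans pa at_.
have sc : s < tval (dt c) := le_lt_trans sb bc.
have tc : t < tval (dt c) := le_lt_trans tb bc.
have [m [m_incr m_surj] hm] := time_change_bump (tval_ge0 (dt p)) ps sc pt tc.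
exists (m \o k).
  split=> [u v uv|v]; first by apply: m_incr; exact: k_incr.
  by have [v' <-] := m_surj v; have [u <-] := k_surj v'; exists u.
have mk u : tval u <= tval (dt c) -> m (k u) = m u.
  by move=> uc; have [kc _ _] := hk u; rewrite kc.
have mk' u : tval (dt c) <= tval u -> m (k u) = k u.
  move=> cu; apply: tval_time_inj; rewrite hm pl_bump_id//; right.
  move: cu; rewrite le_eqVlt => /predU1P[/tval_time_inj<-|/k_incr cu].
    by have [kc _ _] := hk (dt c); rewrite kc.
  by apply/ltW; have [kc _ _] := hk (dt c); rewrite -(kc (lexx _)).
move=> u /=; have [k1 k2 k3] := hk u; split.
- move=> up; rewrite mk; last by lra.
  by apply: tval_time_inj; rewrite hm pl_bump_id//; left.
- have [uc|cu] := leP (tval u) (tval (dt c)); last by rewrite mk' ?(ltW cu).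
  rewrite mk// hm; apply: le_lt_trans (pl_bump_dist t ps sc _) _.
  by apply: le_lt_trans bad; rewrite ler_norml; lra.
move=> pu uq; have [uc|cu] := ltP (tval (dt c)) (tval u).
  by rewrite mk' ?(ltW uc)//; apply: k3 => //; exact: ltW.
rewrite mk//; have [us|su] := ltP (tval u) s.
  apply: si; [apply: F1|apply: G1]; rewrite /= in_itv/= ?pu ?us//.
  by rewrite hm; exact: pl_bump_left.
apply: si'; [apply: F2|apply: G2]; rewrite /= in_itv/= ?su ?cu//.
by rewrite hm; exact: pl_bump_right.
Qed.

(** Two switches are appended to the last plateau: one into [N i1], at a dyadic time where the
    plateau overlaps ]s - e, s[ and both sets hold, and one into [N i2] exactly at [s], where the
    path may jump. *)
Lemma switches_extend F (d : R) E p i l q i1 i2 (s e : R) : 0 < d -> 0 < e ->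
  fine d E l -> small E i1 -> small E i2 ->
  switches F p i l q -> s - e < tval (dt q) -> tval (dt q) <= s ->
  holds F i1 `]s - e, s[ -> holds F i2 `[s, s + e[ ->
  exists l' q', [/\ fine d E l', switches F p i l' q' & s < tval (dt q')].
Proof.
move=> d0 e0 + si1 si2 + eq qs h1 h2.
elim: l p i => [|[[[a b] c] i'] l IH] p i fl /=; last first.
  move=> [pabc ht sw].
  have {}fl' : fine d E l by move=> x xl; apply: fl; rewrite inE xl orbT.
  have [l' [q' [fl'' sw' sq']]] := IH _ _ fl' sw.
  exists ((a, b, c, i') :: l'), q'; split=> // x; rewrite inE => /predU1P[->|].
    by apply: fl; exact: mem_head.
  exact: fl''.
move=> [pq hp].
pose m := Num.max (tval (dt p)) (s - e).
have m0 : 0 <= m by rewrite le_max tval_ge0.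
have mp : tval (dt p) <= m by rewrite le_max lexx.
have me : s - e <= m by rewrite le_max lexx orbT.
have mq : m < tval (dt q) by rewrite gt_max pq.
have [a /andP[ma aq]] := dyadic_between m0 mq.
have abx : tval (dt a) < Num.min (tval (dt q)) (tval (dt a) + d).
  by rewrite lt_min aq ltrDl.
have [b /andP[ab]] := dyadic_between (tval_ge0 _) abx.
rewrite lt_min => /andP[bq bad].
have [c /andP[bc cq]] := dyadic_between (tval_ge0 _) bq.
pose m' := Num.max (tval (dt c)) (s - d / 2).
have m'0 : 0 <= m' by rewrite le_max tval_ge0.
have m'c : tval (dt c) <= m' by rewrite le_max lexx.
have m'd : s - d / 2 <= m' by rewrite le_max lexx orbT.
have m's : m' < s by rewrite gt_max (lt_le_trans cq qs) ltrBlDr ltrDl divr_gt0.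
have [a' /andP[ma' a's]] := dyadic_between m'0 m's.
have s0 : 0 <= s := le_trans m'0 (ltW m's).
have sx : s < Num.min (s + d / 2) (s + e) by rewrite lt_min !ltrDl e0 divr_gt0.
have [b' /andP[sb']] := dyadic_between s0 sx.
rewrite lt_min => /andP[b'd b'e].
have [c' /andP[b'c' c'e]] := dyadic_between (tval_ge0 _) b'e.
have [q' /andP[c'q' q'e]] := dyadic_between (tval_ge0 _) c'e.
exists [:: (a, b, c, i1); (a', b', c', i2)], q'; split.
- move=> x; rewrite !inE => /orP[] /eqP -> /=; split=> //; lra.
- split.
  + by split=> //; lra.
  + exists (tval (dt a)); split.
    * by rewrite lexx ltW.
    * by move=> u /=; rewrite in_itv/= => /andP[pu ua]; apply: hp; rewrite /= in_itv/=; lra.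
    * by move=> u /=; rewrite in_itv/= => /andP[au uc]; apply: h1; rewrite /= in_itv/=; lra.
  split.
  + by split=> //; lra.
  + exists s; split.
    * by lra.
    * by move=> u /=; rewrite in_itv/= => /andP[cu us]; apply: h1; rewrite /= in_itv/=; lra.
    * by move=> u /=; rewrite in_itv/= => /andP[su uc]; apply: h2; rewrite /= in_itv/=; lra.
  split=> //.
  by move=> u /=; rewrite in_itv/= => /andP[cu uq]; apply: h2; rewrite /= in_itv/=; lra.
- lra.
Qed.

Lemma holds_right F (t : time R) i : nbhs (F t) (N i) ->
  exists2 e : R, 0 < e & holds F i `[tval t, tval t + e[.
Proof.
move=> Fi; have /(_ _ Fi)/nbhs_time[r r0 hr] := @traj_right _ _ F t.
exists r => // u; rewrite /= in_itv/= => /andP[].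
rewrite le_eqVlt => /predU1P[/tval_time_inj<- _|tu ur].
  exact: nbhs_singleton.
by apply: hr => //; rewrite ltr_norml; lra.
Qed.

Lemma holds_left F (t : time R) (E : set (V * V)) : entourage E ->
  exists2 i, small E i & exists2 e : R, 0 < e & holds F i `]tval t - e, tval t[.
Proof.
move=> entE; have [f hf] := traj_left F t; have [i fi si] := networkN f entE.
exists i => //; have /nbhs_time[r r0 hr] := hf _ fi.
exists r => // u; rewrite /= in_itv/= => /andP[ru ut].
by apply: hr => //; rewrite ltr_norml; lra.
Qed.

(** The times passed by some chain have no upper bound [T]: at their supremum the path has a left
    limit and is right-continuous, and network sets around the two values extend a chain ending
    nearby beyond the supremum. *)
Lemma switches_exist F (T d : R) (E : set (V * V)) : 0 < d -> entourage E ->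
  exists i l q, [/\ small E i, fine d E l, switches F (0, 0)%N i l q & T < tval (dt q)].
Proof.
move=> d0 entE; have [i Fi si] := networkN (F (dt (0, 0)%N)) entE.
pose S := [set s : R | 0 <= s /\ exists l q,
  [/\ fine d E l, switches F (0, 0)%N i l q & s < tval (dt q)]].
have [e e0 he] := holds_right Fi.
have dt0 : tval (dt (0, 0)%N) = 0 by rewrite dtimeE /dy mul0r.
have [q /andP[q0 qe]] := dyadic_between (lexx 0) e0.
have sq : switches F (0, 0)%N i [::] q.
  split; first by rewrite dt0.
  move=> u /=; rewrite dt0 in_itv/= => /andP[u0 uq]; apply: he.
  by rewrite dt0 add0r /= in_itv/= u0 (le_lt_trans uq).
have fnil : fine d E [::] by [].
have S0 : S 0 by split=> //; exists [::], q.
have [ST|] := pselect (exists2 s, S s & T < s).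
  have [s [_ [l [q' [fl sw sq']]]] Ts] := ST; exists i, l, q'; split=> //.
  exact: lt_trans sq'.
move=> noT; exfalso.
have hS : has_sup S.
  split; first by exists 0.
  by exists T => s Ss; rewrite leNgt; apply/negP => Ts; apply: noT; exists s.
pose s := sup S.
have S_le x : S x -> x <= s by move=> Sx; apply: ub_le_sup => //; case: hS.
have [s0 _] : 0 <= s /\ True by split=> //; exact: S_le.
have no_beyond l q' : fine d E l -> switches F (0, 0)%N i l q' -> tval (dt q') <= s.
  move=> fl sw; rewrite leNgt; apply/negP => sq'.
  have [x /andP[sx xq]] := dyadic_between s0 sq'.
  have : S (tval (dt x)) by split; [exact: tval_ge0|exists l, q'].
  by move/S_le; rewrite leNgt sx.
pose t := time_of s; have ts : tval t = s by rewrite time_ofK.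
have [i1 si1 [e1 e10 h1]] := holds_left F t entE.
have [i2 Fi2 si2] := networkN (F t) entE; have [e2 e20 h2] := holds_right Fi2.
rewrite ts in h1 h2; pose r := Num.min e1 e2.
have r0 : 0 < r by rewrite lt_min e10.
have [x [_ [l [q' [fl sw xq]]]] sx] := sup_adherent r0 hS.
have {}h1 : holds F i1 `]s - r, s[.
  move=> u /= ; rewrite in_itv/= => /andP[ru us]; apply: h1; rewrite /= in_itv/= us andbT.
  by apply: le_lt_trans ru; rewrite lerD2l lerN2 ge_min lexx.
have {}h2 : holds F i2 `[s, s + r[.
  move=> u /= ; rewrite in_itv/= => /andP[su ur]; apply: h2; rewrite /= in_itv/= su/=.
  by apply: lt_le_trans ur _; rewrite lerD2l ge_min lexx orbT.
have [l' [q'' [fl' sw' sq'']]] := switches_extend d0 r0 fl si1 si2 sw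
  (lt_trans sx xq) (no_beyond _ _ fl sw) h1 h2.
by have := no_beyond _ _ fl' sw'; rewrite leNgt sq''.
Qed.

(** Each time of [x, y[ is approached by dyadic times from the right; right-continuity and
    closedness of [N i] conclude. The end [y] cannot be reached in this way and is left out. *)
Lemma holds_dyadic F i (x y : R) : 0 <= x ->
  (forall q, x < tval (dt q) < y -> N i (F (dt q))) -> holds F i `[x, y[.
Proof.
move=> x0 h u; rewrite /= in_itv/= => /andP[xu uy].
have := @closedN i; rewrite closure_id => ->.
move=> B /(@traj_right _ _ F u)/nbhs_time[r r0 hr].
have uy' : tval u < Num.min y (tval u + r) by rewrite lt_min uy ltrDl.
have [q /andP[uq]] := dyadic_between (tval_ge0 u) uy'.
rewrite lt_min => /andP[qy qr].
exists (F (dt q)); split; first by apply: h; rewrite (le_lt_trans xu uq).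
by apply: hr => //; rewrite ltr_norml; lra.
Qed.

Lemma holds_event F i p q : holds F i `[tval (dt p), tval (dt q)] <->
  forall x, tval (dt p) <= tval (dt x) <= tval (dt q) -> N i (F (dt x)).
Proof.
split=> [h x xpq|h u]; first by apply: h; rewrite /= in_itv.
rewrite /= in_itv/= => /andP[pu]; rewrite le_eqVlt => /predU1P[/tval_time_inj uq|uq].
  by rewrite uq; apply: h; rewrite -uq pu lexx.
apply: (@holds_dyadic F i (tval (dt p)) (tval (dt q))).
- exact: tval_ge0.
- by move=> x /andP[px xq]; apply: h; rewrite !ltW.
- by rewrite /= in_itv/= pu.
Qed.

(* The switching time is recovered as the infimum of the dyadic times at which
   the path has left [N i]; closedness and right-continuity do the rest. *)
Lemma switch_event F i i' p a b c : tval (dt p) < tval (dt a) -> tval (dt b) < tval (dt c) ->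
  (exists t : R, [/\ tval (dt a) <= t <= tval (dt b),
     holds F i `[tval (dt p), t[ & holds F i' `[t, tval (dt c)]]) <->
  [/\ tval (dt a) <= tval (dt b),
    forall x, tval (dt p) <= tval (dt x) < tval (dt a) -> N i (F (dt x)),
    forall x, tval (dt b) <= tval (dt x) <= tval (dt c) -> N i' (F (dt x)) &
    forall x y, [/\ tval (dt a) <= tval (dt x), tval (dt x) < tval (dt y)
      & tval (dt y) <= tval (dt b)] -> N i (F (dt x)) \/ N i' (F (dt y))].
Proof.
move=> pa bc; split.
  move=> [t [/andP[at_ tb] h1 h2]]; split; first exact: le_trans tb.
  - by move=> x /andP[px xa]; apply: h1; rewrite /= in_itv/= px (lt_le_trans xa).
  - by move=> x /andP[bx xc]; apply: h2; rewrite /= in_itv/= xc (le_trans tb).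
  - move=> x y [ax xy yb]; have [xt|tx] := ltP (tval (dt x)) t; [left|right].
      by apply: h1; rewrite /= in_itv/= xt andbT; lra.
    by apply: h2; rewrite /= in_itv/=; lra.
move=> [ab h1 h2 h3].
(* Putting the time of [b] into [S] ensures that the infimum exists and is at most that time, even
   if the path never leaves [N i]. *)
pose S := [set s | s = tval (dt b) \/ exists x, [/\ s = tval (dt x),
  tval (dt a) <= s <= tval (dt b) & ~ N i (F (dt x))]].
have Sb : S (tval (dt b)) by left.
have S_ge s : S s -> tval (dt a) <= s by case=> [->//|[x [_ /andP[]]]].
have hS : has_inf S by split; [exists (tval (dt b))|exists (tval (dt a)) => s /S_ge].
have infS s : S s -> inf S <= s by move=> Ss; apply: ge_inf => //; case: hS.
have tb := infS _ Sb.
have at_ : tval (dt a) <= inf S by apply: lb_le_inf; [case: hS|move=> s /S_ge].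
have t0 : 0 <= inf S := le_trans (tval_ge0 _) at_.
exists (inf S); split; first by rewrite at_.
  apply: holds_dyadic => [|x /andP[px xt]]; first exact: tval_ge0.
  have [xa|ax] := ltP (tval (dt x)) (tval (dt a)); first by apply: h1; rewrite xa ltW.
  apply: contrapT => nN; have := xt; rewrite ltNge => /negP; apply; apply: infS.
  by right; exists x; split=> //; rewrite ax (le_trans (ltW xt)).
(* For [x] before [b], the set [N i] fails at some dyadic time before [x], so the last hypothesis
   forces [N i'] at [x]. *)
have h4 x : inf S < tval (dt x) <= tval (dt c) -> N i' (F (dt x)).
  move=> /andP[tx xc]; have [bx|xb] := leP (tval (dt b)) (tval (dt x)).
    by apply: h2; rewrite bx.
  have tx0 : 0 < tval (dt x) - inf S by rewrite subr_gt0.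
  have [s Ss] := inf_adherent tx0 hS.
  rewrite [ltRHS]addrC subrK => sx; case: Ss sx => [->|[y [-> /andP[ay yb] nN]] yx].
    by rewrite ltNge (ltW xb).
  by case: (h3 y x) => //; split=> //; exact: ltW.
move=> u; rewrite /= in_itv/= => /andP[tu]; rewrite le_eqVlt => /predU1P[/tval_time_inj uc|uc].
  by rewrite uc; apply: h4; rewrite lexx andbT; apply: le_lt_trans bc.
apply: (@holds_dyadic F i' (inf S) (tval (dt c)) t0).
  by move=> x /andP[tx xc]; apply: h4; rewrite tx ltW.
by rewrite /= in_itv/= tu.
Qed.

Section events.
Context d (T : measurableType d) (X : T -> cadlag R V).
Hypothesis mX : forall i q, measurable [set w | N i (X w (dt q))].

Lemma measurable_switches p i l q : measurable [set w | switches (X w) p i l q].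
Proof.
elim: l p i => [|[[[a b] c] i'] l IH] p i /=.
  rewrite (_ : [set w | _] = [set w | tval (dt p) < tval (dt q)] `&` [set w |
      forall x, tval (dt p) <= tval (dt x) <= tval (dt q) -> N i (X w (dt x))]).
    apply: measurableI; first exact: measurable_const.
    apply: measurable_forall => x; apply: measurable_imply => _; exact: mX.
  by apply/seteqP; split=> w /= [pq] /holds_event.
have [[pa bc]|npb] := pselect (tval (dt p) < tval (dt a) /\ tval (dt b) < tval (dt c));
    last first.
  rewrite (_ : [set w | _] = set0)//.
  by apply/seteqP; split=> // w [] /npb.
rewrite (_ : [set w | _] = [set w | tval (dt a) <= tval (dt b)] `&`
  [set w | forall x, tval (dt p) <= tval (dt x) < tval (dt a) -> N i (X w (dt x))] `&`
  [set w | forall x, tval (dt b) <= tval (dt x) <= tval (dt c) -> N i' (X w (dt x))] `&`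
  [set w | forall x y, [/\ tval (dt a) <= tval (dt x), tval (dt x) < tval (dt y)
      & tval (dt y) <= tval (dt b)] -> N i (X w (dt x)) \/ N i' (X w (dt y))] `&`
  [set w | switches (X w) c i' l q]); last first.
  apply/seteqP; split=> w /=.
    by move=> [_ /(switch_event _ _ _ pa bc)[? ? ? ?] ?].
  by move=> [[[[? ?] ?] ?] ?]; split=> //; apply/(switch_event _ _ _ pa bc); split.
apply: measurableI; last exact: IH.
apply: measurableI; last first.
  apply: measurable_forall => x; apply: measurable_forall => y.
  apply: measurable_imply => _; apply: measurableU; exact: mX.
apply: measurableI; last first.
  by apply: measurable_forall => x; apply: measurable_imply => _; exact: mX.
apply: measurableI; last first.
  by apply: measurable_forall => x; apply: measurable_imply => _; exact: mX.
exact: measurable_const.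
Qed.

(** A path of [U] follows a chain fine enough for the neighbourhood that openness provides, and by
    [switches_close] every path following the same chain is then in [U]. *)
Lemma measurable_skorohod_open (U : set (cadlag R V)) : skorohod_open U ->
  measurable [set w | U (X w)].
Proof.
move=> oU; pose J := (I * seq (dyad * dyad * dyad * I) * dyad)%type.
pose M (j : J) := [set w | switches (X w) (0, 0)%N j.1.1 j.1.2 j.2].
apply: (@measurable_network _ T J M) => [j|w Uw]; first exact: measurable_switches.
have [t [e [E [e0 entE sU]]]] := oU _ Uw.
have [i [l [q [si fl sw tq]]]] := switches_exist (X w) t e0 entE.
exists (i, l, q) => // w' sw'; apply: sU.
have [c tc hc] := switches_close e0 fl si sw sw'; exists c => // u ut.
have [_ h1 h2] := hc u; split=> //; apply: h2; last exact: le_trans (ltW tq).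
by rewrite dtimeE /dy mul0r tval_ge0.
Qed.

End events.

End switching_paths.

(** * A network of conformal maps *)

(** An entourage contains a finite intersection of entourages of uniform convergence on single
    compact sets; the union of these sets and the intersection of the entourages serve for all. *)
Lemma entourage_compact_family (U : topologicalType) (V : uniformType)
    (E : set ({family compact, U -> V} * {family compact, U -> V})) : entourage E ->
  exists2 K : set U, compact K & exists2 e : set (V * V), entourage e &
    forall f g : U -> V, (forall t, K t -> e (f t, g t)) -> E (f, g).
Proof.
move=> [B [D _ <-] DE].
suff [K cK [e ee h]] : exists2 K : set U, compact K & exists2 e : set (V * V),
    entourage e & forall i, i \in finmap.enum_fset D -> forall f g : U -> V,
      (forall t, K t -> e (f t, g t)) -> (projT1 i).2 (f, g).
  by exists K => //; exists e => // f g fg; apply: DE => i /= iD; exact: h.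
elim: (finmap.enum_fset D) => [|i s [K cK [e ee h]]].
  by exists set0; [exact: compact0|exists setT => //; exact: entourageT].
have [K' cK' [e' ee' h']] : exists2 K : set U, compact K & exists2 e : set (V * V),
    entourage e & forall f g : U -> V,
      (forall t, K t -> e (f t, g t)) -> (projT1 i).2 (f, g).
  case: i => -[[A cA] /= P] /= /asboolP entP.
  have : @entourage {uniform` A -> V} P by exact: entP.
  rewrite uniform_entourage => -[e' ee' eP]; exists A => //; exists e' => // f g fg.
  exact: (eP (f, g)).
exists (K `|` K'); first exact: compactU.
exists (e `&` e'); first exact: filterI.
move=> j; rewrite inE => /predU1P[->|js] f g fg.
  by apply: h' => t Kt; apply: (fg t _).2; right.
by apply: h js _ _ _ => t Kt; apply: (fg t _).1; left.
Qed.

Section conformal_network.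
Variable R : realType.

Lemma upper_half_plane_i : @upper_half_plane R (0 +i* 1).
Proof. exact: ltr01. Qed.

HB.instance Definition _ :=
  isPointed.Build (uhp R) (exist _ (0 +i* 1) (mem_set upper_half_plane_i)).

Local Notation C := (R[i]^o).
Implicit Types (f g : confmap R) (z : uhp R).

Lemma entourage_uhp (e : set (uhp R * uhp R)) : entourage e ->
  exists2 d : R, 0 < d & forall u v : uhp R, cnorm (uval u - uval v) < d -> e (u, v).
Proof.
move=> [V eV Ve]; move: eV; rewrite -entourage_ballE => -[r /= r0 hr].
case: r r0 hr => r r' /=; rewrite ltcE/= => /andP[/eqP -> r0] hr.
exists r => // u v uv; apply: Ve; apply: hr => /=.
by rewrite -ball_normE /= cnormE ltcR.
Qed.

Lemma uhp_entourage (d : R) : 0 < d ->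
  entourage [set x : uhp R * uhp R | cnorm (uval x.1 - uval x.2) < d].
Proof.
move=> d0; exists [set x : C * C | cnorm (x.1 - x.2) < d] => //.
rewrite -entourage_ballE; exists d%:C => /=; first by rewrite ltcR.
by move=> [u v] /=; rewrite -ball_normE /= cnormE ltcR.
Qed.

Lemma entourage_confmap (E : set (confmap R * confmap R)) : entourage E ->
  exists2 K : set (uhp R), compact K & exists2 d : R, 0 < d &
    forall f g, (forall z, K z -> cnorm (uval (cfun f z) - uval (cfun g z)) < d) ->
      E (f, g).
Proof.
move=> [V eV VE]; have [K cK [e ee eV']] := entourage_compact_family eV.
have [d d0 hd] := entourage_uhp ee; exists K => //; exists d => // f g fg.
by apply: VE; apply: eV' => t Kt; apply: hd; exact: fg.
Qed.

Lemma nbhs_confmap f (K : set (uhp R)) (d : R) : compact K -> 0 < d ->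
  nbhs f [set g | forall z, K z -> cnorm (uval (cfun f z) - uval (cfun g z)) < d].
Proof.
move=> cK d0; apply: (@continuous_set_val_confmap R f
  [set h | forall z, K z -> cnorm (uval (cfun f z) - uval (h z)) < d]).
have /fam_cvgP/(_ _ cK) h := @cvg_id _ (nbhs (set_val f : {family compact, uhp R -> uhp R})).
apply: (h [set k | forall z, K z -> cnorm (uval (cfun f z) - uval (k z)) < d]).
apply/uniform_nbhs.
by exists [set x : uhp R * uhp R | cnorm (uval x.1 - uval x.2) < d]; split=> //;
  exact: uhp_entourage.
Qed.

Lemma cfun_continuous f z (e : R) : 0 < e -> exists2 r : R, 0 < r &
  forall u : uhp R, cnorm (uval u - uval z) < r ->
    cnorm (uval (cfun f u) - uval (cfun f z)) < e.
Proof.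
move=> e0; pose F : C -> C := 'valL_ 0 (@uval R \o cfun f).
have FE u : F (uval u) = uval (cfun f u).
  exact: (congr1 (@^~ u) (valLK 0 (@uval R \o cfun f))).
have [/(_ z)/derivable1_diffP/differentiable_continuous cf _] := set_mem (valP f).
have /cvg_cnorm/(_ e e0)/nbhs_ballP[r /= r0 hr] : F t @[t --> uval z] --> F (uval z).
  exact: cf.
case: r r0 hr => r r' /=; rewrite ltcE/= => /andP[/eqP -> r0] hr.
exists r => // u ur; rewrite cnormB -!FE; apply: hr.
by rewrite -ball_normE /= cnormE ltcR cnormB.
Qed.

Lemma compact_uhp_box (x1 x2 y1 y2 : R) : 0 < y1 -> compact [set z : uhp R |
  x1 <= complex.Re (uval z) <= x2 /\ y1 <= complex.Im (uval z) <= y2].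
Proof.
(* Cutting the ordinate off below at [y1] makes the parametrization of the box total. *)
move=> y0; have pr (p : R * R) : @upper_half_plane R (p.1 +i* Num.max p.2 y1).
  by rewrite /upper_half_plane/= lt_max y0 orbT.
pose phi (p : R * R) : uhp R := exist _ (p.1 +i* Num.max p.2 y1) (mem_set (pr p)).
have -> : [set z : uhp R |
    x1 <= complex.Re (uval z) <= x2 /\ y1 <= complex.Im (uval z) <= y2] =
    phi @` (`[x1, x2] `*` `[y1, y2]).
  apply/seteqP; split=> [z [zx zy]|_ [[x y] [/= + + <-]]].
    exists (complex.Re (uval z), complex.Im (uval z)); first by rewrite /= !in_itv.
    apply: val_inj; rewrite /= max_l; last by case/andP: zy.
    by rewrite -[RHS]/(uval z); case: (uval z).
  by rewrite !in_itv/= => xx /andP[y1y yy2]; rewrite max_l// y1y.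
apply: continuous_compact; last by apply: compact_setX; exact: segment_compact.
apply: continuous_subspaceT; apply: continuous_comp_initial => p.
apply/cvg_cnorm => e e0; have e20 : 0 < e / 2 by rewrite divr_gt0.
have c1 : q.1 @[q --> p] --> p.1 by exact: cvg_fst.
have c2 : Num.max q.2 y1 @[q --> p] --> Num.max p.2 y1.
  apply: (@continuous_max R _ (fun q : R * R => q.2) (cst y1)); last exact: cvg_cst.
  exact: cvg_snd.
move/cvgrPdist_lt/(_ _ e20): c1; move/cvgrPdist_lt/(_ _ e20): c2.
apply: filterS2 => q q2 q1; apply: le_lt_trans (ler_cnorm_ReIm _) _.
by rewrite !raddfB/= [e]splitr ltrD.
Qed.

Definition cpt (q : rat * rat) : R[i] := ratr q.1 +i* ratr q.2.

(* Centre and radius of a disc, centre and radius of the target disc. *)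
Definition disc_rule := (rat * rat * rat * (rat * rat * rat))%type.

Definition disc (x : disc_rule) : set (uhp R) :=
  [set z | cnorm (uval z - cpt x.1.1) < ratr x.1.2].

(** The source disc is open, so that discs can cover a compact set; the target is closed, so that
    the rule is a closed condition, as [holds_dyadic] requires. *)
Definition obeys (x : disc_rule) : set (confmap R) :=
  [set g | forall z, disc x z -> cnorm (uval (cfun g z) - cpt x.2.1) <= ratr x.2.2].

Definition obeys_all (s : seq disc_rule) : set (confmap R) :=
  [set g | forall x, x \in s -> obeys x g].

Lemma open_disc x : open (disc x).
Proof.
rewrite openE => z zx; have r0 : 0 < ratr x.1.2 - cnorm (uval z - cpt x.1.1).
  by rewrite subr_gt0.
have /cvg_cnorm/(_ _ r0) := @continuous_uval R z; apply: filterS => u.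
rewrite cnormB => uz; rewrite /disc/=.
have -> : uval u - cpt x.1.1 = (uval u - uval z) + (uval z - cpt x.1.1).
  by rewrite addrA subrK.
by apply: le_lt_trans (cnormD _ _) _; lra.
Qed.

Lemma closed_obeys_all s : closed (obeys_all s).
Proof.
have -> : obeys_all s = \bigcap_(x in [set` s]) \bigcap_(z in disc x)
    [set g | cnorm (uval (cfun g z) - cpt x.2.1) <= ratr x.2.2].
  by apply/seteqP; split=> g h x /= xs z zx; exact: h.
apply: closed_bigI => x _; apply: closed_bigI => z _.
rewrite (_ : [set g | _] =
  ~` [set g | ratr x.2.2 < cnorm (uval (cfun g z) - cpt x.2.1)]); last first.
  by apply/seteqP; split=> g /=; rewrite leNgt => /negP.
apply: open_closedC; rewrite openE => g /=; rewrite -subr_gt0 => e0.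
have /cvg_cnorm/(_ _ e0) := @continuous_ev R z g; apply: filterS => h /= hg.
have := cnormD (uval (cfun g z) - uval (cfun h z)) (uval (cfun h z) - cpt x.2.1).
by rewrite addrA subrK; lra.
Qed.

Lemma disc_around f z (d : R) : 0 < d -> exists x,
  [/\ disc x z, nbhs f (obeys x) & ratr x.2.2 < d].
Proof.
move=> d0; have [e] := rat_in_itvoo d0; rewrite in_itv/= => /andP[e0 ed].
have e30 : 0 < ratr e / 3 :> R by rewrite divr_gt0.
have [r r0 hr] := cfun_continuous f z e30.
have [b1 [b2 hb]] := crat_approx (uval (cfun f z)) e30.
have z0 := Im_uval_gt0 z.
(* Within [s] of [z] the map [f] varies by less than [e / 3] and the box [B] stays off the real
   line; the other two thirds are for the centre of the target and for the distance of [g] to [f] on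
   [B]. *)
pose s := Num.min (r / 4) (complex.Im (uval z) / 2).
have s0 : 0 < s by rewrite lt_min !divr_gt0.
have sr : s <= r / 4 by rewrite ge_min lexx.
have sz : s <= complex.Im (uval z) / 2 by rewrite ge_min lexx orbT.
have s20 : 0 < s / 2 by rewrite divr_gt0.
have [q] := rat_in_itvoo s20; rewrite in_itv/= => /andP[q0 qs].
have [a1 [a2 ha]] := crat_approx (uval z) q0.
exists (a1, a2, q, (b1, b2, e)); split=> //.
pose B := [set u : uhp R |
  complex.Re (uval z) - s <= complex.Re (uval u) <= complex.Re (uval z) + s /\
  complex.Im (uval z) - s <= complex.Im (uval u) <= complex.Im (uval z) + s].
have cB : compact B by apply: compact_uhp_box; lra.
have := nbhs_confmap f cB e30; apply: filterS => g hg u; rewrite /disc/= => ua.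
have uz : cnorm (uval u - uval z) < s.
  have -> : uval u - uval z = (uval u - cpt (a1, a2)) - (uval z - cpt (a1, a2)).
    by rewrite opprB addrA subrK.
  by apply: le_lt_trans (cnormD _ _) _; rewrite cnormN; rewrite /cpt/= in ua *; lra.
have Bu : B u.
  have := le_lt_trans (ler_Re_cnorm _) uz; have := le_lt_trans (ler_Im_cnorm _) uz.
  rewrite !raddfB/= !ltr_norml => /andP[? ?] /andP[? ?].
  by split; apply/andP; split; lra.
have fz : cnorm (uval (cfun f u) - uval (cfun f z)) < ratr e / 3 by apply: hr; lra.
have -> : uval (cfun g u) - cpt (b1, b2) =
    - (uval (cfun f u) - uval (cfun g u)) +
    ((uval (cfun f u) - uval (cfun f z)) + (uval (cfun f z) - cpt (b1, b2))).
  by ring.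
apply: le_trans (cnormD _ _) _; rewrite cnormN.
have := cnormD (uval (cfun f u) - uval (cfun f z)) (uval (cfun f z) - cpt (b1, b2)).
by have := hg u Bu; rewrite /cpt/= in hb *; lra.
Qed.

(** Two maps sending a disc into the same disc of radius less than [d / 2] differ there by less than
    [d], and finitely many such discs cover [K]. *)
Lemma confmap_network f (E : set (confmap R * confmap R)) : entourage E ->
  exists2 s, nbhs f (obeys_all s) &
    forall g h, obeys_all s g -> obeys_all s h -> E (g, h).
Proof.
move=> /entourage_confmap[K cK [d d0 hd]]; have d20 : 0 < d / 2 by rewrite divr_gt0.
pose D := [set x : disc_rule | nbhs f (obeys x) /\ ratr x.2.2 < d / 2].
have KD : K `<=` cover D disc.
  by move=> z _; have [x [zx fx xd]] := disc_around f z d20; exists x.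
have : @cover_compact (uhp R) K by rewrite -compact_cover.
move=> /(_ _ D disc (fun x _ => @open_disc x) KD).
move=> [D' D'D KD']; exists (finmap.enum_fset D').
  have {D'D KD'} : forall x, x \in finmap.enum_fset D' -> D x.
    by move=> x /D'D; rewrite inE.
  elim: (finmap.enum_fset D') => [_|x s IH sD].
    by apply: filterS filterT => g _ x.
  have [fx _] := sD x (mem_head _ _).
  have fs : nbhs f (obeys_all s) by apply: IH => y ys; apply: sD; rewrite inE ys orbT.
  apply: filterS2 fx fs => g gx gs y; rewrite inE => /predU1P[->//|]; exact: gs.
move=> g h og oh; apply: hd => z Kz; have [x /= xD' zx] := KD' z Kz.
have /set_mem[_ xd] := D'D _ xD'.
have := og x xD' z zx; have := oh x xD' z zx.
have -> : uval (cfun g z) - uval (cfun h z) =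
    (uval (cfun g z) - cpt x.2.1) - (uval (cfun h z) - cpt x.2.1).
  by rewrite opprB addrA subrK.
by move=> h1 h2; apply: le_lt_trans (cnormD _ _) _; rewrite cnormN; lra.
Qed.

(** By continuity of [g] it is enough to test points with rational coordinates, which reduces the
    rule to countably many values. *)
Lemma obeys_rational x g : obeys x g <-> forall q z, uval z = cpt q -> disc x z ->
  cnorm (uval (cfun g z) - cpt x.2.1) <= ratr x.2.2.
Proof.
split=> [gx q z _|gx z zx]; first exact: gx.
rewrite leNgt; apply/negP; rewrite -subr_gt0 => e0.
have [r r0 hr] := cfun_continuous g z e0; have z0 := Im_uval_gt0 z.
have d0 : 0 < ratr x.1.2 - cnorm (uval z - cpt x.1.1) by rewrite subr_gt0.
pose s := Num.min r (Num.min (complex.Im (uval z)) (ratr x.1.2 - cnorm (uval z - cpt x.1.1))).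
have s0 : 0 < s by rewrite !lt_min r0 z0.
have [a [b ab]] := crat_approx (uval z) s0.
have sr : s <= r by rewrite ge_min lexx.
have sz : s <= complex.Im (uval z) by rewrite !ge_min lexx orbT.
have sd : s <= ratr x.1.2 - cnorm (uval z - cpt x.1.1) by rewrite !ge_min lexx !orbT.
have b0 : @upper_half_plane R (cpt (a, b)).
  rewrite /upper_half_plane/=.
  have := le_lt_trans (ler_Im_cnorm _) ab; rewrite raddfB/= ltr_norml => /andP[_].
  by lra.
pose u : uhp R := exist _ (cpt (a, b)) (mem_set b0).
have uz : cnorm (uval u - uval z) < s by rewrite cnormB.
have ux : disc x u.
  rewrite /disc/=; have -> : uval u - cpt x.1.1 = (uval u - uval z) + (uval z - cpt x.1.1).
    by rewrite addrA subrK.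
  by apply: le_lt_trans (cnormD _ _) _; lra.
have h1 := gx (a, b) u erefl ux; have h2 := hr u (lt_le_trans uz sr).
have := cnormD (uval (cfun g z) - uval (cfun g u)) (uval (cfun g u) - cpt x.2.1).
by rewrite addrA subrK [cnorm (_ - uval (cfun g u))]cnormB; lra.
Qed.

End conformal_network.

(** * P-measurability of the whole path *)

Section uniqueness.
Variables (R : realType) (mu1 mu2 : probability (Omega R) R).
Hypothesis h1 : backward_SHL0 mu1.
Hypothesis h2 : backward_SHL0 mu2.
Local Notation OmegaP := (OmegaP mu1 mu2).

Lemma measurable_obeys_all (s : seq disc_rule) q :
  measurable [set w : OmegaP | obeys_all s (Ft w (dt R q))].
Proof.
rewrite (_ : [set w | _] = [set w : OmegaP | forall x, x \in s -> forall r,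
    forall z, uval z = cpt R r -> disc x z ->
    cnorm (uval (value w (dt R q) z) - cpt R x.2.1) <= ratr x.2.2]); last first.
  by apply/seteqP; split=> w h x xs; [|apply/obeys_rational => r z]; move: (h x xs);
    [move/obeys_rational|apply].
apply: measurable_forall => x; apply: measurable_imply => _.
apply: measurable_forall => r.
(* A rational point outside the half-plane imposes no condition. *)
have [[z zr]|no] := pselect (exists z : uhp R, uval z = cpt R r); last first.
  rewrite [X in measurable X](_ : _ = setT); first exact: measurableT.
  by apply/seteqP; split=> // w _ z zr; case: no; exists z.
rewrite [X in measurable X](_ : _ = [set w : OmegaP | disc x z ->
    cnorm (uval (value w (dt R q) z) - cpt R x.2.1) <= ratr x.2.2]); last first.
  apply/seteqP; split=> w /= h; first exact: h.
  by move=> u; rewrite -zr => /val_inj ->.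
apply: measurable_imply => _.
(* [value_event] treats open conditions, hence the passage to the complement. *)
rewrite [X in measurable X](_ : _ = ~` [set w : OmegaP |
    ratr x.2.2 < cnorm (uval (value w (dt R q) z) - cpt R x.2.1)]); last first.
  by apply/seteqP; split=> w /=; rewrite leNgt => /negP.
apply: measurableC; rewrite measurable_PeventsE; try exact: SHL_poisson.
apply: (value_event h1 h2 z q.1 q.2 (U := [set c | ratr x.2.2 < cnorm (c - cpt R x.2.1)])).
move=> c; rewrite /= -subr_gt0 => e0; exists (cnorm (c - cpt R x.2.1) - ratr x.2.2) => // y yc.
have := cnormD (c - y) (y - cpt R x.2.1); rewrite addrA subrK [cnorm (c - y)]cnormB /=; lra.
Qed.

Lemma measurable_Ft :
  measurable_fun setT (fun w : OmegaP => Ft w : borel (cadlag R (confmap R))).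
Proof.
apply: (@measurability _ _ OmegaP (borel (cadlag R (confmap R))) setT _
  (@open (cadlag R (confmap R)))) => // _ [U oU <-]; rewrite setTI.
apply: (@measurable_skorohod_open R (confmap R) _ (@obeys_all R)) => //.
- exact: closed_obeys_all.
- exact: confmap_network.
- exact: measurable_obeys_all.
Qed.

End uniqueness.

Theorem theorem3p1 (R : realType) (mu1 mu2 : probability (Omega R) R)
    (h1 : backward_SHL0 mu1) (h2 : backward_SHL0 mu2) :
  forall A : set (Omega R), measurable A -> mu1 A = mu2 A.
Proof.
move=> A mA.
apply: (Pevents_eq (SHL_poisson h1) (SHL_poisson h2) mA).
rewrite -measurable_PeventsE.
(* Pairing [Pt] and [Ft] gives the identity map, measurable from [OmegaP] to [Omega]; so every event
   of the product sigma-algebra is in [Pevents]. *)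
have := measurable_fun_pair (measurable_Pt (SHL_poisson h1) (SHL_poisson h2))
  (measurable_Ft h1 h2).
move=> /(_ measurableT A mA); rewrite setTI.
rewrite (_ : _ @^-1` A = A)//.
by apply/seteqP; split=> -[].
Qed.
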